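(* Let $f\in\mathcal A_c(\mathbb R^2)$, let $F\in\mathcal B_c(\overline{\mathbb R}^2)$ be its primitive and let $g\in\mathcal{HKBV}(\overline{\mathbb R}^2)$. Then: (a) $f\ast g$ exists on $\mathbb R^2$. (b) $f\ast g=g\ast f$. (c) $\lVert f\ast g\rVert_\infty\le\lVert f\rVert\,\lVert g\rVert_{bv}$. (d) $f\ast g\in C(\overline{\mathbb R}^2)$. Let $\epsilon_1,\epsilon_2\in\{+,-\}$. Then $$\lim_{x\to\epsilon_1\infty,\ y\to\epsilon_2\infty}f\ast g(x,y)=g(\epsilon_1\infty,\epsilon_2\infty)\,F(\infty,\infty).$$ (e) If $h\in L^1(\mathbb R^2)$ then $f\ast(g\ast h)=(f\ast g)\ast h\in C(\overline{\mathbb R}^2)$.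
   Context: $\overline{\mathbb R}=[-\infty,\infty]$ is the two-point compactification of $\mathbb R$, $\overline{\mathbb R}^2$ carries the product topology, and $C(\overline{\mathbb R}^2)$ is the set of continuous real-valued functions on it; a function defined on $\mathbb R^2$ is said to be in $C(\overline{\mathbb R}^2)$ if it extends continuously to $\overline{\mathbb R}^2$. $\mathcal B_c(\overline{\mathbb R}^2)=\{F\in C(\overline{\mathbb R}^2)\mid F(-\infty,s)=F(s,-\infty)=0\ \forall s\in\overline{\mathbb R}\}$. $\partial_{12}=\partial_1\partial_2$ is the distributional derivative on $\mathbb R^2$, and $\mathcal A_c(\mathbb R^2)=\{\partial_{12}F\mid F\in\mathcal B_c(\overline{\mathbb R}^2)\}\subset\mathcal D'(\mathbb R^2)$; the primitive $F\in\mathcal B_c(\overline{\mathbb R}^2)$ of $f=\partial_{12}F$ is unique and the Alexiewicz norm is $\lVert f\rVert=\lVert F\rVert_\infty$. For every $G\in C(\overline{\mathbb R}^2)$, $\partial_{12}G\in\mathcal A_c(\mathbb R^2)$. Hardy--Krause variation: a division of $\overline{\mathbb R}^2$ is a finite collection of closed intervals with union $\overline{\mathbb R}^2$ whose pairwise intersections have planar Lebesgue measure zero. For $g:\overline{\mathbb R}^2\to\mathbb R$, $V_{12}g=\sup\sum_i|g(a_i,c_i)+g(b_i,d_i)-g(a_i,d_i)-g(b_i,c_i)|$ over all divisions $\{[a_i,b_i]\times[c_i,d_i]\}$ of $\overline{\mathbb R}^2$; $V_1g(\cdot,y_0)$ and $V_2g(x_0,\cdot)$ are the one-variable total variations over $\overline{\mathbb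 R}$ of $x\mapsto g(x,y_0)$ and $y\mapsto g(x_0,y)$. $\mathcal{HKBV}(\overline{\mathbb R}^2)$ is the set of $g$ with $V_{12}g<\infty$ and, for some $x_0,y_0\in\overline{\mathbb R}$, $V_1g(\cdot,y_0)<\infty$ and $V_2g(x_0,\cdot)<\infty$. Here $\lVert V_1g\rVert_\infty=\sup_{y}V_1g(\cdot,y)$, $\lVert V_2g\rVert_\infty=\sup_xV_2g(x,\cdot)$, and $\lVert g\rVert_{bv}=\lVert g\rVert_\infty+\lVert V_1g\rVert_\infty+\lVert V_2g\rVert_\infty+V_{12}g$. Stieltjes integrals are Henstock--Stieltjes integrals: a gauge $\gamma$ assigns to each point an open set containing it (contained in $\mathbb R^2$ for points of $\mathbb R^2$); a tagged division $\{[a_i,b_i]\times[c_i,d_i],(x_i,y_i)\}$ (tag in its interval) is $\gamma$-fine if each interval is contained in $\gamma$ of its tag; $\iint F\,d_{12}g=A$ means for every $\epsilon>0$ there is a gauge $\gamma$ such that $|\sum_iF(x_i,y_i)[g(a_i,c_i)+g(b_i,d_i)-g(a_i,d_i)-g(b_i,c_i)]-A|<\epsilon$ for each $\gamma$-fine tagged division of the interval of integration. $d_1$ and $d_2$ denote the analogous one-variable integrals with respect to the first, resp. second, variable. The integral of the product $fg$ is defined by integration by parts: for $f\in\mathcal A_c(\mathbb R^2)$ with primitive $F\in\mathcal B_c(\overline{\mathbb R}^2)$ and $g\in\mathcal{HKBV}(\overline{\mathbb R}^2)$, $\int_{-\infty}^\infty\int_{-\infty}^\infty fg:=F(\infty,\infty)g(\infty,\infty)-\int_{-\infty}^\infty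 F(s,\infty)\,d_1g(s,\infty)-\int_{-\infty}^\infty F(\infty,t)\,d_2g(\infty,t)+\int_{-\infty}^\infty\int_{-\infty}^\infty F\,d_{12}g$. Convolution: for fixed $(x,y)\in\mathbb R^2$ the function $(s,t)\mapsto F(x-s,y-t)$ is in $C(\overline{\mathbb R}^2)$, and $(s,t)\mapsto f(x-s,y-t)$ denotes its derivative $\partial_{12}$ in $(s,t)$, an element of $\mathcal A_c(\mathbb R^2)$. Then $f\ast g(x,y)=\int_{-\infty}^\infty\int_{-\infty}^\infty f(x-s,y-t)g(s,t)\,dt\,ds$ and $g\ast f(x,y)=\int_{-\infty}^\infty\int_{-\infty}^\infty f(s,t)g(x-s,y-t)\,dt\,ds$, where $x-(\pm\infty)=\mp\infty$. For $h\in L^1(\mathbb R^2)$ and bounded measurable $k$, $k\ast h(x,y)=\int_{-\infty}^\infty\int_{-\infty}^\infty k(x-s,y-t)h(s,t)\,dt\,ds$ is the Lebesgue convolution; for $k=g\in\mathcal{HKBV}(\overline{\mathbb R}^2)$ the same formula (with $\pm\infty-s=\pm\infty$) defines $g\ast h$ on all of $\overline{\mathbb R}^2$, and $g\ast h\in\mathcal{HKBV}(\overline{\mathbb R}^2)$.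
   Formalization: In (d), the value g(ε1∞,ε2∞) is replaced by the limit of g at that corner through finite points, shown to exist; with the point value the formula fails (g the indicator of (∞,∞) gives f∗g=0). The literal formula is kept when g attains this limit. *)

(* Defs.v *)
From HB Require Import structures.
From mathcomp Require Import all_boot all_order all_algebra.
From mathcomp Require Import all_classical all_reals all_analysis.

Set Implicit Arguments.
Unset Strict Implicit.
Unset Printing Implicit Defensive.

Import Order.TTheory GRing.Theory Num.Theory.
Import numFieldNormedType.Exports.

Local Open Scope classical_set_scope.
Local Open Scope ring_scope.

(* [\bar R] with its library topology is the two-point compactification of
   [R], and [\bar R * \bar R] carries the product topology. *)

Notation lebesgue2 R :=
  (@lebesgue_measure R \x @lebesgue_measure R)%E (only parsing).

Definition embed2 (R : realType) (p : R * R) : \bar R * \bar R :=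
  (p.1%:E, p.2%:E).

(* Values in the extended reals, so that [+oo] means "unbounded". *)
Definition supnorm (R : realType) (T : Type) (h : T -> R) : \bar R :=
  ereal_sup [set (`|h t|)%:E | t in [set: T]].

Definition extends_continuously (R : realType) (h : R * R -> R) : Prop :=
  exists H : \bar R * \bar R -> R,
    continuous H /\ forall p, H (embed2 p) = h p.

Definition pd1 (R : realType) (phi : R * R -> R) : R * R -> R :=
  fun p => derive1 (fun s => phi (s, p.2)) p.1.

Definition pd2 (R : realType) (phi : R * R -> R) : R * R -> R :=
  fun p => derive1 (fun t => phi (p.1, t)) p.2.

(* The mixed partial derivative along the word [w]: [false] stands for the
   first variable, [true] for the second one. *)
Definition iter_pd (R : realType) (w : seq bool) (phi : R * R -> R) :
  R * R -> R := foldr (fun b => if b then @pd2 R else @pd1 R) phi w.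

(* [derive1] is a total operator, hence the derivability requirements. *)
Definition smooth2 (R : realType) (phi : R * R -> R) : Prop :=
  forall w : seq bool,
    continuous (iter_pd w phi) /\
    forall p, derivable (fun s => iter_pd w phi (s, p.2)) p.1 1 /\
              derivable (fun t => iter_pd w phi (p.1, t)) p.2 1.

Record testfun (R : realType) := TestFun {
  testfun_fun :> R * R -> R;
  testfun_smooth : smooth2 testfun_fun;
  testfun_support : compact (closure [set p | testfun_fun p != 0]) }.

(* Distributions are compared as functionals on test functions.  Linearity and
   continuity are not imposed on this ambient type: they hold automatically
   for the functionals [dist12 F] with [F] continuous, the only ones used. *)
Definition functional (R : realType) : Type := testfun R -> R.

(* <d_1 d_2 F, phi> = - <d_2 F, d_1 phi> = <F, d_2 d_1 phi>. *)
Definition dist12 (R : realType) (F : \bar R * \bar R -> R) : functional R :=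
  fun phi => \int[(lebesgue2 R)]_p (F (embed2 p) * pd2 (pd1 phi) p).

Definition Bc (R : realType) : set (\bar R * \bar R -> R) :=
  [set F | continuous F /\
           forall s : \bar R, F (-oo%E, s) = 0 /\ F (s, -oo%E) = 0].

Definition Ac (R : realType) : set (functional R) :=
  [set f | exists2 F, Bc F & f = dist12 F].

(* The primitive of an element of [Ac] is unique; outside [Ac] this is the
   zero function. *)
Definition primitive (R : realType) (f : functional R) :
  \bar R * \bar R -> R :=
  xget (fun=> 0) [set F | Bc F /\ f = dist12 F].

Definition alexiewicz (R : realType) (f : functional R) : \bar R :=
  supnorm (primitive f).

(* [(a, b)] stands for the closed interval [a, b] of the extended line, and
   [(I, J)] for the rectangle with sides [I] and [J]. *)
Definition itv1 (R : realType) : Type := (\bar R * \bar R)%type.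
Definition itv2 (R : realType) : Type := (itv1 R * itv1 R)%type.

Definition iset1 (R : realType) (I : itv1 R) : set (\bar R) :=
  [set x | (I.1 <= x <= I.2)%E].

Definition iset2 (R : realType) (I : itv2 R) : set (\bar R * \bar R) :=
  iset1 I.1 `*` iset1 I.2.

Definition proper_itv1 (R : realType) (I : itv1 R) : Prop := (I.1 < I.2)%E.

(* Lebesgue measure ignores the points at infinity. *)
Definition division1 (R : realType) (n : nat) (I : 'I_n -> itv1 R) : Prop :=
  [/\ forall i, proper_itv1 (I i),
      \bigcup_i iset1 (I i) = [set: \bar R] &
      forall i j, i != j ->
        @lebesgue_measure R
          ((@EFin R) @^-1` (iset1 (I i) `&` iset1 (I j))) = 0%E].

Definition division2 (R : realType) (n : nat) (I : 'I_n -> itv2 R) : Prop :=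
  [/\ forall i, proper_itv1 (I i).1 /\ proper_itv1 (I i).2,
      \bigcup_i iset2 (I i) = [set: \bar R * \bar R] &
      forall i j, i != j ->
        (lebesgue2 R) ((@embed2 R) @^-1` (iset2 (I i) `&` iset2 (I j))) = 0%E].

Definition incr1 (R : realType) (g : \bar R -> R) (I : itv1 R) : R :=
  g I.2 - g I.1.

Definition incr2 (R : realType) (g : \bar R * \bar R -> R) (I : itv2 R) : R :=
  g (I.1.1, I.2.1) + g (I.1.2, I.2.2) - g (I.1.1, I.2.2) - g (I.1.2, I.2.1).

Definition var1 (R : realType) (g : \bar R -> R) : \bar R :=
  ereal_sup [set v | exists n (I : 'I_n -> itv1 R),
    division1 I /\ v = (\sum_(i < n) `|incr1 g (I i)|)%:E].

Definition V12 (R : realType) (g : \bar R * \bar R -> R) : \bar R :=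
  ereal_sup [set v | exists n (I : 'I_n -> itv2 R),
    division2 I /\ v = (\sum_(i < n) `|incr2 g (I i)|)%:E].

Definition V1 (R : realType) (g : \bar R * \bar R -> R) (y : \bar R) : \bar R :=
  var1 (fun x => g (x, y)).

Definition V2 (R : realType) (g : \bar R * \bar R -> R) (x : \bar R) : \bar R :=
  var1 (fun y => g (x, y)).

Definition HKBV (R : realType) : set (\bar R * \bar R -> R) :=
  [set g | (V12 g < +oo)%E /\
    exists x0 y0 : \bar R, (V1 g y0 < +oo)%E /\ (V2 g x0 < +oo)%E].

Definition bvnorm (R : realType) (g : \bar R * \bar R -> R) : \bar R :=
  (supnorm g + ereal_sup (range (V1 g)) + ereal_sup (range (V2 g))
   + V12 g)%E.

Definition gauge1 (R : realType) (gam : \bar R -> set (\bar R)) : Prop :=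
  (forall x, open (gam x) /\ gam x x) /\
  forall r : R, gam r%:E `<=` range (@EFin R).

Definition gauge2 (R : realType)
    (gam : \bar R * \bar R -> set (\bar R * \bar R)) : Prop :=
  (forall z, open (gam z) /\ gam z z) /\
  forall p : R * R, gam (embed2 p) `<=` range (@embed2 R).

Definition fine_division1 (R : realType) (gam : \bar R -> set (\bar R)) (n : nat)
    (I : 'I_n -> itv1 R) (tag : 'I_n -> \bar R) : Prop :=
  division1 I /\
  forall i, iset1 (I i) (tag i) /\ iset1 (I i) `<=` gam (tag i).

Definition fine_division2 (R : realType)
    (gam : \bar R * \bar R -> set (\bar R * \bar R)) (n : nat)
    (I : 'I_n -> itv2 R) (tag : 'I_n -> \bar R * \bar R) : Prop :=
  division2 I /\
  forall i, iset2 (I i) (tag i) /\ iset2 (I i) `<=` gam (tag i).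

Definition is_HS1 (R : realType) (F g : \bar R -> R) (A : R) : Prop :=
  forall eps : R, 0 < eps -> exists gam, gauge1 gam /\
    forall n (I : 'I_n -> itv1 R) tag, fine_division1 gam I tag ->
      `|\sum_(i < n) F (tag i) * incr1 g (I i) - A| < eps.

Definition is_HS2 (R : realType) (F g : \bar R * \bar R -> R) (A : R) : Prop :=
  forall eps : R, 0 < eps -> exists gam, gauge2 gam /\
    forall n (I : 'I_n -> itv2 R) tag, fine_division2 gam I tag ->
      `|\sum_(i < n) F (tag i) * incr2 g (I i) - A| < eps.

(* [is_iint f g v]: the integral of [f g] exists and its value is [v]. *)
Definition is_iint (R : realType) (f : functional R)
    (g : \bar R * \bar R -> R) (v : R) : Prop :=
  Ac f /\
  let F := primitive f in
  exists A1 A2 A12 : R,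
    [/\ is_HS1 (fun s => F (s, +oo%E)) (fun s => g (s, +oo%E)) A1,
        is_HS1 (fun t => F (+oo%E, t)) (fun t => g (+oo%E, t)) A2,
        is_HS2 F g A12 &
        v = F (+oo%E, +oo%E) * g (+oo%E, +oo%E) - A1 - A2 + A12].

Definition iint_exists (R : realType) (f : functional R)
    (g : \bar R * \bar R -> R) : Prop := exists v, is_iint f g v.

Definition iint (R : realType) (f : functional R)
    (g : \bar R * \bar R -> R) : R := xget 0 [set v | is_iint f g v].

(* (s, t) |-> G (x - s, y - t); [r%:E - +oo = -oo] and [r%:E - -oo = +oo]. *)
Definition reflect2 (R : realType) (G : \bar R * \bar R -> R) (p : R * R) :
  \bar R * \bar R -> R :=
  fun z => G ((p.1%:E - z.1)%E, (p.2%:E - z.2)%E).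

(* (s, t) |-> f (x - s, y - t). *)
Definition reflect_dist (R : realType) (f : functional R) (p : R * R) :
  functional R := dist12 (reflect2 (primitive f) p).

(* [Aconv f g] is f * g and [Arconv g f] is g * f: only one of the two factors
   is a function. *)
Definition Aconv_exists (R : realType) (f : functional R)
    (g : \bar R * \bar R -> R) (p : R * R) : Prop :=
  iint_exists (reflect_dist f p) g.

Definition Aconv (R : realType) (f : functional R)
    (g : \bar R * \bar R -> R) (p : R * R) : R := iint (reflect_dist f p) g.

Definition Arconv_exists (R : realType) (g : \bar R * \bar R -> R)
    (f : functional R) (p : R * R) : Prop := iint_exists f (reflect2 g p).

Definition Arconv (R : realType) (g : \bar R * \bar R -> R)
    (f : functional R) (p : R * R) : R := iint f (reflect2 g p).

Definition Lconv (R : realType) (k h : R * R -> R) (p : R * R) : R :=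
  \int[(lebesgue2 R)]_q (k (p.1 - q.1, p.2 - q.2) * h q).

(* [Lconv_ext]: here an infinite coordinate is left fixed by the shift. *)
Definition Lconv_ext (R : realType) (g : \bar R * \bar R -> R)
    (h : R * R -> R) (z : \bar R * \bar R) : R :=
  \int[(lebesgue2 R)]_q (g ((z.1 - q.1%:E)%E, (z.2 - q.2%:E)%E) * h q).

Definition L1 (R : realType) : set (R * R -> R) :=
  [set h | (lebesgue2 R).-integrable setT (EFin \o h)].

(* [true] stands for the sign +, [false] for the sign -. *)
Definition infty (R : realType) (e : bool) : \bar R :=
  if e then +oo%E else -oo%E.

Definition nbhs_infty (R : realType) (e : bool) : set_system R :=
  if e then pinfty_nbhs R else ninfty_nbhs R.

(* x -> e1 oo, y -> e2 oo, independently and through finite values. *)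
Definition corner (R : realType) (e1 e2 : bool) : set_system (R * R) :=
  filter_prod (@nbhs_infty R e1) (@nbhs_infty R e2).

(* The value of [g] at a corner, taken as a limit through finite points.  It
   may differ from [g (infty e1, infty e2)]: the function equal to 1 at
   (+oo, +oo) and to 0 elsewhere is in [HKBV] but its convolution with any [f]
   vanishes identically (the four terms of the product integral are
   F(oo, oo) times 1, -1, -1 and 1), so the convolution only sees the
   limit. *)
Definition corner_lim (R : realType) (g : \bar R * \bar R -> R)
    (e1 e2 : bool) : R := lim ((g \o @embed2 R) @ @corner R e1 e2).

(* Main.v *)
Require Import Defs.
From HB Require Import structures.
From mathcomp Require Import all_boot all_order all_algebra.
From mathcomp Require Import all_classical all_reals all_analysis.
From mathcomp Require Import measurable_realfun.
From mathcomp Require Import lra zify.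

(** Every part of the theorem comes from one approximation formula: the
    convolution is a uniform limit of finite sums
      [c_1 * g (p - al_1) + ... + c_n * g (p - al_n)],
    where the real numbers [c_t] and the points [al_t] of the finite plane
    depend on [F] alone and the [c_t] add up to [F (+oo, +oo)]
    ([conv_approx]).

    The formula is a summation by parts.  The primitive [F] is continuous on
    the compact extended plane.  If it oscillates by at most [e] and [e'] on
    the rectangles of two divisions, a grid that refines both shows that
    their Stieltjes sums differ by at most [(e + e') * V12 g] ([compare2]).
    So these sums converge, with a known error for each of them ([RS2_ex]);
    a gauge read off the oscillation of [F] makes the limit a
    Henstock-Stieltjes integral ([RS2_HS2]), and Cousin's lemma ([cousin2])
    makes it the only one.  On a grid whose extreme cells carry the tags
    [-oo] and [+oo], Abel's transformation in both variables ([abel2])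
    collapses the four terms of the product integral into the sum of the
    increments of [F] between consecutive tags, weighted by the values of the
    other factor at the inner, hence finite, points of the grid
    ([product_integral_ex]).  For the factor [reflect2 g p] this is the
    approximation formula.

    Commutativity: reflecting the grid exchanges the approximating sums of
    both products ([mixed_sum_refl]).  Norm: each term of the product
    integral is at most the sup norm of [F] times a term of the norm of [g].
    Limits at infinity:
    [g] is dominated, in each variable, by the increments of a nondecreasing
    function ([HKBV_dominated]); such a function has limits at infinity that
    translations do not change, so the finite sums converge at the corners
    ([corner_cvg]) and are Cauchy at infinity in one variable, uniformly in
    the other ([conv_cauchy]).  At finite points, continuity follows from the
    uniform continuity of the translations of [F] ([reflection_uniform]) and
    from the fact that the product integral is Lipschitz in the primitive.
    Small oscillation near each point of the extended plane is what a
    continuous extension requires ([extend_by_oscillation]).  Associativity: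
    the finite sums commute with the convolution by [h] ([conv_assoc]).

    Since the convolution is defined from distributions, the primitive has to
    be known to be unique ([dist12_inj]).  Tested on products of smooth steps,
    a function annihilated by the mixed derivatives of all test functions has
    zero increments over all rectangles ([mixed_difference_zero]).  The
    primitive of the reflected distribution is [reflect2 F p] corrected by its
    values on the lower edges ([dist12_normalize]): functions of one variable
    have no mixed derivative, by Schwarz's theorem and the fundamental theorem
    of calculus. *)

Set Implicit Arguments.
Unset Strict Implicit.
Unset Printing Implicit Defensive.

Import Order.TTheory GRing.Theory Num.Theory.
Import numFieldNormedType.Exports.

Local Open Scope classical_set_scope.
Local Open Scope ring_scope.

(** * Divisions and grids *)

Section intervals.
Context {R : realType}.
Implicit Types (x y : \bar R) (I J : itv1 R) (K L : itv2 R).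

Lemma ereal_between x y : (x < y)%E -> exists r : R, (x < r%:E < y)%E.
Proof.
case: x y => [r| |] [s| |]//=.
- rewrite lte_fin => rs; exists ((r + s) / 2); rewrite !lte_fin; lra.
- by move=> _; exists (r + 1); rewrite lte_fin ltry; lra.
- by move=> _; exists (s - 1); rewrite lte_fin ltNyr; lra.
- by move=> _; exists 0; rewrite ltry ltNyr.
Qed.

Definition nonoverlap1 I J := ((I.2 <= J.1) || (J.2 <= I.1))%E.

Definition nonoverlap2 K L := nonoverlap1 K.1 L.1 || nonoverlap1 K.2 L.2.

Lemma measurable_trace1 I : measurable ((@EFin R) @^-1` iset1 I).
Proof.
rewrite [X in measurable X](_ : _ =
    ((@EFin R) @^-1` [set` `[I.1, I.2]%E])).
  by rewrite -[X in measurable X]setTI; apply: measurable_realfun.EFin_measurable => //;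
     exact: measurable_realfun.emeasurable_itv.
by apply/seteqP; split => r /=; rewrite /iset1 /= in_itv.
Qed.

(** Two proper intervals that overlap share a whole interval with finite ends,
    of positive length; otherwise they share at most one point. *)
Lemma null_overlap1 I J : proper_itv1 I -> proper_itv1 J ->
  @lebesgue_measure R ((@EFin R) @^-1` (iset1 I `&` iset1 J)) = 0%E <->
  nonoverlap1 I J.
Proof.
rewrite /proper_itv1 => pI pJ; split => [|/orP novl].
  apply: contra_eqT; rewrite negb_or -!ltNge => /andP[JI IJ].
  have [r /andP[r1 r2]] : exists r : R,
      (maxe I.1 J.1 < r%:E < mine I.2 J.2)%E.
    by apply: ereal_between; rewrite gt_max !lt_min pI pJ JI IJ.
  have [s /andP[s1 s2]] := ereal_between r2.
  have mm : measurable ((@EFin R) @^-1` (iset1 I `&` iset1 J)).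
    by rewrite preimage_setI; apply: measurableI; exact: measurable_trace1.
  have sub : [set` `[r, s]] `<=` (@EFin R) @^-1` (iset1 I `&` iset1 J).
    move: r1 r2 s1 s2; rewrite !gt_max !lt_min.
    move=> /andP[a1 a2] /andP[a3 a4] a5 /andP[a6 a7] t /=; rewrite in_itv /=.
    move=> /andP[rt ts]; split; rewrite /iset1 /=; apply/andP; split.
    - by apply: le_trans (ltW a1) _; rewrite lee_fin.
    - by apply: le_trans _ (ltW a6); rewrite lee_fin.
    - by apply: le_trans (ltW a2) _; rewrite lee_fin.
    - by apply: le_trans _ (ltW a7); rewrite lee_fin.
  have h : (@lebesgue_measure R [set` `[r, s]] <=
      @lebesgue_measure R ((@EFin R) @^-1` (iset1 I `&` iset1 J)))%E.
    by apply: le_measure => //; rewrite inE//; exact: measurable_itv.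
  move: h; rewrite lebesgue_measure_itv /= s1 => h; rewrite gt_eqF//.
  by apply: lt_le_trans h; rewrite -EFinB lte_fin subr_gt0.
have sub : exists c, (iset1 I `&` iset1 J) `<=` [set c].
  rewrite /iset1; case: novl => h.
    exists I.2 => z [/= /andP[_ z1] /andP[z2 _]].
    by apply/le_anti; rewrite z1 (le_trans h).
  exists J.2 => z [/= /andP[z2 _] /andP[_ z1]].
  by apply/le_anti; rewrite z1 (le_trans h).
have [c cP] := sub.
apply/eqP; rewrite eq_le measure_ge0 andbT.
rewrite -(lebesgue_measure_set1 (fine c)); apply: le_measure; rewrite ?inE//.
  by rewrite preimage_setI; apply: measurableI; exact: measurable_trace1.
by move=> r /cP <-.
Qed.

(** The overlap of two rectangles is the product of the overlaps of their
    sides, and a product is null exactly when one of its factors is. *)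
Lemma null_overlap2 K L : proper_itv1 K.1 -> proper_itv1 K.2 ->
  proper_itv1 L.1 -> proper_itv1 L.2 ->
  (lebesgue2 R) ((@embed2 R) @^-1` (iset2 K `&` iset2 L)) = 0%E <->
  nonoverlap2 K L.
Proof.
move=> pK1 pK2 pL1 pL2.
have -> : (@embed2 R) @^-1` (iset2 K `&` iset2 L) =
    ((@EFin R) @^-1` (iset1 K.1 `&` iset1 L.1)) `*`
    ((@EFin R) @^-1` (iset1 K.2 `&` iset1 L.2)).
  by apply/seteqP; split => -[r s] /= [] [? ?] [].
rewrite product_measure1E; do 1?by rewrite preimage_setI;
  apply: measurableI; exact: measurable_trace1.
split => [/eqP|/orP[] h]; last 2 first.
- rewrite [X in (X * _)%E](_ : _ = 0%E) ?mul0e//.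
  exact: (null_overlap1 pK1 pL1).2.
- rewrite [X in (_ * X)%E](_ : _ = 0%E) ?mule0//.
  exact: (null_overlap1 pK2 pL2).2.
rewrite mule_eq0 => /orP[] /eqP h; apply/orP; [left|right].
- exact: (null_overlap1 pK1 pL1).1.
- exact: (null_overlap1 pK2 pL2).1.
Qed.

(** Measure disappears from divisions here: only the order of the end points
    is left. *)
Lemma division1P n (I : 'I_n -> itv1 R) : division1 I <->
  [/\ forall i, proper_itv1 (I i),
      forall x, exists i, iset1 (I i) x &
      forall i j, i != j -> nonoverlap1 (I i) (I j)].
Proof.
split=> -[pI cI nI]; split => //.
- move=> x; have : [set: \bar R] x by [].
  by rewrite -cI => -[i _ ?]; exists i.
- by move=> i j /nI h; apply/null_overlap1.
- by apply/seteqP; split => // x _; have [i] := cI x; exists i.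
- by move=> i j /nI h; apply/null_overlap1.
Qed.

Lemma division2P n (I : 'I_n -> itv2 R) : division2 I <->
  [/\ forall i, proper_itv1 (I i).1 /\ proper_itv1 (I i).2,
      forall z, exists i, iset2 (I i) z &
      forall i j, i != j -> nonoverlap2 (I i) (I j)].
Proof.
split=> -[pI cI nI]; split => //.
- move=> x; have : [set: \bar R * \bar R] x by [].
  by rewrite -cI => -[i _ ?]; exists i.
- by move=> i j /nI h; have [? ?] := pI i; have [? ?] := pI j;
    apply/null_overlap2.
- by apply/seteqP; split => // x _; have [i] := cI x; exists i.
- by move=> i j /nI h; have [? ?] := pI i; have [? ?] := pI j;
    apply/null_overlap2.
Qed.

(** Grids and columns are more naturally indexed by products and dependent
    pairs than by ordinals. *)
Lemma division2_fin (T : finType) (I : T -> itv2 R) :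
  (forall i, proper_itv1 (I i).1 /\ proper_itv1 (I i).2) ->
  (forall z, exists i, iset2 (I i) z) ->
  (forall i j, i != j -> nonoverlap2 (I i) (I j)) ->
  division2 (fun i : 'I_#|T| => I (enum_val i)).
Proof.
move=> pI cI nI; apply/division2P; split => //.
- by move=> z; have [i] := cI z; exists (enum_rank i); rewrite enum_rankK.
- by move=> i j ij; apply: nI; rewrite (inj_eq enum_val_inj).
Qed.

(** The points of a grid are a function on [nat], of which only the values at
    [0], ..., [n] matter; consecutive cells then need no casts between
    ordinals. *)
Definition is_grid (n : nat) (a : nat -> \bar R) :=
  [/\ a 0%N = -oo%E, a n = +oo%E & forall i, (i < n)%N -> (a i < a i.+1)%E].

Definition cell1 (a : nat -> \bar R) (i : nat) : itv1 R := (a i, a i.+1).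

Definition cell2 (a b : nat -> \bar R) (i j : nat) : itv2 R :=
  (cell1 a i, cell1 b j).

Lemma grid_lt n a i j : is_grid n a -> (i < j <= n)%N -> (a i < a j)%E.
Proof.
move=> [_ _ ga]; elim: j => // j ih /andP[]; rewrite ltnS leq_eqVlt.
move=> /orP[/eqP <- jn|ij jn]; first exact: ga.
by apply: (lt_trans (ih _) (ga _ jn)); rewrite ij ltnW.
Qed.

Lemma grid_le n a i j : is_grid n a -> (i <= j <= n)%N -> (a i <= a j)%E.
Proof.
move=> ga; rewrite leq_eqVlt => /andP[/orP[/eqP ->//|ij] jn].
by apply/ltW/(grid_lt ga); rewrite ij jn.
Qed.

Lemma grid_leE n a i j : is_grid n a -> (i <= n)%N -> (j <= n)%N ->
  (a i <= a j)%E = (i <= j)%N.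
Proof.
move=> ga in_ jn; apply/idP/idP => [|ij]; last by apply: (grid_le ga); rewrite ij.
by apply: contraTT; rewrite -ltnNge -ltNge => ji; apply: (grid_lt ga); rewrite ji.
Qed.

Lemma grid_pos n a : is_grid n a -> (0 < n)%N.
Proof. by move=> [a0 an _]; case: n an => //; rewrite a0. Qed.

Lemma grid_cover n a x : is_grid n a ->
  exists2 i, (i < n)%N & iset1 (cell1 a i) x.
Proof.
move=> ga; have [a0 an _] := ga.
have : exists i, (a i <= x)%E && (i < n)%N.
  by exists 0%N; rewrite a0 leNye (grid_pos ga).
move=> exi; have bd i : (a i <= x)%E && (i < n)%N -> (i <= n)%N by move=> /andP[_ /ltnW].
have [i /andP[aix in_] maxi] := ex_maxnP exi bd.
exists i => //; rewrite /iset1 /= aix /=.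
have [lt|] := ltnP i.+1 n; last first.
  by move=> h; rewrite (_ : i.+1 = n) ?an ?leey//; lia.
by rewrite leNgt; apply/negP => /ltW xi; have := maxi i.+1; rewrite xi lt => /(_ isT); lia.
Qed.

Lemma grid_nonoverlap n a i j : is_grid n a -> (i < n)%N -> (j < n)%N -> i != j ->
  nonoverlap1 (cell1 a i) (cell1 a j).
Proof.
move=> ga in_ jn; rewrite neq_ltn /nonoverlap1 /= => /orP[] h.
  by rewrite (grid_le ga)// h /= ltnW.
by rewrite orbC (grid_le ga)// h /= ltnW.
Qed.

Lemma grid_division1 n a : is_grid n a ->
  division1 (fun i : 'I_n => cell1 a i).
Proof.
move=> ga; apply/division1P; split.
- by move=> i; have [_ _] := ga; apply.
- by move=> x; have [i hi ?] := grid_cover x ga; exists (Ordinal hi).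
- by move=> i j ij; exact: (grid_nonoverlap ga).
Qed.

(** Cousin's lemma in the plane yields divisions of this shape: each column is
    cut at heights of its own. *)
Lemma column_division2 n a (m : nat -> nat) (b : nat -> nat -> \bar R) :
  is_grid n a -> (forall i, (i < n)%N -> is_grid (m i) (b i)) ->
  let T := {i : 'I_n & 'I_(m i)} in
  division2 (fun k : 'I_#|{: T}| => let t := enum_val k in
     (cell1 a (tag t), cell1 (b (tag t)) (tagged t))).
Proof.
move=> ga gb T.
pose I (t : T) : itv2 R := (cell1 a (tag t), cell1 (b (tag t)) (tagged t)).
apply: (@division2_fin T I).
- move=> [i j] /=; split; first by have [_ _] := ga; apply.
  by have [_ _] := gb i (ltn_ord i); apply.
- move=> [x y]; have [i hi Ix] := grid_cover x ga.
  have [j hj Jy] := grid_cover y (gb i hi).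
  by exists (Tagged (fun i : 'I_n => 'I_(m i)) (Ordinal hj : 'I_(m (Ordinal hi)))).
- move=> [i j] [i' j'] ne; rewrite /nonoverlap2 /=.
  have [ii'|ii'] := eqVneq i i'; last by rewrite (grid_nonoverlap ga).
  apply/orP; right; subst i'.
  apply: (grid_nonoverlap (gb i (ltn_ord i))) => //.
  by apply: contraNneq ne => /val_inj ->.
Qed.

Lemma grid_division2 n a m b : is_grid n a -> is_grid m b ->
  division2 (fun k : 'I_#|{: 'I_n * 'I_m}| =>
    cell2 a b (enum_val k).1 (enum_val k).2).
Proof.
move=> ga gb.
apply: (@division2_fin ('I_n * 'I_m)%type (fun c => cell2 a b c.1 c.2)).
- by move=> [i j]; have [_ _ ha] := ga; have [_ _ hb] := gb; split;
    [apply: ha|apply: hb].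
- move=> [x y]; have [i hi Ix] := grid_cover x ga.
  by have [j hj Jy] := grid_cover y gb; exists (Ordinal hi, Ordinal hj).
- move=> [i j] [i' j']; rewrite xpair_eqE negb_and /nonoverlap2 => /orP[] h /=.
    by rewrite (grid_nonoverlap ga).
  by apply/orP; right; rewrite (grid_nonoverlap gb).
Qed.

(** The given points are sorted together with both infinities. *)
Lemma grid_through (X : seq (\bar R)) : exists n a,
  is_grid n a /\ forall x, x \in X -> exists2 i, (i <= n)%N & a i = x.
Proof.
pose Y := sort <=%O (undup (-oo%E :: +oo%E :: X)).
have memY x : x \in Y = (x \in -oo%E :: +oo%E :: X) by rewrite mem_sort mem_undup.
have sY : sorted <%O Y by rewrite sort_lt_sorted undup_uniq.
have sY' : sorted <=%O Y by exact: sort_le_sorted.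
have szY : (0 < size Y)%N.
  by have : -oo%E \in Y by [rewrite memY inE eqxx]; case: (Y).
exists (size Y).-1, (nth +oo%E Y); split; last first.
  move=> x xX; have xY : x \in Y by rewrite memY !inE xX !orbT.
  exists (index x Y); last by rewrite nth_index.
  by rewrite -ltnS prednK // index_mem.
have ix (x : \bar R) : x \in Y -> exists2 i, (i < size Y)%N & nth +oo%E Y i = x.
  by move=> xY; exists (index x Y); rewrite ?index_mem ?nth_index.
split.
- have [|i hi ei] := ix (-oo%E); first by rewrite memY inE eqxx.
  apply/eqP; rewrite -leeNy_eq -ei.
  by apply: (sorted_leq_nth le_trans le_refl) => //; rewrite inE.
- have [|i hi ei] := ix (+oo%E); first by rewrite memY !inE eqxx orbT.
  have h : (nth +oo%E Y i <= nth +oo%E Y (size Y).-1)%E.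
    apply: (sorted_leq_nth le_trans le_refl) => //; rewrite ?inE //; lia.
  by apply/eqP; rewrite -leye_eq -{1}ei.
- move=> i hi; apply: (sorted_ltn_nth lt_trans) => //; rewrite inE; lia.
Qed.

Definition inside (I J : itv1 R) := ((J.1 <= I.1) && (I.2 <= J.2))%E.

Definition on_grid n (a : nat -> \bar R) x := exists2 i, (i <= n)%N & a i = x.

(** The increments over the cells of [I] telescope. *)
Lemma incr1_cells n a (u : \bar R -> R) I : is_grid n a ->
  on_grid n a I.1 -> on_grid n a I.2 -> (I.1 <= I.2)%E ->
  incr1 u I = \sum_(k < n | inside (cell1 a k) I) incr1 u (cell1 a k).
Proof.
move=> ga [p pn ap] [q qn aq] I12; rewrite /incr1 -ap -aq.
have pq : (p <= q)%N by rewrite -(grid_leE ga)// ap aq.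
rewrite -(telescope_sumr (u \o a))//= -(big_mkord (fun k => inside (cell1 a k) I)
  (fun k => u (a k.+1) - u (a k))).
rewrite [RHS](big_cat_nat (n := p))//= ?(leq_trans pq)//.
rewrite [X in _ = _ + X](big_cat_nat (n := q))//=.
rewrite [X in _ = X + _]big_nat_cond [X in _ = X + _]big_pred0 ?add0r; last first.
  move=> k; apply/negP => /andP[/= kp]; rewrite /inside /= -ap.
  by rewrite (grid_leE ga) ?(leq_trans (ltnW kp))//; lia.
rewrite [X in _ = _ + X]big_nat_cond [X in _ = _ + X]big_pred0 ?addr0; last first.
  move=> k; apply/negP => /andP[/= /andP[qk kn]]; rewrite /inside /= -aq.
  by rewrite andbC (grid_leE ga) //; lia.
rewrite big_nat_cond [RHS]big_nat_cond; apply: eq_bigl => k.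
have [/andP[pk kq]|] := boolP (p <= k < q)%N; last by [].
rewrite /inside /= -ap -aq !(grid_leE ga)//; lia.
Qed.

(** An increment over a rectangle is an increment, in one variable, of an
    increment in the other; it telescopes in each of them. *)
Lemma incr2_cells n a m b (g : \bar R * \bar R -> R) (K : itv2 R) :
  is_grid n a -> is_grid m b ->
  on_grid n a K.1.1 -> on_grid n a K.1.2 -> (K.1.1 <= K.1.2)%E ->
  on_grid m b K.2.1 -> on_grid m b K.2.2 -> (K.2.1 <= K.2.2)%E ->
  incr2 g K =
  \sum_(c : 'I_n * 'I_m | inside (cell1 a c.1) K.1 && inside (cell1 b c.2) K.2)
    incr2 g (cell2 a b c.1 c.2).
Proof.
move=> ga gb a1 a2 aa b1 b2 bb.
rewrite -(pair_big (fun k : 'I_n => inside (cell1 a k) K.1)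
  (fun l : 'I_m => inside (cell1 b l) K.2)
  (fun k l => incr2 g (cell2 a b k l))) /=.
pose v s := g (s, K.2.2) - g (s, K.2.1).
transitivity (incr1 v K.1); first by rewrite /incr2 /incr1 /v; lra.
rewrite (incr1_cells v ga a1 a2 aa); apply: eq_bigr => k _.
pose w t := g (a k.+1, t) - g (a k, t).
transitivity (incr1 w K.2); first by rewrite /incr1 /v /w /=; lra.
rewrite (incr1_cells w gb b1 b2 bb); apply: eq_bigr => l _.
by rewrite /incr1 /incr2 /w /=; lra.
Qed.

Lemma cell_nonoverlap n a i I J : is_grid n a -> (i < n)%N ->
  inside (cell1 a i) I -> inside (cell1 a i) J -> nonoverlap1 I J -> False.
Proof.
move=> [_ _ ga] /ga; rewrite /inside /nonoverlap1 /= => h.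
move=> /andP[i1 i2] /andP[j1 j2] /orP[] k.
  by move: h; rewrite ltNge (le_trans i2 (le_trans k j1)).
by move: h; rewrite ltNge (le_trans j2 (le_trans k i1)).
Qed.

(** The ends of [I] are points of the grid, none of which lies strictly inside
    a cell; so a single inner point of the cell decides. *)
Lemma cell_inside n a i I r : is_grid n a -> (i < n)%N ->
  on_grid n a I.1 -> on_grid n a I.2 ->
  (a i < r%:E < a i.+1)%E -> iset1 I r%:E -> inside (cell1 a i) I.
Proof.
move=> ga hi [p pn ep] [q qn eq_] /andP[r1 r2].
rewrite /iset1 /inside /= -ep -eq_ => /andP[r3 r4].
have h1 : (p < i.+1)%N.
  by rewrite ltnNge -(grid_leE ga)// -ltNge (le_lt_trans r3).
have h2 : (i < q)%N.
  by rewrite ltnNge -(grid_leE ga)// ?(ltnW hi)// -ltNge (lt_le_trans r1).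
by rewrite !(grid_leE ga)//; lia.
Qed.

End intervals.

(** * Comparison of Stieltjes sums *)

Section sums_over_cells.
Context {R : realType}.

(** The sets [P i] are disjoint, so that each weight is counted at most once.
    *)
Lemma pack_cells (C T : finType) (P : T -> pred C) (w : C -> R) :
  (forall c, 0 <= w c) -> (forall i j c, P i c -> P j c -> i = j) ->
  \sum_i \sum_(c | P i c) w c <= \sum_c w c.
Proof.
move=> w0 P1; rewrite (exchange_big_dep predT)//=; apply: ler_sum => c _.
have [i Pi|P0] := pickP (fun i => P i c); last by rewrite big_pred0.
by rewrite (big_pred1 i)// => j; apply/idP/eqP => [Pj|->//]; exact: (P1 _ _ c).
Qed.

Lemma regroup_cells (C T : finType) (P : T -> pred C) (phi : C -> T)
    (w : T -> R) (mu : C -> R) : (forall i c, P i c = (phi c == i)) ->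
  \sum_i w i * \sum_(c | P i c) mu c = \sum_c w (phi c) * mu c.
Proof.
move=> hP; under eq_bigr do rewrite big_distrr /=.
rewrite (exchange_big_dep predT)//=; apply: eq_bigr => c _.
by rewrite (big_pred1 (phi c))// => i; rewrite hP eq_sym.
Qed.

Lemma compare_cells (C : finType) (u v mu : C -> R) (e V : R) :
  (forall c, `|u c - v c| <= e) -> \sum_c `|mu c| <= V -> 0 <= e ->
  `|\sum_c u c * mu c - \sum_c v c * mu c| <= e * V.
Proof.
move=> uv muV e0; rewrite -sumrB; apply: le_trans (ler_norm_sum _ _ _) _.
apply: le_trans (ler_wpM2l e0 muV); rewrite mulr_sumr; apply: ler_sum => c _.
by rewrite -mulrBl normrM ler_wpM2r.
Qed.

End sums_over_cells.

Section packing.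
Context {R : realType}.
Implicit Types (u : \bar R -> R) (g : \bar R * \bar R -> R).

Lemma fine_ub (E : set (\bar R)) (r : R) :
  (ereal_sup E < +oo)%E -> E r%:E -> r <= fine (ereal_sup E).
Proof.
move=> fE Er; have h := ereal_sup_ubound Er.
rewrite -lee_fin fineK// fin_numE; apply/andP; split; last by rewrite lt_eqF.
by rewrite gt_eqF// (lt_le_trans _ h)// ltNyr.
Qed.

Lemma var1_ub u n (I : 'I_n -> itv1 R) : (var1 u < +oo)%E -> division1 I ->
  \sum_(i < n) `|incr1 u (I i)| <= fine (var1 u).
Proof. by move=> fu dI; apply: fine_ub => //; exists n, I. Qed.

Lemma V12_ub g n (I : 'I_n -> itv2 R) : (V12 g < +oo)%E -> division2 I ->
  \sum_(i < n) `|incr2 g (I i)| <= fine (V12 g).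
Proof. by move=> fu dI; apply: fine_ub => //; exists n, I. Qed.

Lemma var1_grid u n a : (var1 u < +oo)%E -> is_grid n a ->
  \sum_(i < n) `|incr1 u (cell1 a i)| <= fine (var1 u).
Proof. by move=> fu /grid_division1; exact: var1_ub. Qed.

Lemma V12_grid g n a m b : (V12 g < +oo)%E -> is_grid n a -> is_grid m b ->
  \sum_(c : 'I_n * 'I_m) `|incr2 g (cell2 a b c.1 c.2)| <= fine (V12 g).
Proof.
move=> fg ga gb; apply: le_trans (V12_ub fg (grid_division2 ga gb)).
by rewrite [leLHS]big_enum_val.
Qed.

Definition coords T (I : T -> itv1 R) (s : seq T) :=
  [seq (I i).1 | i <- s] ++ [seq (I i).2 | i <- s].

Lemma grid_coords (T : finType) (I : T -> itv1 R) : exists n a,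
  is_grid n a /\ forall i, on_grid n a (I i).1 /\ on_grid n a (I i).2.
Proof.
have [n [a [ga h]]] := grid_through (coords I (enum T)).
exists n, a; split => // i; split; apply: h; rewrite mem_cat; apply/orP.
  by left; apply/mapP; exists i; rewrite ?mem_enum.
by right; apply/mapP; exists i; rewrite ?mem_enum.
Qed.

(** Intervals that do not overlap are part of a division: a grid through all
    their ends refines them and covers the rest. *)
Lemma var1_pack u (T : finType) (I : T -> itv1 R) : (var1 u < +oo)%E ->
  (forall i, (I i).1 <= (I i).2)%E ->
  (forall i j, i != j -> nonoverlap1 (I i) (I j)) ->
  \sum_i `|incr1 u (I i)| <= fine (var1 u).
Proof.
move=> fu leI nI; have [n [a [ga h]]] := grid_coords I.
apply: le_trans (var1_grid fu ga).
apply: le_trans (pack_cells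
  (P := fun (i : T) (k : 'I_n) => inside (cell1 a k) (I i)) _ _) => //.
  apply: ler_sum => i _; have [h1 h2] := h i.
  by rewrite (incr1_cells u ga h1 h2 (leI i)) ler_norm_sum.
move=> i j k ki kj; apply/eqP/negP => /negP /nI.
exact: (cell_nonoverlap ga (ltn_ord k) ki kj).
Qed.

Lemma V12_pack g (T : finType) (K : T -> itv2 R) : (V12 g < +oo)%E ->
  (forall i, (K i).1.1 <= (K i).1.2)%E -> (forall i, (K i).2.1 <= (K i).2.2)%E ->
  (forall i j, i != j -> nonoverlap2 (K i) (K j)) ->
  \sum_i `|incr2 g (K i)| <= fine (V12 g).
Proof.
move=> fg le1 le2 nK.
have [n [a [ga h]]] := grid_coords (fst \o K).
have [m [b [gb h']]] := grid_coords (snd \o K).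
apply: le_trans (V12_grid fg ga gb).
apply: le_trans (pack_cells (P := fun (i : T) (c : 'I_n * 'I_m) =>
  inside (cell1 a c.1) (K i).1 && inside (cell1 b c.2) (K i).2) _ _) => //.
  apply: ler_sum => i _; have [h1 h2] := h i; have [h3 h4] := h' i.
  by rewrite (incr2_cells g ga gb h1 h2 (le1 i) h3 h4 (le2 i)) ler_norm_sum.
move=> i j c /andP[i1 i2] /andP[j1 j2]; apply/eqP/negP => /negP /nK /orP[].
  exact: (cell_nonoverlap ga (ltn_ord _) i1 j1).
exact: (cell_nonoverlap gb (ltn_ord _) i2 j2).
Qed.

(** The owner of a cell is found by looking at a point strictly inside the
    cell. *)
Lemma cell_owner1 n a N (I : 'I_N -> itv1 R) : is_grid n a -> division1 I ->
  (forall i, on_grid n a (I i).1 /\ on_grid n a (I i).2) ->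
  exists phi : 'I_n -> 'I_N,
    forall i (k : 'I_n), inside (cell1 a k) (I i) = (phi k == i).
Proof.
move=> ga /division1P[pI cI nI] h.
have /choice[phi phiP] : forall k : 'I_n, exists i, inside (cell1 a k) (I i).
  move=> k; have [_ _ /(_ _ (ltn_ord k)) /ereal_between[r hr]] := ga.
  have [i Ii] := cI r%:E; exists i; have [h1 h2] := h i.
  exact: (cell_inside ga (ltn_ord k) h1 h2 hr).
exists phi => i k; apply/idP/eqP => [ki|<-//]; apply/eqP/negP => /negP /nI.
exact: (cell_nonoverlap ga (ltn_ord k)).
Qed.

Lemma cell_owner2 n a m b N (K : 'I_N -> itv2 R) :
  is_grid n a -> is_grid m b -> division2 K ->
  (forall i, on_grid n a (K i).1.1 /\ on_grid n a (K i).1.2) ->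
  (forall i, on_grid m b (K i).2.1 /\ on_grid m b (K i).2.2) ->
  exists phi : 'I_n * 'I_m -> 'I_N, forall i (c : 'I_n * 'I_m),
    inside (cell1 a c.1) (K i).1 && inside (cell1 b c.2) (K i).2 = (phi c == i).
Proof.
move=> ga gb /division2P[pI cI nI] h h'.
have /choice[phi phiP] : forall c : 'I_n * 'I_m, exists i,
    inside (cell1 a c.1) (K i).1 && inside (cell1 b c.2) (K i).2.
  move=> [k l]; have [_ _ /(_ _ (ltn_ord k)) /ereal_between[r hr]] := ga.
  have [_ _ /(_ _ (ltn_ord l)) /ereal_between[s hs]] := gb.
  have [i [/= Ii1 Ii2]] := cI (r%:E, s%:E).
  exists i; have [h1 h2] := h i; have [h3 h4] := h' i.
  rewrite (cell_inside ga (ltn_ord k) h1 h2 hr)//.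
  by rewrite (cell_inside gb (ltn_ord l) h3 h4 hs).
exists phi => i c; apply/idP/eqP => [/andP[i1 i2]|<-//].
have /andP[j1 j2] := phiP c.
apply/eqP/negP => /negP /nI /orP[].
  exact: (cell_nonoverlap ga (ltn_ord c.1) j1 i1).
exact: (cell_nonoverlap gb (ltn_ord c.2) j2 i2).
Qed.

Definition close1 (F : \bar R -> R) n (I : 'I_n -> itv1 R) (t : 'I_n -> \bar R)
  (e : R) := forall i x, iset1 (I i) x -> `|F x - F (t i)| <= e.

Definition close2 (F : \bar R * \bar R -> R) n (K : 'I_n -> itv2 R)
    (t : 'I_n -> \bar R * \bar R) (e : R) :=
  forall i z, iset2 (K i) z -> `|F z - F (t i)| <= e.

Lemma close_dist (a b c e e' : R) :
  `|c - a| <= e -> `|c - b| <= e' -> `|a - b| <= e + e'.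
Proof.
move=> h1 h2; rewrite (_ : a - b = (c - b) - (c - a)); last by lra.
by apply: le_trans (ler_normB _ _) _; rewrite addrC lerD.
Qed.

(** Both sums are rewritten over the cells of a grid through the ends of both
    divisions. On a cell, both values of [F] are close to its value at a point
    of the cell. *)
Lemma compare1 F u n (I : 'I_n -> itv1 R) t e n' (I' : 'I_n' -> itv1 R) t' e' :
  (var1 u < +oo)%E -> division1 I -> division1 I' ->
  close1 F I t e -> close1 F I' t' e' ->
  `|\sum_(i < n) F (t i) * incr1 u (I i) -
    \sum_(i < n') F (t' i) * incr1 u (I' i)| <= (e + e') * fine (var1 u).
Proof.
move=> fu dI dI' cI cI'.
pose IJ (i : 'I_n + 'I_n') := match i with inl i => I i | inr i => I' i end.
have [N [a [ga h]]] := grid_coords IJ.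
have hI i := h (inl i); have hI' i := h (inr i).
have [phi phiP] := cell_owner1 ga dI hI.
have [phi' phiP'] := cell_owner1 ga dI' hI'.
have sumE k (J : 'I_k -> itv1 R) (s : 'I_k -> \bar R) (psi : 'I_N -> 'I_k) :
    division1 J -> (forall i, on_grid N a (J i).1 /\ on_grid N a (J i).2) ->
    (forall i (k : 'I_N), inside (cell1 a k) (J i) = (psi k == i)) ->
    \sum_(i < k) F (s i) * incr1 u (J i) =
    \sum_(c < N) F (s (psi c)) * incr1 u (cell1 a c).
  move=> /division1P[pJ _ _] hJ psiP.
  rewrite -(regroup_cells (fun i => F (s i)) _ psiP); apply: eq_bigr => i _.
  by have [h1 h2] := hJ i; rewrite (incr1_cells u ga h1 h2)// ltW// pJ.
rewrite (sumE _ _ _ _ dI hI phiP) (sumE _ _ _ _ dI' hI' phiP').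
have cc c : `|F (t (phi c)) - F (t' (phi' c))| <= e + e'.
  have h1 := phiP (phi c) c; have h2 := phiP' (phi' c) c.
  move: h1 h2; rewrite !eqxx /inside => /andP[l1 r1] /andP[l2 r2].
  apply: close_dist; [apply: cI|apply: cI']; rewrite /iset1 /=.
    by apply/andP; split; [exact: l1|apply: le_trans r1];
      have [_ _ /(_ _ (ltn_ord c)) /ltW] := ga.
  by apply/andP; split; [exact: l2|apply: le_trans r2];
      have [_ _ /(_ _ (ltn_ord c)) /ltW] := ga.
apply: compare_cells => //; first exact: var1_grid.
have N0 := grid_pos ga.
exact: le_trans (normr_ge0 _) (cc (Ordinal N0)).
Qed.

Lemma compare2 F g n (I : 'I_n -> itv2 R) t e n' (I' : 'I_n' -> itv2 R) t' e' :
  (V12 g < +oo)%E -> division2 I -> division2 I' ->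
  close2 F I t e -> close2 F I' t' e' ->
  `|\sum_(i < n) F (t i) * incr2 g (I i) -
    \sum_(i < n') F (t' i) * incr2 g (I' i)| <= (e + e') * fine (V12 g).
Proof.
move=> fu dI dI' cI cI'.
pose IJ (i : 'I_n + 'I_n') := match i with inl i => I i | inr i => I' i end.
have [N [a [ga h]]] := grid_coords (fst \o IJ).
have [M [b [gb k]]] := grid_coords (snd \o IJ).
have hI i := h (inl i); have hI' i := h (inr i).
have kI i := k (inl i); have kI' i := k (inr i).
have [phi phiP] := cell_owner2 ga gb dI hI kI.
have [phi' phiP'] := cell_owner2 ga gb dI' hI' kI'.
have sumE p (J : 'I_p -> itv2 R) s (psi : 'I_N * 'I_M -> 'I_p) :
    division2 J -> (forall i, on_grid N a (J i).1.1 /\ on_grid N a (J i).1.2) ->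
    (forall i, on_grid M b (J i).2.1 /\ on_grid M b (J i).2.2) ->
    (forall i (c : 'I_N * 'I_M), inside (cell1 a c.1) (J i).1 && inside (cell1 b c.2) (J i).2
      = (psi c == i)) ->
    \sum_(i < p) F (s i) * incr2 g (J i) =
    \sum_c F (s (psi c)) * incr2 g (cell2 a b c.1 c.2).
  move=> /division2P[pJ _ _] hJ kJ psiP.
  rewrite -(regroup_cells (fun i => F (s i)) _ psiP); apply: eq_bigr => i _.
  have [h1 h2] := hJ i; have [h3 h4] := kJ i; have [pJ1 pJ2] := pJ i.
  by rewrite (incr2_cells g ga gb h1 h2 _ h3 h4)// ltW.
rewrite (sumE _ _ _ _ dI hI kI phiP) (sumE _ _ _ _ dI' hI' kI' phiP').
have cc c : `|F (t (phi c)) - F (t' (phi' c))| <= e + e'.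
  have h1 := phiP (phi c) c; have h2 := phiP' (phi' c) c.
  move: h1 h2; rewrite !eqxx /inside.
  move=> /andP[/andP[l1 r1] /andP[l2 r2]] /andP[/andP[l3 r3] /andP[l4 r4]].
  have [_ _ /(_ _ (ltn_ord c.1)) /ltW A] := ga.
  have [_ _ /(_ _ (ltn_ord c.2)) /ltW B] := gb.
  apply: (@close_dist _ _ (F (a c.1, b c.2))); [apply: cI|apply: cI'];
    rewrite /iset2 /iset1 /=; split; apply/andP; split => //=.
  - exact: le_trans r1.
  - exact: le_trans r2.
  - exact: le_trans r3.
  - exact: le_trans r4.
apply: (@compare_cells _ _ (fun c => F (t (phi c))) (fun c => F (t' (phi' c)))) => //.
  exact: V12_grid.
have N0 := grid_pos ga; have M0 := grid_pos gb.
exact: le_trans (normr_ge0 _) (cc (Ordinal N0, Ordinal M0)).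
Qed.

End packing.

(** * Cousin's lemma *)

Section cousin.
Context {R : realType}.

(** This treats real numbers and both infinities at once: an end of the
    segment fails to be strictly beyond [x] only when nothing lies beyond [x].
    *)
Lemma ereal_nbhs_segment (x : \bar R) (A : set (\bar R)) : nbhs x A ->
  exists l r, [/\ (l <= x <= r)%E, x = -oo%E \/ (l < x)%E,
    x = +oo%E \/ (x < r)%E & forall z, (l <= z <= r)%E -> A z].
Proof.
case: x => [r| |].
- move=> [e /= e0 h]; exists (r - e / 2)%:E, (r + e / 2)%:E.
  have e2 : 0 < e / 2 by rewrite divr_gt0.
  split.
  + by rewrite !lee_fin; apply/andP; split; lra.
  + by right; rewrite lte_fin; lra.
  + by right; rewrite lte_fin; lra.
  + case=> [z|/andP[]|/andP[]]//; rewrite !lee_fin => /andP[h1 h2].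
    by apply: h; rewrite /ball /= ltr_norml; apply/andP; split; lra.
- move=> [M [_ h]]; exists (M + 1)%:E, +oo%E; split.
  + by rewrite leey lexx.
  + by right; rewrite ltry.
  + by left.
  + move=> z /andP[h1 _]; apply: h; apply: lt_le_trans h1.
    by rewrite lte_fin ltrDl.
- move=> [M [_ h]]; exists -oo%E, (M - 1)%:E; split.
  + by rewrite !leNye.
  + by left.
  + by right; rewrite ltNyr.
  + move=> z /andP[_ h1]; apply: h; apply: (le_lt_trans h1).
    by rewrite lte_fin ltrBlDr ltrDl.
Qed.

(** Let [s] be the supremum of the points up to which such a grid can be
    built. A segment around [s] contained in [O s] serves as one more cell: it
    shows that [s] is reached, then that [s] is [+oo]. *)
Lemma cousin1 (O : \bar R -> set (\bar R)) : (forall x, nbhs x (O x)) ->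
  exists n a (t : nat -> \bar R), is_grid n a /\
    forall i, (i < n)%N -> iset1 (cell1 a i) (t i) /\
      forall x, iset1 (cell1 a i) x -> O (t i) x.
Proof.
move=> nO.
pose reach x := exists n a (t : nat -> \bar R),
  [/\ a 0%N = -oo%E, a n = x, forall i, (i < n)%N -> (a i < a i.+1)%E &
    forall i, (i < n)%N -> iset1 (cell1 a i) (t i) /\
      forall x, iset1 (cell1 a i) x -> O (t i) x].
suff: reach +oo%E.
  by move=> [n [a [t [a0 an ai h]]]]; exists n, a, t.
have ext x y t : reach x -> (x < y)%E -> iset1 (x, y) t ->
    (forall z, iset1 (x, y) z -> O t z) -> reach y.
  move=> [n [a [s [a0 an ai h]]]] xy ht hO.
  exists n.+1, (fun i => if (i <= n)%N then a i else y),
    (fun i => if (i < n)%N then s i else t).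
  split.
  - by rewrite leq0n.
  - by rewrite ltnn.
  - move=> i; rewrite ltnS => le; have [ni|ge] := ltnP i n.
      by rewrite (ltnW ni); exact: ai.
    by have -> : i = n; [apply/eqP; rewrite eqn_leq le|rewrite leqnn an].
  - move=> i; rewrite ltnS /cell1 => le; have [ni|ge] := ltnP i n.
      by rewrite (ltnW ni); exact: h.
    by have -> : i = n; [apply/eqP; rewrite eqn_leq le|rewrite leqnn an].
have reach0 : reach -oo%E by exists 0%N, (fun=> -oo%E), (fun=> -oo%E); split.
pose s := ereal_sup [set x | reach x].
have [l [r [/andP[ls sr] Hl Hr hO]]] := ereal_nbhs_segment (nO s).
have rs : reach s.
  case: Hl => [->//|ls'].
  have [x rx lx] : exists2 x, reach x & (l < x)%E.
    by have /ereal_sup_gt[x] := ls'; exists x.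
  have xs : (x <= s)%E by apply: ereal_sup_ubound.
  move: xs; rewrite le_eqVlt => /orP[/eqP <-//|xs].
  apply: (ext x s s) => //; rewrite /iset1 /=; first by rewrite ltW//= lexx.
  move=> z /andP[xz zs]; apply: hO.
  by rewrite (le_trans (ltW lx) xz) (le_trans zs sr).
case: Hr => [<-//|sr'].
have rr : reach r.
  apply: (ext s r s) => //; rewrite /iset1 /=; first by rewrite lexx.
  by move=> z /andP[sz zr]; apply: hO; rewrite (le_trans ls sz) zr.
have : (r <= s)%E by apply: ereal_sup_ubound.
by rewrite leNgt sr'.
Qed.

(** The extended line is compact: by Cousin's lemma finitely many sets cover
    it, and a filter is stable under finite intersections. *)
Lemma ereal_tube (I : Type) (F : set_system I) (P : \bar R -> I -> Prop) :
  Filter F -> (forall x : \bar R, \forall x' \near x & i \near F, P x' i) ->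
  \forall i \near F, forall x, P x i.
Proof.
move=> FF h.
have /choice[A hA] : forall x : \bar R, exists A : set (\bar R),
    nbhs x A /\ exists2 B, F B & forall x' i, A x' -> B i -> P x' i.
  move=> x; have [[A B] /= [nA nB] AB] := h x.
  exists A; split => //; exists B => // x' i Ax' Bi; exact: (AB (x', i)).
have [|n [a [t [ga ht]]]] := @cousin1 A; first by move=> x; have [] := hA x.
have : \forall i \near F, forall k : 'I_n, forall x, A (t k) x -> P x i.
  apply: filter_forall => k; have [_ [B FB hB]] := hA (t k).
  by apply: filterS FB => i Bi x /hB; apply.
apply: filterS => i hi x; have [k hk xk] := grid_cover x ga.
by apply: (hi (Ordinal hk)); have [_] := ht k hk; apply.
Qed.

(** Since any two values on a cell are close, every point of the cell can be
    its tag: the first and the last tags are moved to the infinities, where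
    summation by parts needs them. *)
Lemma unif_grid (Y : Type) (F : \bar R -> Y -> R) (e : R) :
  (forall x0 d, 0 < d -> \forall x \near x0, forall w, `|F x w - F x0 w| < d) ->
  0 < e ->
  exists N a (t : nat -> \bar R), [/\ is_grid N.+1 a, t 0%N = -oo%E,
    t N = +oo%E & forall i x w, (i < N.+1)%N -> iset1 (cell1 a i) x ->
      `|F x w - F (t i) w| <= e].
Proof.
move=> cF e0; have e2 : 0 < e / 2 by rewrite divr_gt0.
have [|n [a [s [ga hs]]]] := @cousin1 (fun x0 => [set x | forall w,
    `|F x w - F x0 w| < e / 2]).
  by move=> x0; exact: cF.
have osc i x y w : (i < n)%N -> iset1 (cell1 a i) x -> iset1 (cell1 a i) y ->
    `|F x w - F y w| <= e.
  move=> ni xi yi; have [_ hO] := hs i ni.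
  have /(_ w) h1 := hO x xi; have /(_ w) h2 := hO y yi.
  rewrite (_ : F x w - F y w = (F x w - F (s i) w) - (F y w - F (s i) w)).
    by apply: le_trans (ler_normB _ _) _; lra.
  by lra.
have [a0 an ai] := ga.
have [N nE] : exists N, n = N.+1 by exists n.-1; rewrite prednK ?(grid_pos ga).
rewrite {}nE in ga hs osc an ai *.
have [N0|N0] := posnP N; last first.
  exists N, a, (fun i => if i == N then +oo%E else a i); split => //.
  - by rewrite eq_sym gtn_eqF.
  - by rewrite eqxx.
  - move=> i x w ni xi; apply: (osc i) => //; rewrite /iset1 /=.
    have [->|_] := eqVneq i N; first by rewrite an leey /=.
    by rewrite lexx/= ltW// ai.
(* a single cell cannot carry both infinite tags: it is cut at 0 *)
subst N.
exists 1%N, (fun i => nth +oo%E [:: -oo%E; 0%E; +oo%E] i),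
  (fun i => nth +oo%E [:: -oo%E; +oo%E] i); split => //.
  by split=> // -[|[|//]] //=.
move=> i x w ni xi; apply: (osc 0%N) => //; rewrite /iset1 /= a0 an leey leNye//.
Qed.

(** Cousin's lemma is applied on each vertical line, then to the horizontal
    neighbourhoods common to the finitely many tags of a line. *)
Lemma cousin2 (O : \bar R * \bar R -> set (\bar R * \bar R)) :
  (forall z, nbhs z (O z)) ->
  exists n (K : 'I_n -> itv2 R) (t : 'I_n -> \bar R * \bar R), division2 K /\
    forall i, iset2 (K i) (t i) /\ iset2 (K i) `<=` O (t i).
Proof.
move=> nO.
have /choice[AB hAB] : forall z, exists AB : set (\bar R) * set (\bar R),
    [/\ nbhs z.1 AB.1, nbhs z.2 AB.2 &
      forall x y, AB.1 x -> AB.2 y -> O z (x, y)].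
  move=> z; have [[A B] /= [nA nB] h] := nO z.
  by exists (A, B); split => // x y Ax By; apply: h.
pose D := (nat * (nat -> \bar R) * (nat -> \bar R))%type.
have /choice[col hcol] : forall x, exists d : D,
    is_grid d.1.1 d.1.2 /\ forall j, (j < d.1.1)%N ->
      iset1 (cell1 d.1.2 j) (d.2 j) /\
      forall y, iset1 (cell1 d.1.2 j) y -> (AB (x, d.2 j)).2 y.
  move=> x; have [|m [b [s [gb hs]]]] := @cousin1 (fun y => (AB (x, y)).2).
    by move=> y; have [] := hAB (x, y).
  by exists (m, b, s).
have [|n [a [t [ga ht]]]] := @cousin1 (fun x =>
    [set x' | forall j : 'I_(col x).1.1, (AB (x, (col x).2 j)).1 x']).
  by move=> x; apply: filter_forall => j; have [] := hAB (x, (col x).2 j).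
have gb i : (i < n)%N -> is_grid (col (t i)).1.1 (col (t i)).1.2.
  by move=> _; have [] := hcol (t i).
have /= dT := column_division2 ga gb.
pose T := ({i : 'I_n & 'I_((col (t i)).1.1)})%type.
exists #|{: T}|, (fun k => let u : T := enum_val k in
     (cell1 a (tag u), cell1 (col (t (tag u))).1.2 (tagged u))),
  (fun k => let u : T := enum_val k in (t (tag u), (col (t (tag u))).2 (tagged u))).
split=> // k; move: (enum_val k) => [i j] /=.
have [ti hO] := ht i (ltn_ord i).
have [_ /(_ j (ltn_ord j))[sj hO']] := hcol (t i).
split=> //= -[x y] [/= xi yj].
have [_ _] := hAB (t i, (col (t i)).2 j); apply; last exact: hO'.
exact: (hO x xi).
Qed.

End cousin.

(** * Stieltjes integrals of continuous functions *)

Section stieltjes.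
Context {R : realType}.
Implicit Types (u : \bar R -> R) (g : \bar R * \bar R -> R).

(** Read [E s e] as: the number looked for is within [e] of [s]. These closed
    intervals meet pairwise, hence have a common point, the supremum of their
    left ends. *)
Lemma squeeze_ex (E : R -> R -> Prop) : (exists s e, E s e) ->
  (forall s e s' e', E s e -> E s' e' -> `|s - s'| <= e + e') ->
  exists A, forall s e, E s e -> `|s - A| <= e.
Proof.
move=> [s0 [e0 E0]] h; pose L := [set x | exists s e, E s e /\ x = s - e].
have ub s e : E s e -> ubound L (s + e).
  move=> Ese x [s' [e' [E' ->]]]; have := h _ _ _ _ Ese E'.
  by rewrite ler_norml => /andP[]; lra.
have L0 : L !=set0 by exists (s0 - e0), s0, e0.
exists (sup L) => s e Ese; rewrite ler_norml; apply/andP; split.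
  have : sup L <= s + e by apply: ge_sup => //; exact: ub.
  lra.
have : s - e <= sup L; last by lra.
apply: ub_le_sup; last by exists s, e.
by exists (s + e); exact: ub.
Qed.

(** The dummy parameter gives functions of one variable the form that
    [unif_grid] expects. *)
Lemma continuous_uniform1 (F : \bar R -> R) : continuous F ->
  forall x0 d, 0 < d -> \forall x \near x0, forall w : unit, `|F x - F x0| < d.
Proof.
move=> cF x0 d d0; have /cvgrPdist_lt/(_ _ d0) := cF x0.
by apply: filterS => x h _; rewrite distrC.
Qed.

(** The second variable ranges over a compact space, so the tube lemma makes
    continuity uniform in it. *)
Lemma continuous_uniform2 (F : \bar R * \bar R -> R) : continuous F ->
  forall x0 d, 0 < d -> \forall x \near x0, forall w, `|F (x, w) - F (x0, w)| < d.
Proof.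
move=> cF x0 d d0.
apply: (@ereal_tube _ _ (nbhs x0) (fun w x => `|F (x, w) - F (x0, w)| < d)).
move=> w; have d2 : 0 < d / 2 by rewrite divr_gt0.
have /cvgrPdist_lt/(_ _ d2)[[A B] /= [nA nB] h] := cF (x0, w).
exists (B, A) => //= -[y x] /= [By Ax].
have h1 := h (x, y) (conj Ax By).
have h2 := h (x0, y) (conj (nbhs_singleton nA) By).
rewrite (_ : F (x, y) - F (x0, y) =
  (F (x0, w) - F (x0, y)) - (F (x0, w) - F (x, y))); last by lra.
by apply: le_lt_trans (ler_normB _ _) _; move: h1 h2 => /=; lra.
Qed.

Definition swap2 (F : \bar R * \bar R -> R) (z : \bar R * \bar R) := F (z.2, z.1).

Lemma continuous_swap2 F : continuous F -> continuous (swap2 F).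
Proof.
move=> cF [x y].
apply: (@continuous_comp _ _ _ (fun z : \bar R * \bar R => (z.2, z.1)) F); last exact: cF.
by apply: cvg_pair => /=; [exact: cvg_snd|exact: cvg_fst].
Qed.

Definition good_grid1 (F : \bar R -> R) (e : R) N a (t : nat -> \bar R) :=
  [/\ is_grid N.+1 a, t 0%N = -oo%E, t N = +oo%E &
   forall i x, (i < N.+1)%N -> iset1 (cell1 a i) x -> `|F x - F (t i)| <= e].

(** With infinite extreme tags, the boundary terms of a summation by parts sit
    on the edges of the extended plane, where the product integral has its
    one-dimensional terms. *)
Definition good_grid2 (F : \bar R * \bar R -> R) (e : R) N a t M b s :=
  [/\ is_grid N.+1 a /\ is_grid M.+1 b,
   t 0%N = -oo%E /\ t N = +oo%E, s 0%N = -oo%E /\ s M = +oo%E &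
   forall i j x y, (i < N.+1)%N -> (j < M.+1)%N ->
    iset1 (cell1 a i) x -> iset1 (cell1 b j) y ->
    `|F (x, y) - F (t i, s j)| <= e].

Lemma good_grid1_ex F e : continuous F -> 0 < e ->
  exists N a t, good_grid1 F e N a t.
Proof.
move=> cF e0; have [N [a [t [ga t0 tN h]]]] := unif_grid (continuous_uniform1 cF) e0.
by exists N, a, t; split => // i x ni xi; exact: h i x tt ni xi.
Qed.

Lemma good_grid2_ex F e : continuous F -> 0 < e ->
  exists N a t M b s, good_grid2 F e N a t M b s.
Proof.
move=> cF e0; have e2 : 0 < e / 2 by rewrite divr_gt0.
have [N [a [t [ga t0 tN h]]]] := unif_grid (continuous_uniform2 cF) e2.
have [M [b [s [gb s0 sM k]]]] := unif_grid (continuous_uniform2 (continuous_swap2 cF)) e2.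
exists N, a, t, M, b, s; split => // i j x y ni mj xi yj.
have h1 := h i x y ni xi; have h2 := k j y (t i) mj yj.
rewrite (_ : F (x, y) - F (t i, s j) = (F (x, y) - F (t i, y)) +
   (F (t i, y) - F (t i, s j))); last by lra.
by apply: le_trans (ler_normD _ _) _; move: h1 h2; rewrite /swap2 /=; lra.
Qed.

Lemma good_grid1_close F e N a t : good_grid1 F e N a t ->
  close1 F (fun i : 'I_N.+1 => cell1 a i) (fun i => t i) e.
Proof. by move=> [_ _ _ h] i x; apply: h. Qed.

Lemma good_grid2_close F e N a t M b s : good_grid2 F e N a t M b s ->
  close2 F (fun k : 'I_#|{: 'I_N.+1 * 'I_M.+1}| =>
      cell2 a b (enum_val k).1 (enum_val k).2)
    (fun k => (t (enum_val k).1, s (enum_val k).2)) e.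
Proof. by move=> [_ _ _ h] k [x y] [/= xi yj]; apply: h. Qed.

(** The Riemann-Stieltjes integral, known together with the error of each
    Riemann sum. As this error depends on [u] through its variation only, the
    same grid serves for many integrators. *)
Definition RS1 (F u : \bar R -> R) (A : R) := forall n (I : 'I_n -> itv1 R) t e,
  division1 I -> close1 F I t e ->
  `|\sum_(i < n) F (t i) * incr1 u (I i) - A| <= e * fine (var1 u).

Definition RS2 (F g : \bar R * \bar R -> R) (A : R) :=
  forall n (K : 'I_n -> itv2 R) t e,
  division2 K -> close2 F K t e ->
  `|\sum_(i < n) F (t i) * incr2 g (K i) - A| <= e * fine (V12 g).

Lemma RS1_ex F u : continuous F -> (var1 u < +oo)%E -> exists A, RS1 F u A.
Proof.
move=> cF fu.
pose E S e' := exists n (I : 'I_n -> itv1 R) t e, [/\ division1 I,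
  close1 F I t e, S = \sum_(i < n) F (t i) * incr1 u (I i) &
  e' = e * fine (var1 u)].
have [||A hA] := @squeeze_ex E.
- have [N [a [t gd]]] := good_grid1_ex cF ltr01.
  have ga : is_grid N.+1 a by case: gd.
  do 2 eexists; exists N.+1; do 3 eexists; split; [exact: grid_division1 ga|
    exact: good_grid1_close gd|by []|by []].
- move=> S e S' e' [n [I [t [d [dI cI -> ->]]]]] [n' [I' [t' [d' [dI' cI' -> ->]]]]].
  by rewrite -mulrDl; exact: compare1.
- by exists A => n I t e dI cI; apply: hA; exists n, I, t, e.
Qed.

Lemma RS2_ex F g : continuous F -> (V12 g < +oo)%E -> exists A, RS2 F g A.
Proof.
move=> cF fu.
pose E S e' := exists n (K : 'I_n -> itv2 R) t e, [/\ division2 K,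
  close2 F K t e, S = \sum_(i < n) F (t i) * incr2 g (K i) &
  e' = e * fine (V12 g)].
have [||A hA] := @squeeze_ex E.
- have [N [a [t [M [b [s gd]]]]]] := good_grid2_ex cF ltr01.
  have [ga gb] : is_grid N.+1 a /\ is_grid M.+1 b by case: gd.
  do 2 eexists; do 4 eexists; split; [exact: grid_division2 ga gb|
    exact: good_grid2_close gd|by []|by []].
- move=> S e S' e' [n [I [t [d [dI cI -> ->]]]]] [n' [I' [t' [d' [dI' cI' -> ->]]]]].
  by rewrite -mulrDl; exact: compare2.
- by exists A => n I t e dI cI; apply: hA; exists n, I, t, e.
Qed.

Lemma var1_ge0 u : (0 <= var1 u)%E.
Proof.
have [ga|] := pselect (exists n (I : 'I_n -> itv1 R), division1 I).
  have [n [I dI]] := ga; apply: le_trans (ereal_sup_ubound _); last first.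
    by exists n, I; split; [exact: dI|reflexivity].
  by rewrite lee_fin sumr_ge0.
case; have [|n [a [t [ga _]]]] := @cousin1 R (fun=> setT).
  by move=> x; exact: filterT.
by do 2 eexists; exact: grid_division1 ga.
Qed.

Lemma V12_ge0 g : (0 <= V12 g)%E.
Proof.
have [|n [K [t [dK _]]]] := @cousin2 R (fun=> setT).
  by move=> x; exact: filterT.
apply: le_trans (ereal_sup_ubound _); last first.
  by exists n, K; split; [exact: dK|reflexivity].
by rewrite lee_fin sumr_ge0.
Qed.

Lemma small_factor (V eps : R) : 0 <= V -> 0 < eps ->
  exists2 d : R, 0 < d & d * V < eps.
Proof.
move=> V0 eps0; exists (eps / (V + 1)); first by rewrite divr_gt0// ltr_wpDl.
by rewrite mulrAC ltr_pdivrMr ?ltr_wpDl// ltr_pM2l// ltrDl.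
Qed.

Lemma open_range_EFin : open (range (@EFin R)).
Proof.
rewrite openE => _ [r _ <-]; rewrite /interior; exists 1 => //= s _.
by exists s.
Qed.

Lemma open_range_embed2 : open (range (@embed2 R)).
Proof.
rewrite (_ : range _ = range (@EFin R) `*` range (@EFin R)).
  rewrite openE => -[x y] [/= Rx Ry]; exists (range (@EFin R), range (@EFin R)) => //.
  by split; apply: open_nbhs_nbhs; split => //; exact: open_range_EFin.
apply/seteqP; split => [_ [[r s] _ <-]|[x y] [[r _ /= <-] [s _ /= <-]]].
  by split; [exists r|exists s].
by exists (r, s).
Qed.

(** For the gauge of the sets where [F] stays close to its value at the tag,
    fine divisions have the required small oscillation. *)
Lemma RS1_HS1 F u A : continuous F -> RS1 F u A -> is_HS1 F u A.
Proof.
move=> cF hA eps eps0.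
have [d d0 dV] := small_factor (fine_ge0 (var1_ge0 u)) eps0.
pose ball x := [set y | `|F y - F x| < d].
(* the gauge at a finite point must stay within the finite points *)
exists (fun x => if x is r%:E then ball x `&` range (@EFin R) else ball x).
have ob x : open (ball x).
  rewrite (_ : ball x = F @^-1` [set r | `|F x - r| < d]).
    by apply: open_comp => [? _|]; [exact: cF|exact: (@ball_open _ R^o)].
  by apply/seteqP; split => y; rewrite /ball /= distrC.
have bx x : ball x x by rewrite /ball /= subrr normr0.
split.
  split=> [x|r]; last by move=> ? [].
  case: x => [r| |]; split; rewrite ?inE//; try exact: ob; try exact: bx.
  by apply: openI; [exact: ob|exact: open_range_EFin].
move=> n I t [dI hI]; apply: le_lt_trans dV; apply: hA => // i x.
have [_ sub] := hI i; move/sub => /= h; apply: ltW.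
by move: h; case: (t i) => [r []| |].
Qed.

Lemma RS2_HS2 F g A : continuous F -> RS2 F g A -> is_HS2 F g A.
Proof.
move=> cF hA eps eps0.
have [d d0 dV] := small_factor (fine_ge0 (V12_ge0 g)) eps0.
pose ball x := [set y | `|F y - F x| < d].
exists (fun x => if `[< range (@embed2 R) x >] then
  ball x `&` range (@embed2 R) else ball x).
have ob x : open (ball x).
  rewrite (_ : ball x = F @^-1` [set r | `|F x - r| < d]).
    by apply: open_comp => [? _|]; [exact: cF|exact: (@ball_open _ R^o)].
  by apply/seteqP; split => y; rewrite /ball /= distrC.
have bx x : ball x x by rewrite /ball /= subrr normr0.
split.
  split=> [x|p]; last by rewrite ifT; [move=> ? []|apply/asboolP; exists p].
  case: asboolP => h; split; try exact: ob; try exact: bx.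
  - by apply: openI; [exact: ob|exact: open_range_embed2].
  - by split; [exact: bx|].
move=> n I t [dI hI]; apply: le_lt_trans dV; apply: hA => // i x.
have [_ sub] := hI i; move/sub => /= h; apply: ltW.
by move: h; case: ifP => [_ []|].
Qed.

(** Cousin's lemma gives a division that is fine for two gauges at a time. *)
Lemma HS1_unique F u A B : is_HS1 F u A -> is_HS1 F u B -> A = B.
Proof.
move=> hA hB; apply/eqP; rewrite -subr_eq0 -normr_eq0; apply/negPn/negP => ne.
pose eps := `|A - B| / 2.
have eps0 : 0 < eps by rewrite divr_gt0// lt_neqAle eq_sym ne normr_ge0.
have [g1 [[oA _] h1]] := hA _ eps0; have [g2 [[oB _] h2]] := hB _ eps0.
have [|n [a [t [ga ht]]]] := @cousin1 R (fun x => g1 x `&` g2 x).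
  move=> x; have [? ?] := oA x; have [? ?] := oB x.
  by apply: filterI; exact: open_nbhs_nbhs.
have dI := grid_division1 ga.
have /h1 : fine_division1 g1 (fun i : 'I_n => cell1 a i) (fun i => t i).
  by split => // i; have [? h] := ht i (ltn_ord i); split => // x /h [].
have /h2 : fine_division1 g2 (fun i : 'I_n => cell1 a i) (fun i => t i).
  by split => // i; have [? h] := ht i (ltn_ord i); split => // x /h [].
set S := \sum_(i < n) _ => k1 k2.
(* the common division brings A and B within eps of the same sum *)
have := ler_normB (S - B) (S - A).
rewrite (_ : S - B - (S - A) = A - B); last by lra.
by rewrite /eps in k1 k2; lra.
Qed.

Lemma HS2_unique F g A B : is_HS2 F g A -> is_HS2 F g B -> A = B.
Proof.
move=> hA hB; apply/eqP; rewrite -subr_eq0 -normr_eq0; apply/negPn/negP => ne.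
pose eps := `|A - B| / 2.
have eps0 : 0 < eps by rewrite divr_gt0// lt_neqAle eq_sym ne normr_ge0.
have [g1 [[oA _] h1]] := hA _ eps0; have [g2 [[oB _] h2]] := hB _ eps0.
have [|n [K [t [dK ht]]]] := @cousin2 R (fun x => g1 x `&` g2 x).
  move=> x; have [? ?] := oA x; have [? ?] := oB x.
  by apply: filterI; exact: open_nbhs_nbhs.
have /h1 : fine_division2 g1 K t.
  by split => // i; have [? h] := ht i; split => // x /h [].
have /h2 : fine_division2 g2 K t.
  by split => // i; have [? h] := ht i; split => // x /h [].
set S := \sum_(i < n) _ => k1 k2.
have := ler_normB (S - B) (S - A).
rewrite (_ : S - B - (S - A) = A - B); last by lra.
by rewrite /eps in k1 k2; lra.
Qed.

Lemma RS1_le F u A c : continuous F -> (var1 u < +oo)%E -> RS1 F u A ->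
  (forall x, `|F x| <= c) -> `|A| <= c * fine (var1 u).
Proof.
move=> cF fu hA hc.
have V0 := fine_ge0 (var1_ge0 u).
have [//|lt] := leP `|A| (c * fine (var1 u)); exfalso.
have [|d d0 dV] := @small_factor (fine (var1 u)) (`|A| - c * fine (var1 u)) V0.
  by rewrite subr_gt0.
have [N [a [t gd]]] := good_grid1_ex cF d0.
have ga : is_grid N.+1 a by case: gd.
have dI := grid_division1 ga.
have := hA _ _ _ _ dI (good_grid1_close gd).
set S := \sum_(i < _) _ => h1.
have h2 : `|S| <= c * fine (var1 u).
  have := var1_ub fu dI => h; apply: le_trans (ler_norm_sum _ _ _) _.
  apply: le_trans (ler_wpM2l (le_trans (normr_ge0 _) (hc 0%E)) h).
  rewrite mulr_sumr; apply: ler_sum => i _.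
  by rewrite normrM ler_wpM2r.
have := ler_normB S (S - A); rewrite (_ : S - (S - A) = A); last by lra.
by move: h1 h2 dV; lra.
Qed.

Lemma RS2_le F g A c : continuous F -> (V12 g < +oo)%E -> RS2 F g A ->
  (forall x, `|F x| <= c) -> `|A| <= c * fine (V12 g).
Proof.
move=> cF fu hA hc.
have V0 := fine_ge0 (V12_ge0 g).
have [//|lt] := leP `|A| (c * fine (V12 g)); exfalso.
have [|d d0 dV] := @small_factor (fine (V12 g)) (`|A| - c * fine (V12 g)) V0.
  by rewrite subr_gt0.
have [N [a [t [M [b [s gd]]]]]] := good_grid2_ex cF d0.
have [ga gb] : is_grid N.+1 a /\ is_grid M.+1 b by case: gd.
have dI := grid_division2 ga gb.
have := hA _ _ _ _ dI (good_grid2_close gd).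
set S := \sum_(i < _) _ => h1.
have h2 : `|S| <= c * fine (V12 g).
  have := V12_ub fu dI => h; apply: le_trans (ler_norm_sum _ _ _) _.
  apply: le_trans (ler_wpM2l (le_trans (normr_ge0 _) (hc (0%E, 0%E))) h).
  rewrite mulr_sumr; apply: ler_sum => i _.
  by rewrite normrM ler_wpM2r.
have := ler_normB S (S - A); rewrite (_ : S - (S - A) = A); last by lra.
by move: h1 h2 dV; lra.
Qed.

End stieltjes.

(** * Summation by parts *)

Section product_integral.
Context {R : realType}.

(** The integral of a product, read on the primitive [F] of the first factor.
    *)
Definition is_product_integral (F g : \bar R * \bar R -> R) (v : R) :=
  exists A1 A2 A12 : R,
    [/\ is_HS1 (fun s => F (s, +oo%E)) (fun s => g (s, +oo%E)) A1,
        is_HS1 (fun t => F (+oo%E, t)) (fun t => g (+oo%E, t)) A2,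
        is_HS2 F g A12 &
        v = F (+oo%E, +oo%E) * g (+oo%E, +oo%E) - A1 - A2 + A12].

Lemma product_integral_unique F g v w : is_product_integral F g v -> is_product_integral F g w -> v = w.
Proof.
move=> [A1 [A2 [A3 [a1 a2 a3 ->]]]] [B1 [B2 [B3 [b1 b2 b3 ->]]]].
by rewrite (HS1_unique a1 b1) (HS1_unique a2 b2) (HS2_unique a3 b3).
Qed.

(** The point [a i.+1] separates the cells of the tags [t i] and [t i.+1]:
    integrating by parts exchanges the roles of tags and end points. *)
Definition mixed_sum (F k : \bar R * \bar R -> R) N (a t : nat -> \bar R)
    M (b s : nat -> \bar R) : R :=
  \sum_(i < N) \sum_(j < M)
    incr2 F ((t i, t i.+1), (s j, s j.+1)) * k (a i.+1, b j.+1).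

Lemma abel1 N (u v : nat -> R) :
  u N * v N.+1 - \sum_(i < N.+1) u i * (v i.+1 - v i) =
  u 0%N * v 0%N + \sum_(i < N) (u i.+1 - u i) * v i.+1.
Proof.
elim: N => [|N ih]; first by rewrite big_ord_recl !big_ord0 /=; lra.
rewrite big_ord_recr [X in _ = _ + X]big_ord_recr /=; move: ih; lra.
Qed.

(** Summation by parts in each variable in turn. Its boundary terms at the
    upper ends are those of the product integral, and those at the lower ends
    vanish with [u]. *)
Lemma abel2 N M (u v : nat -> nat -> R) :
  (forall j, u 0%N j = 0) -> (forall i, u i 0%N = 0) ->
  u N M * v N.+1 M.+1 - \sum_(i < N.+1) u i M * (v i.+1 M.+1 - v i M.+1)
  - \sum_(j < M.+1) u N j * (v N.+1 j.+1 - v N.+1 j)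
  + \sum_(i < N.+1) \sum_(j < M.+1)
      u i j * (v i j + v i.+1 j.+1 - v i j.+1 - v i.+1 j) =
  \sum_(i < N) \sum_(j < M)
    (u i j + u i.+1 j.+1 - u i j.+1 - u i.+1 j) * v i.+1 j.+1.
Proof.
move=> u0 u1.
have ab i (w : nat -> R) : u i M * w M.+1 - \sum_(j < M.+1) u i j * (w j.+1 - w j)
   = \sum_(j < M) (u i j.+1 - u i j) * w j.+1.
  by rewrite abel1 u1 mul0r add0r.
have -> : \sum_(i < N.+1) u i M * (v i.+1 M.+1 - v i M.+1) =
  \sum_(i < N.+1) (\sum_(j < M.+1)
      u i j * (v i j + v i.+1 j.+1 - v i j.+1 - v i.+1 j) +
   \sum_(j < M) (u i j.+1 - u i j) * (v i.+1 j.+1 - v i j.+1)).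
  apply: eq_bigr => i _; have := ab i (fun j => v i.+1 j - v i j).
  set A := \sum_(j < M) _; set B := \sum_(j < M.+1) _; set C := \sum_(j < M.+1) _.
  have -> : B = C by apply: eq_bigr => j _; lra.
  by move=> /=; lra.
rewrite big_split /= opprD addrA.
have := ab N (v N.+1).
set A := \sum_(j < M.+1) _; set B := \sum_(i < N.+1) _; set C := \sum_(i < N.+1) _.
set D := \sum_(j < M) _ => h.
transitivity (D - C); first by move: h; lra.
rewrite /D /C exchange_big /= [RHS]exchange_big /= -sumrB; apply: eq_bigr => j _.
have := abel1 N (fun i => u i j.+1 - u i j) (fun i => v i j.+1).
rewrite /= !u0 subrr mul0r add0r => ->.
by apply: eq_bigr => i _; lra.
Qed.

(** The right-hand side samples [k] at inner grid points only, which are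
    finite, while each term on the left involves values of [k] at infinity. *)
Lemma abel_grid F k N a t M b s e : Bc F -> good_grid2 F e N a t M b s ->
  F (+oo%E, +oo%E) * k (+oo%E, +oo%E)
  - \sum_(i < N.+1) F (t i, +oo%E) * incr1 (fun x => k (x, +oo%E)) (cell1 a i)
  - \sum_(j < M.+1) F (+oo%E, s j) * incr1 (fun y => k (+oo%E, y)) (cell1 b j)
  + \sum_(c : 'I_N.+1 * 'I_M.+1) F (t c.1, s c.2) * incr2 k (cell2 a b c.1 c.2)
  = mixed_sum F k N a t M b s.
Proof.
move=> [_ F0] [[ga gb] [t0 tN] [s0 sM] _].
have [_ aN _] := ga; have [_ bM _] := gb.
have := @abel2 N M (fun i j => F (t i, s j)) (fun i j => k (a i, b j)).
rewrite /mixed_sum {2}/incr2 /= tN sM aN bM t0 s0 => <-.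
- by rewrite (pair_bigA _ (fun (i : 'I_N.+1) (j : 'I_M.+1) =>
    F (t i, s j) * incr2 k (cell2 a b i j))) /=.
- by move=> j; have [] := F0 (s j).
- by move=> i; have [] := F0 (t i).
Qed.

(** The variations that govern the three Stieltjes integrals of the product
    integral against [k]. *)
Definition upper_variation (k : \bar R * \bar R -> R) : R :=
  fine (V1 k +oo%E) + fine (V2 k +oo%E) + fine (V12 k).

Lemma upper_variation_ge0 k : 0 <= upper_variation k.
Proof.
by rewrite /upper_variation !addr_ge0// fine_ge0// ?V12_ge0 ?var1_ge0.
Qed.

Lemma cont_edge1 (F : \bar R * \bar R -> R) y : continuous F ->
  continuous (fun x => F (x, y)).
Proof.
move=> cF x; apply: (@continuous_comp _ _ _ (fun x => (x, y)) F); last exact: cF.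
by apply: cvg_pair => /=; [exact: cvg_id|exact: cvg_cst].
Qed.

Lemma cont_edge2 (F : \bar R * \bar R -> R) x : continuous F ->
  continuous (fun y => F (x, y)).
Proof.
move=> cF y; apply: (@continuous_comp _ _ _ (fun y => (x, y)) F); last exact: cF.
by apply: cvg_pair => /=; [exact: cvg_cst|exact: cvg_id].
Qed.

(** The three Stieltjes integrals exist, and their Riemann sums on a grid add
    up to a [mixed_sum] by [abel_grid]. *)
Lemma product_integral_ex F k : Bc F -> (V12 k < +oo)%E ->
  (V1 k +oo < +oo)%E -> (V2 k +oo < +oo)%E ->
  exists v, [/\ is_product_integral F k v,
    (forall e N a t M b s, good_grid2 F e N a t M b s ->
      `|v - mixed_sum F k N a t M b s| <= e * upper_variation k) &
    forall c, (forall z, `|F z| <= c) ->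
      `|v| <= c * (`|k (+oo%E, +oo%E)| + upper_variation k)].
Proof.
move=> BF f12 f1 f2; have [cF F0] := BF.
have c1 := cont_edge1 (y := +oo%E) cF; have c2 := cont_edge2 (x := +oo%E) cF.
have [A1 h1] := RS1_ex c1 f1; have [A2 h2] := RS1_ex c2 f2.
have [A3 h3] := RS2_ex cF f12.
exists (F (+oo%E, +oo%E) * k (+oo%E, +oo%E) - A1 - A2 + A3); split.
- exists A1, A2, A3; split => //; [exact: RS1_HS1|exact: RS1_HS1|exact: RS2_HS2].
- move=> e N a t M b s gd.
  have [[ga gb] [t0 tN] [s0 sM] cl] := gd.
  have [_ aN _] := ga; have [_ bM _] := gb.
  rewrite -(abel_grid k BF gd).
  have cl1 : close1 (fun x => F (x, +oo%E)) (fun i : 'I_N.+1 => cell1 a i)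
      (fun i => t i) e.
    move=> i x xi; rewrite -{2}sM; apply: cl => //.
    by rewrite /iset1 /= bM !leey.
  have cl2 : close1 (fun y => F (+oo%E, y)) (fun i : 'I_M.+1 => cell1 b i)
      (fun i => s i) e.
    move=> i x xi; rewrite -{2}tN; apply: cl => //.
    by rewrite /iset1 /= aN !leey.
  have k1 := h1 _ _ _ _ (grid_division1 ga) cl1.
  have k2 := h2 _ _ _ _ (grid_division1 gb) cl2.
  have := h3 _ _ _ e (grid_division2 ga gb) (good_grid2_close gd).
  rewrite (big_enum_val (fun c : 'I_N.+1 * 'I_M.+1 =>
    F (t c.1, s c.2) * incr2 k (cell2 a b c.1 c.2))).
  move=> k3; move: k1 k2 k3; rewrite /upper_variation /V1 /V2.
  set S1 := \sum_(i < _) _; set S2 := \sum_(i < _) _; set S3 := \sum_(c | _) _.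
  move=> k1 k2 k3.
  rewrite !mulrDr.
  rewrite (_ : _ - _ = (S1 - A1) + (S2 - A2) - (S3 - A3)); last by lra.
  apply: le_trans (ler_normB _ _) _; apply: lerD => //.
  by apply: le_trans (ler_normD _ _) _; exact: lerD.
- move=> c hc.
  have l1 := RS1_le c1 f1 h1 (fun x => hc (x, +oo%E)).
  have l2 := RS1_le c2 f2 h2 (fun x => hc (+oo%E, x)).
  have l3 := RS2_le cF f12 h3 hc.
  rewrite /upper_variation !mulrDr !addrA.
  apply: le_trans (ler_normD _ _) (lerD _ l3).
  apply: le_trans (ler_normB _ _) (lerD _ l2).
  apply: le_trans (ler_normB _ _) (lerD _ l1).
  by rewrite normrM ler_wpM2r.
Qed.

End product_integral.

(** * Reflections *)

Section reflection.
Context {R : realType}.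
Implicit Types (p : R) (x y : \bar R).

Lemma reflK p x : (p%:E - (p%:E - x) = x)%E.
Proof. by case: x => [x| |]//=; congr EFin; rewrite opprB addrC subrK. Qed.

Lemma lee_reflect p x y : (p%:E - x <= p%:E - y)%E = (y <= x)%E.
Proof.
case: x y => [x| |] [y| |]//=; rewrite ?leNye ?leey//.
by rewrite !lee_fin lerD2l lerN2.
Qed.

Lemma lte_reflect p x y : (p%:E - x < p%:E - y)%E = (y < x)%E.
Proof. by rewrite !ltNge lee_reflect. Qed.

Definition refl_itv p (I : itv1 R) : itv1 R := (p%:E - I.2, p%:E - I.1)%E.

Lemma proper_refl p I : proper_itv1 (refl_itv p I) = proper_itv1 I.
Proof. by rewrite /proper_itv1 /= lte_reflect. Qed.

Lemma iset_refl p I x : iset1 (refl_itv p I) x <-> iset1 I (p%:E - x)%E.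
Proof.
rewrite /iset1 /= -{1 2}(reflK p x) !lee_reflect.
by split => /andP[-> ->].
Qed.

Lemma nonoverlap_refl p I J : nonoverlap1 (refl_itv p I) (refl_itv p J) = nonoverlap1 I J.
Proof. by rewrite /nonoverlap1 /= !lee_reflect orbC. Qed.

Lemma division1_refl p n (I : 'I_n -> itv1 R) : division1 I ->
  division1 (fun i => refl_itv p (I i)).
Proof.
move=> /division1P[pI cI nI]; apply/division1P; split.
- by move=> i; rewrite proper_refl.
- by move=> x; have [i Ii] := cI (p%:E - x)%E; exists i; apply/iset_refl.
- by move=> i j ij; rewrite nonoverlap_refl nI.
Qed.

Lemma division2_refl (p : R * R) n (K : 'I_n -> itv2 R) : division2 K ->
  division2 (fun i => (refl_itv p.1 (K i).1, refl_itv p.2 (K i).2)).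
Proof.
move=> /division2P[pI cI nI]; apply/division2P; split.
- by move=> i; rewrite !proper_refl.
- move=> [x y]; have [i [/= K1 K2]] := cI (p.1%:E - x, p.2%:E - y)%E.
  by exists i; split; apply/iset_refl.
- by move=> i j ij; rewrite /nonoverlap2 /= !nonoverlap_refl; exact: nI.
Qed.

Lemma var1_refl p u : (var1 (fun x => u (p%:E - x)%E) <= var1 u)%E.
Proof.
apply: ge_ereal_sup => _ [n [I [dI ->]]].
apply: ereal_sup_ubound; exists n, (fun i => refl_itv p (I i)); split.
  exact: division1_refl.
by congr EFin; apply: eq_bigr => i _; rewrite /incr1 /= distrC.
Qed.

Lemma V12_refl (p : R * R) (g : \bar R * \bar R -> R) : (V12 (reflect2 g p) <= V12 g)%E.
Proof.
apply: ge_ereal_sup => _ [n [K [dK ->]]].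
apply: ereal_sup_ubound.
exists n, (fun i => (refl_itv p.1 (K i).1, refl_itv p.2 (K i).2)); split.
  exact: division2_refl.
congr EFin; apply: eq_bigr => i _; rewrite /incr2 /reflect2 /=.
by congr `|_|; lra.
Qed.

Lemma HKBV_refl (g : \bar R * \bar R -> R) (p : R * R) : HKBV g -> HKBV (reflect2 g p).
Proof.
move=> [g12 [x0 [y0 [g1 g2]]]]; split; first exact: le_lt_trans (V12_refl _ _) g12.
exists (p.1%:E - x0)%E, (p.2%:E - y0)%E; split.
  apply: le_lt_trans g1; rewrite /V1 /reflect2 /= reflK.
  exact: (var1_refl _ (fun x => g (x, y0))).
apply: le_lt_trans g2; rewrite /V2 /reflect2 /= reflK.
exact: (var1_refl _ (fun y => g (x0, y))).
Qed.

Lemma V12_swap (g : \bar R * \bar R -> R) : (V12 (swap2 g) <= V12 g)%E.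
Proof.
apply: ge_ereal_sup => _ [n [K [/division2P[pK cK nK] ->]]].
apply: ereal_sup_ubound; exists n, (fun i => ((K i).2, (K i).1)); split.
  apply/division2P; split => /=.
  - by move=> i; have [] := pK i.
  - by move=> [x y]; have [i [? ?]] := cK (y, x); exists i.
  - by move=> i j /nK; rewrite /nonoverlap2 /= orbC.
by congr EFin; apply: eq_bigr => i _; rewrite /incr2 /swap2 /=; congr `|_|; lra.
Qed.

Lemma HKBV_swap (g : \bar R * \bar R -> R) : HKBV g -> HKBV (swap2 g).
Proof.
move=> [g12 [x0 [y0 [g1 g2]]]]; split; first exact: le_lt_trans (V12_swap _) g12.
by exists y0, x0; split.
Qed.

End reflection.

(** * Functions of bounded Hardy-Krause variation *)

Section hardy_krause.
Context {R : realType}.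
Implicit Types (g : \bar R * \bar R -> R) (x y : \bar R).

(** An increment on the level [y i] differs from the one on the level [y0] by
    the increment over the rectangle between both levels, and these rectangles
    do not overlap. That the level may change with [i] makes the domination
    below uniform in the second variable. *)
Lemma strip_bound g y0 (T : finType) (I : T -> itv1 R) (y : T -> \bar R) :
  (V12 g < +oo)%E -> (V1 g y0 < +oo)%E ->
  (forall i, (I i).1 <= (I i).2)%E -> (forall i j, i != j -> nonoverlap1 (I i) (I j)) ->
  \sum_i `|g ((I i).2, y i) - g ((I i).1, y i)| <=
    fine (V1 g y0) + fine (V12 g).
Proof.
move=> g12 g1 leI nI.
have h1 := var1_pack g1 leI nI.
(* the level y i may be on either side of y0 *)
pose K i : itv2 R := (I i, (Order.min (y i) y0, Order.max (y i) y0)).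
have h2 : \sum_i `|incr2 g (K i)| <= fine (V12 g).
  apply: V12_pack => //= [i|i j ij].
    by rewrite le_max ge_min lexx.
  by rewrite /nonoverlap2 /= nI.
apply: le_trans (lerD h1 h2); rewrite -big_split /=; apply: ler_sum => i _.
rewrite /K /incr1 /incr2 /= /Order.min /Order.max.
case: ifP => _.
  rewrite (_ : g ((I i).2, y i) - _ = (g ((I i).2, y0) - g ((I i).1, y0)) -
    (g ((I i).1, y i) + g ((I i).2, y0) - g ((I i).1, y0) - g ((I i).2, y i))).
    exact: ler_normB.
  by lra.
rewrite (_ : g ((I i).2, y i) - _ = (g ((I i).2, y0) - g ((I i).1, y0)) +
    (g ((I i).1, y0) + g ((I i).2, y i) - g ((I i).1, y i) - g ((I i).2, y0))).
  exact: ler_normD.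
by lra.
Qed.

Lemma HKBV_V1 g y : HKBV g -> (V1 g y < +oo)%E.
Proof.
move=> [g12 [x0 [y0 [g1 g2]]]].
apply: (@le_lt_trans _ _ (fine (V1 g y0) + fine (V12 g))%:E); last exact: ltry.
apply: ge_ereal_sup => _ [n [I [/division1P[pI cI nI] ->]]].
rewrite lee_fin; apply: (@strip_bound _ y0 _ I (fun=> y)) => // i.
by apply/ltW/pI.
Qed.

Lemma HKBV_V2 g x : HKBV g -> (V2 g x < +oo)%E.
Proof. by move=> /HKBV_swap /(HKBV_V1 x). Qed.

Definition ndec (m : \bar R -> R) := forall x x', (x <= x')%E -> m x <= m x'.

(** The map [x |-> g (x, .)] is of bounded variation for the sup norm, and
    [m1] is its variation function; likewise for [m2] in the other variable.
    *)
Definition dominated g (m1 m2 : \bar R -> R) := [/\ ndec m1, ndec m2,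
  forall x x' y, (x <= x')%E -> `|g (x', y) - g (x, y)| <= m1 x' - m1 x &
  forall x y y', (y <= y')%E -> `|g (x, y') - g (x, y)| <= m2 y' - m2 y].

(** The value [m x] is a supremum over the chains that end at [x], with a free
    choice of the level at each step; [strip_bound] makes it finite. *)
Lemma half_dominated g : HKBV g -> exists2 m, ndec m &
  forall x x' y, (x <= x')%E -> `|g (x', y) - g (x, y)| <= m x' - m x.
Proof.
move=> [g12 [x0 [y0 [g1 g2]]]].
pose E x := [set s | exists n (a y : nat -> \bar R),
  [/\ forall i, (i < n)%N -> (a i <= a i.+1)%E, a n = x &
   s = \sum_(i < n) `|g (a i.+1, y i) - g (a i, y i)|]].
have ubE x : ubound (E x) (fine (V1 g y0) + fine (V12 g)).
  move=> _ [n [a [y [ai _ ->]]]].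
  apply: (@strip_bound _ y0 _ (fun i : 'I_n => (a i, a i.+1)) (fun i => y i)) => //.
    by move=> i; exact: ai.
  have mono i j : (i <= j <= n)%N -> (a i <= a j)%E.
    elim: j => [|j ih]; first by rewrite leqn0 => /andP[/eqP ->].
    move=> /andP[ij jn]; have [ij'|ij'] := leqP i j.
      by apply: le_trans (ih _) (ai _ jn); rewrite ij' ltnW.
    by have -> : i = j.+1; [apply/eqP; rewrite eqn_leq ij|].
  move=> i j; rewrite neq_ltn /nonoverlap1 /= => /orP[] h.
    by rewrite mono// h /= ltnW.
  by rewrite orbC mono// h /= ltnW.
have E0 x : E x !=set0.
  by exists 0, 0%N, (fun=> x), (fun=> x); split => //; rewrite big_ord0.
have step x x' y : (x <= x')%E ->
    sup (E x) + `|g (x', y) - g (x, y)| <= sup (E x').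
  move=> xx'; rewrite -lerBrDr; apply: ge_sup => // s [n [a [z [ai an ->]]]].
  rewrite lerBrDr; apply: ub_le_sup; first by eexists; exact: ubE.
  (* a chain up to x is continued by one step to x', on the level y *)
  exists n.+1, (fun i => if (i <= n)%N then a i else x'),
    (fun i => if (i < n)%N then z i else y).
  split.
  - move=> i; rewrite ltnS => le; rewrite le; case: (ltnP i n) => ni; first exact: ai.
    by have -> : i = n; [apply/eqP; rewrite eqn_leq le|rewrite an].
  - by rewrite ltnn.
  - rewrite big_ord_recr /= leqnn !ltnn an; congr (_ + _).
    by apply: eq_bigr => i _; rewrite (ltnW (ltn_ord i)) !ltn_ord.
exists (sup \o E) => x x' => [xx'|y xx'] /=.
  by apply: le_trans (step _ _ x xx'); rewrite lerDl.
by rewrite lerBrDl step.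
Qed.

Lemma HKBV_dominated g : HKBV g -> exists m1 m2, dominated g m1 m2.
Proof.
move=> hg; have [m1 n1 h1] := half_dominated hg.
have [m2 n2 h2] := half_dominated (HKBV_swap hg).
exists m1, m2; split => // x y y' yy'.
exact: (h2 y y' x yy').
Qed.

Lemma dominated_dist g m1 m2 x y x' y' : dominated g m1 m2 ->
  `|g (x, y) - g (x', y')| <= `|m1 x - m1 x'| + `|m2 y - m2 y'|.
Proof.
move=> [n1 n2 h1 h2].
have k1 : `|g (x, y) - g (x', y)| <= `|m1 x - m1 x'|.
  case: (leP x' x) => [le|/ltW le].
    by apply: le_trans (h1 _ _ y le) (ler_norm _).
  by rewrite distrC (distrC (m1 x)); apply: le_trans (h1 _ _ y le) (ler_norm _).
have k2 : `|g (x', y) - g (x', y')| <= `|m2 y - m2 y'|.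
  case: (leP y' y) => [le|/ltW le].
    by apply: le_trans (h2 x' _ _ le) (ler_norm _).
  by rewrite distrC (distrC (m2 y)); apply: le_trans (h2 x' _ _ le) (ler_norm _).
rewrite (_ : g (x, y) - _ = (g (x, y) - g (x', y)) + (g (x', y) - g (x', y'))).
  by apply: le_trans (ler_normD _ _) (lerD k1 k2).
by lra.
Qed.

Lemma dominated_bounded g m1 m2 : dominated g m1 m2 ->
  exists c, forall z, `|g z| <= c.
Proof.
move=> d; have [n1 n2 _ _] := d.
exists (`|g (-oo%E, -oo%E)| + ((m1 +oo%E - m1 -oo%E) + (m2 +oo%E - m2 -oo%E))).
move=> [x y]; have := dominated_dist x y -oo%E -oo%E d.
have h1 : `|m1 x - m1 -oo%E| <= m1 +oo%E - m1 -oo%E.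
  by rewrite ger0_norm ?subr_ge0 ?n1 ?leNye// lerD2r n1// leey.
have h2 : `|m2 y - m2 -oo%E| <= m2 +oo%E - m2 -oo%E.
  by rewrite ger0_norm ?subr_ge0 ?n2 ?leNye// lerD2r n2// leey.
have := ler_normD (g (x, y) - g (-oo%E, -oo%E)) (g (-oo%E, -oo%E)).
by rewrite subrK; lra.
Qed.

Lemma ndec_infty_cvg (m : \bar R -> R) (e : bool) : ndec m ->
  exists L : R, (m \o EFin) x @[x --> @nbhs_infty R e] --> L.
Proof.
move=> nm; case: e; rewrite /nbhs_infty.
  eexists; apply: nondecreasing_cvgr.
    by move=> x y xy; apply: nm; rewrite lee_fin.
  by exists (m +oo%E) => _ [x _ <-]; apply: nm; rewrite leey.
(* at -oo, the reflected function - m (- x) is nondecreasing too *)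
have h : (fun x : R => - m (- x)%:E) x @[x --> +oo] -->
    sup (range (fun x : R => - m (- x)%:E)).
  apply: nondecreasing_cvgr.
    by move=> x y xy; rewrite lerN2; apply: nm; rewrite lee_fin lerN2.
  by exists (- m -oo%E) => _ [x _ <-]; rewrite lerN2; apply: nm; rewrite leNye.
exists (- sup (range (fun x : R => - m (- x)%:E))).
apply/cvgNy_compNP.
have -> : (m \o EFin) \o -%R = - (fun x : R => - m (- x)%:E).
  by apply/funext => x /=; rewrite fctE opprK.
exact: cvgN h.
Qed.

End hardy_krause.

(** * Integration against an integrable weight *)

Section measurability.
Context {R : realType}.

(** The functions of the sequence take countably many values, each on a
    countable union of measurable rectangles. *)
Lemma quantized_measurable (k : R * R -> R) (N1 N2 : nat -> R -> int)
    (c : nat -> int -> int -> R) :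
  (forall n i, measurable (N1 n @^-1` [set i])) ->
  (forall n i, measurable (N2 n @^-1` [set i])) ->
  (forall p, (fun n => c n (N1 n p.1) (N2 n p.2)) x @[x --> \oo] --> k p) ->
  measurable_fun [set: R * R] k.
Proof.
move=> m1 m2 ck.
apply: (measurable_realfun.measurable_fun_cvg
  (h := fun n (p : R * R) => c n (N1 n p.1) (N2 n p.2))) => [n|p _]; last exact: ck.
move=> _ B mB; rewrite setTI.
rewrite (_ : _ @^-1` B = \bigcup_(ij : int * int)
   if `[< B (c n ij.1 ij.2) >] then (N1 n @^-1` [set ij.1]) `*` (N2 n @^-1` [set ij.2])
   else set0).
  apply: countable_bigcupT_measurable; first exact: countableP.
  move=> ij; case: ifP => _ //; exact: measurableX.
apply/seteqP; split => [[x y] /= Bxy|[x y] [ij _]].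
  by exists (N1 n x, N2 n y) => //=; rewrite asboolT.
by case: asboolP => // Bc [/= e1 e2]; rewrite -e1 -e2 in Bc.
Qed.

Lemma floor_fiber_measurable (M : R -> R) i : measurable_fun [set: R] M ->
  measurable ((fun x => Num.floor (M x)) @^-1` [set i]).
Proof.
move=> mM; rewrite (_ : _ @^-1` _ = [set: R] `&` M @^-1` `[i%:~R, (i + 1)%:~R[).
  by apply: mM => //; exact: measurable_itv.
rewrite setTI; apply/seteqP; split => x /=; rewrite in_itv /= -floor_eq.
  by move=> ->.
by move=> /eqP.
Qed.

Lemma floor_dist (n : nat) (u v : R) :
  Num.floor (n.+1%:R * u) = Num.floor (n.+1%:R * v) -> `|u - v| <= n.+1%:R^-1.
Proof.
move=> e; have h1 := floor_itv (n.+1%:R * u); have h2 := floor_itv (n.+1%:R * v).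
have n0 : 0 < n.+1%:R :> R by rewrite ltr0n.
rewrite -(ler_pM2l n0) divff ?gt_eqF//.
rewrite -[X in X * _](gtr0_norm n0) -normrM mulrBr.
move: h1 h2; rewrite e intrD => /andP[h1 h2] /andP[h3 h4].
by rewrite ler_norml; apply/andP; split; lra.
Qed.

(** Where the integer parts of [n.+1 * M1] and [n.+1 * M2] are fixed, [k]
    varies by at most [2 / n.+1]; it is replaced there by its value at a
    chosen point. *)
Lemma dominated_measurable (k : R * R -> R) (M1 M2 : R -> R) :
  measurable_fun [set: R] M1 -> measurable_fun [set: R] M2 ->
  (forall p q, `|k p - k q| <= `|M1 p.1 - M1 q.1| + `|M2 p.2 - M2 q.2|) ->
  measurable_fun [set: R * R] k.
Proof.
move=> mM1 mM2 kM.
pose N M (n : nat) (x : R) : int := Num.floor (n.+1%:R * M x : R).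
pose rep n i j := xget (0 : R, 0 : R) [set p | N M1 n p.1 = i /\ N M2 n p.2 = j].
apply: (@quantized_measurable k (N M1) (N M2) (fun n i j => k (rep n i j))).
- by move=> n i; apply: floor_fiber_measurable; exact: measurable_funM.
- by move=> n i; apply: floor_fiber_measurable; exact: measurable_funM.
- move=> p; apply/cvgrPdist_le => e e0.
  have e2 : 0 < e / 2 by rewrite divr_gt0.
  have := @cvg_harmonic R; move/cvgrPdist_le => /(_ _ e2).
  apply: filterS => n; rewrite sub0r normrN ger0_norm ?invr_ge0//= => hn.
  have [h1 h2] : N M1 n (rep n (N M1 n p.1) (N M2 n p.2)).1 = N M1 n p.1 /\
      N M2 n (rep n (N M1 n p.1) (N M2 n p.2)).2 = N M2 n p.2.
    by rewrite /rep; case: xgetP => [q _ //|/(_ p)]; case.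
  apply: le_trans (kM _ _) _.
  have k1 := floor_dist (esym h1); have k2 := floor_dist (esym h2).
  apply: le_trans (lerD k1 k2) _; apply: le_trans (lerD hn hn) _.
  by rewrite -splitr.
Qed.

(** Each point is replaced by the corner of the square of side [1 / n.+1] that
    contains it. *)
Lemma continuous_measurable2 (k : R * R -> R) : continuous k ->
  measurable_fun [set: R * R] k.
Proof.
move=> ck; pose N (n : nat) (x : R) : int := Num.floor (n.+1%:R * x : R).
have mN n i : measurable (N n @^-1` [set i]).
  by apply: floor_fiber_measurable; exact: measurable_funM.
apply: (@quantized_measurable k N N
  (fun n i j => k (i%:~R / n.+1%:R, j%:~R / n.+1%:R))) => // -[x y] /=.
have cx (z : R) : (fun n => (N n z)%:~R / n.+1%:R : R) n @[n --> \oo] --> z.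
  apply/cvgrPdist_le => e e0; have := @cvg_harmonic R.
  move/cvgrPdist_le => /(_ _ e0); apply: filterS => n.
  rewrite sub0r normrN ger0_norm ?invr_ge0//= => hn; apply: le_trans hn.
  rewrite /harmonic /=; have n0 : 0 < n.+1%:R :> R by rewrite ltr0n.
  rewrite -(ler_pM2l n0) divff ?gt_eqF//.
  rewrite -[X in X * _](gtr0_norm n0) -normrM mulrBr mulrCA divff ?gt_eqF// mulr1.
  have := floor_itv (n.+1%:R * z); rewrite -/(N n z) intrD => /andP[h1 h2].
  by rewrite ler_norml; apply/andP; split; lra.
apply: (@continuous_cvg _ _ _ _ _ _ k) => //.
  exact: ck.
exact: (cvg_pair (cx x) (cx y)).
Qed.

End measurability.

Section weighted_integral.
Context {R : realType}.
Notation mu := (lebesgue2 R).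
Variable h : R * R -> R.
Hypothesis hL1 : L1 h.

Definition bounded_measurable (k : R * R -> R) :=
  measurable_fun [set: measurableTypeR R * measurableTypeR R] k /\
  exists c, forall p, `|k p| <= c.

Lemma bmD k l : bounded_measurable k -> bounded_measurable l ->
  bounded_measurable (fun q => k q + l q).
Proof.
move=> [mk [c hc]] [ml [d hd]]; split; first exact: measurable_funD.
by exists (c + d) => p; apply: le_trans (ler_normD _ _) (lerD _ _).
Qed.

Lemma bmZ r k : bounded_measurable k -> bounded_measurable (fun q => r * k q).
Proof.
move=> [mk [c hc]]; split; first exact: measurable_funM.
by exists (`|r| * c) => p; rewrite normrM ler_wpM2l.
Qed.

Lemma bm_sum (T : finType) (k : T -> R * R -> R) :
  (forall i, bounded_measurable (k i)) ->
  bounded_measurable (fun q => \sum_i k i q).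
Proof.
move=> hk; elim: (index_enum T) => [|i s ih].
  rewrite (_ : (fun _ => _) = cst 0); last by apply/funext => q; rewrite big_nil.
  by split; [exact: measurable_cst|exists 0 => p; rewrite normr0].
rewrite (_ : (fun _ => _) = (fun q => k i q + \sum_(j <- s) k j q)).
  exact: bmD.
by apply/funext => q; rewrite big_cons.
Qed.

Lemma bm_integrable k : bounded_measurable k ->
  mu.-integrable setT (EFin \o (fun q => k q * h q)).
Proof.
move=> [mk [c hc]].
have -> : EFin \o (fun q => k q * h q) = ((EFin \o k) \* (EFin \o h))%E.
  by apply/funext => q /=; rewrite EFinM.
apply: (integrableMr measurableT mk _ hL1).
exists c; split; first exact: num_real.
by move=> d cd p _; apply: le_trans (hc p) (ltW cd).
Qed.

Definition wint k := (\int[mu]_q (k q * h q)).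

Lemma wintD k l : bounded_measurable k -> bounded_measurable l ->
  wint (fun q => k q + l q) = wint k + wint l.
Proof.
move=> bk bl; rewrite /wint -RintegralD//; do ?exact: bm_integrable.
by apply: eq_Rintegral => q _; rewrite mulrDl.
Qed.

Lemma wintZ r k : bounded_measurable k -> wint (fun q => r * k q) = r * wint k.
Proof.
move=> bk; rewrite /wint -RintegralZl//; do ?exact: bm_integrable.
by apply: eq_Rintegral => q _; rewrite mulrA.
Qed.

Lemma wint_sum (T : finType) (k : T -> R * R -> R) :
  (forall i, bounded_measurable (k i)) ->
  wint (fun q => \sum_i k i q) = \sum_i wint (k i).
Proof.
move=> bk; suff : bounded_measurable (fun q => \sum_i k i q) /\
    wint (fun q => \sum_i k i q) = \sum_i wint (k i) by case.
elim: (index_enum T) => [|i s [b ih]].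
  rewrite (_ : (fun _ => _) = cst 0); last by apply/funext => q; rewrite big_nil.
  split; first by split; [exact: measurable_cst|exists 0 => p; rewrite normr0].
  rewrite big_nil /wint (_ : (fun _ => _) = cst 0) ?Rintegral_cst ?mul0r//.
  by apply/funext => q; rewrite /= mul0r.
have -> : (fun q => \sum_(j <- i :: s) k j q) =
    (fun q => k i q + \sum_(j <- s) k j q).
  by apply/funext => q; rewrite big_cons.
by split; [exact: bmD|rewrite wintD// ih big_cons].
Qed.

Definition norm1 := \int[mu]_q `|h q|.

Lemma normh_integrable : mu.-integrable setT (EFin \o (fun q => `|h q|)).
Proof. exact: integrable_norm hL1. Qed.

Lemma norm1_ge0 : 0 <= norm1.
Proof. exact: Rintegral_ge0. Qed.

Lemma wint_le k V : bounded_measurable k -> (forall q, h q != 0 -> `|k q| <= V) ->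
  `|wint k| <= V * norm1.
Proof.
move=> bk kV; apply: le_trans (le_normr_Rintegral _ (bm_integrable bk)) _ => //.
rewrite /norm1 -RintegralZl//; last exact: normh_integrable.
apply: le_Rintegral => //.
- exact: integrable_norm (bm_integrable bk).
- rewrite (_ : EFin \o _ = (fun q => V%:E * (`|h q|)%:E)%E).
    exact: integrableZl normh_integrable.
  by apply/funext => q /=; rewrite EFinM.
- move=> q _; rewrite normrM; have [->|hq] := eqVneq (h q) 0.
    by rewrite normr0 !mulr0.
  by rewrite ler_wpM2r// kV.
Qed.

(** Multiplying each [k i] by the sign of its integral turns the sum into the
    integral of one function bounded by [V]. In this way bounds on variations
    pass through an integral. *)
Lemma wint_sum_le (T : finType) (k : T -> R * R -> R) V :
  (forall i, bounded_measurable (k i)) ->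
  (forall q, \sum_i `|k i q| <= V) ->
  \sum_i `|wint (k i)| <= V * norm1.
Proof.
move=> bk kV; pose s i := Num.sg (wint (k i)).
have -> : \sum_i `|wint (k i)| = wint (fun q => \sum_i s i * k i q).
  rewrite wint_sum; last by move=> i; exact: bmZ.
  by apply: eq_bigr => i _; rewrite wintZ// /s -normrEsg.
apply: le_trans (ler_norm _) _; apply: wint_le.
  by apply: bm_sum => i; exact: bmZ.
move=> q _; apply: le_trans (kV q); apply: le_trans (ler_norm_sum _ _ _) _.
apply: ler_sum => i _; rewrite normrM -[leRHS]mul1r ler_wpM2r//.
by rewrite normr_sg lern1; case: (_ != _).
Qed.

End weighted_integral.

(** * Convolution with an integrable function *)

Section convolution.
Context {R : realType}.
Implicit Types (g : \bar R * \bar R -> R) (h : R * R -> R).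

Definition transl g (q : R * R) : \bar R * \bar R -> R :=
  fun z => g ((z.1 - q.1%:E)%E, (z.2 - q.2%:E)%E).

(** A translation is the product of two reflections, so it inherits their
    bounds on variations. *)
Lemma translE g q : transl g q = reflect2 (reflect2 g (- q.1, - q.2)) (0, 0).
Proof.
apply/funext => -[x y]; rewrite /transl /reflect2 /=; congr (g (_, _)).
  by case: x => [x| |]//=; congr EFin; lra.
by case: y => [y| |]//=; congr EFin; lra.
Qed.

Lemma V12_transl g q : (V12 (transl g q) <= V12 g)%E.
Proof. by rewrite translE; apply: le_trans (V12_refl _ _) (V12_refl _ _). Qed.

Lemma ndec_shift_measurable (m : \bar R -> R) (z : \bar R) : ndec m ->
  measurable_fun [set: R] (fun x : R => m (z - x%:E)%E).
Proof.
move=> nm; apply: nonincreasing_measurable => // x y xy; apply: nm.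
by rewrite leeB// lee_fin.
Qed.

Lemma transl_bm g z : HKBV g -> bounded_measurable (fun q => transl g q z).
Proof.
move=> hg; have [m1 [m2 d]] := HKBV_dominated hg; split; last first.
  by have [c hc] := dominated_bounded d; exists c => p; exact: hc.
have [n1 n2 _ _] := d.
apply: (dominated_measurable (ndec_shift_measurable z.1 n1)
  (ndec_shift_measurable z.2 n2)) => p q.
exact: dominated_dist.
Qed.

Lemma var1_transl (u : \bar R -> R) (q : R) :
  (var1 (fun x => u (x - q%:E)%E) <= var1 u)%E.
Proof.
have -> : (fun x => u (x - q%:E)%E) = (fun x => u ((- q)%:E - (0%:E - x))%E).
  by apply/funext => -[x| |]//=; congr (u _%:E); lra.
exact: le_trans (var1_refl _ (fun y => u ((- q)%:E - y)%E)) (var1_refl _ _).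
Qed.

Lemma fine_le_ub (a b : \bar R) (r : R) : (0 <= a <= b)%E -> (b < +oo)%E ->
  r <= fine a -> r <= fine b.
Proof.
move=> /andP[a0 ab] bo ra; apply: le_trans ra _; apply: fine_le => //.
  by rewrite ge0_fin_numE// (le_lt_trans ab).
by rewrite ge0_fin_numE// (le_trans a0).
Qed.

Lemma wint_incr1 h n (I : 'I_n -> itv1 R) (G : \bar R -> R * R -> R) (V : R) :
  L1 h -> (forall x, bounded_measurable (G x)) ->
  (forall q, \sum_(i < n) `|incr1 (G^~ q) (I i)| <= V) ->
  \sum_(i < n) `|incr1 (fun x => wint h (G x)) (I i)| <= V * norm1 h.
Proof.
move=> hh bG hV; pose k i q := incr1 (G^~ q) (I i).
have kE i : k i = (fun q => G (I i).2 q + -1 * G (I i).1 q).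
  by apply/funext => q; rewrite mulN1r.
have bk i : bounded_measurable (k i) by rewrite kE; apply: bmD => //; exact: bmZ.
rewrite (eq_bigr (fun i => `|wint h (k i)|)); first exact: wint_sum_le.
move=> i _; rewrite kE wintD//; last exact: bmZ.
by rewrite wintZ// mulN1r.
Qed.

Lemma wint_incr2 h n (K : 'I_n -> itv2 R) (G : \bar R * \bar R -> R * R -> R)
    (V : R) :
  L1 h -> (forall z, bounded_measurable (G z)) ->
  (forall q, \sum_(i < n) `|incr2 (G^~ q) (K i)| <= V) ->
  \sum_(i < n) `|incr2 (fun z => wint h (G z)) (K i)| <= V * norm1 h.
Proof.
move=> hh bG hV; pose k i q := incr2 (G^~ q) (K i).
have bZ z : bounded_measurable (fun q => -1 * G z q) by exact: bmZ.
have kE i : k i = (fun q => (G ((K i).1.1, (K i).2.1) q + G ((K i).1.2, (K i).2.2) q)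
   + (-1 * G ((K i).1.1, (K i).2.2) q + -1 * G ((K i).1.2, (K i).2.1) q)).
  by apply/funext => q; rewrite /k /incr2 !mulN1r addrA.
have bk i : bounded_measurable (k i) by rewrite kE; do ![apply: bmD|exact: bZ].
rewrite (eq_bigr (fun i => `|wint h (k i)|)); first exact: wint_sum_le.
move=> i _; rewrite kE (wintD hh (bmD (bG _) (bG _)) (bmD (bZ _) (bZ _))).
rewrite (wintD hh (bG _) (bG _)) (wintD hh (bZ _) (bZ _)) !(wintZ hh)//.
by rewrite !mulN1r addrA.
Qed.

(** Translations do not increase the variations of [g], and the convolution
    superposes translates with total mass [norm1 h]. *)
Lemma HKBV_Lconv_ext g h : HKBV g -> L1 h -> HKBV (Lconv_ext g h).
Proof.
move=> hg hh; have [g12 _] := hg.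
have bm z := transl_bm z hg.
have v1 : (V1 g -oo < +oo)%E by exact: HKBV_V1.
have v2 : (V2 g -oo < +oo)%E by exact: HKBV_V2.
split; last first.
  exists -oo%E, -oo%E; split.
    apply: (@le_lt_trans _ _ (fine (V1 g -oo) * norm1 h)%:E); last exact: ltry.
    apply: ge_ereal_sup => _ [n [I [dI ->]]]; rewrite lee_fin.
    apply: (@wint_incr1 h n I (fun x q => transl g q (x, -oo%E))) => // q.
    have le := var1_transl (fun x => g (x, -oo%E)) q.1.
    apply: (fine_le_ub _ v1 (var1_ub (le_lt_trans le v1) dI)).
    by rewrite var1_ge0.
  apply: (@le_lt_trans _ _ (fine (V2 g -oo) * norm1 h)%:E); last exact: ltry.
  apply: ge_ereal_sup => _ [n [I [dI ->]]]; rewrite lee_fin.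
  apply: (@wint_incr1 h n I (fun y q => transl g q (-oo%E, y))) => // q.
  have le := var1_transl (fun y => g (-oo%E, y)) q.2.
  apply: (fine_le_ub _ v2 (var1_ub (le_lt_trans le v2) dI)).
  by rewrite var1_ge0.
apply: (@le_lt_trans _ _ (fine (V12 g) * norm1 h)%:E); last exact: ltry.
apply: ge_ereal_sup => _ [n [K [dK ->]]]; rewrite lee_fin.
apply: (@wint_incr2 h n K (fun z q => transl g q z)) => // q.
have le := V12_transl g q.
apply: (fine_le_ub _ g12 (V12_ub (le_lt_trans le g12) dK)).
by rewrite V12_ge0.
Qed.

End convolution.

(** * Smooth step functions *)

Section derivation_rules.
Context {R : realType}.
Implicit Types (f g : R -> R) (x : R).

(** As [derive1] is total, its value is meaningful only together with
    derivability. *)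
Definition has_deriv f x d := derivable f x 1 /\ derive1 f x = d.

Lemma has_derivP f x d : has_deriv f x d <-> is_derive x 1 f d.
Proof.
split=> [[hf <-]|h]; first by rewrite derive1E; exact/derivableP.
by split; [exact: ex_derive|rewrite derive1E (@derive_val _ _ _ _ _ _ _ h)].
Qed.

Lemma has_deriv_eq f x d d' : has_deriv f x d -> d = d' -> has_deriv f x d'.
Proof. by move=> h <-. Qed.

Lemma near_has_deriv f g x d : (\forall y \near x, f y = g y) ->
  has_deriv f x d -> has_deriv g x d.
Proof. by move=> fg /has_derivP h; apply/has_derivP; exact: near_eq_is_derive h. Qed.

Lemma has_deriv_cst (c : R) x : has_deriv (fun=> c) x 0.
Proof. by apply/has_derivP; exact: is_derive_cst. Qed.

Lemma has_deriv_id x : has_deriv (fun y => y) x 1.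
Proof. by apply/has_derivP; exact: is_derive_id. Qed.

Lemma has_deriv_add f g x df dg : has_deriv f x df -> has_deriv g x dg ->
  has_deriv (fun y => f y + g y) x (df + dg).
Proof.
by move=> /has_derivP hf /has_derivP hg; apply/has_derivP; exact: is_deriveD.
Qed.

Lemma has_deriv_opp f x df : has_deriv f x df -> has_deriv (fun y => - f y) x (- df).
Proof. by move=> /has_derivP hf; apply/has_derivP; exact: is_deriveN. Qed.

Lemma has_deriv_mul f g x df dg : has_deriv f x df -> has_deriv g x dg ->
  has_deriv (fun y => f y * g y) x (df * g x + f x * dg).
Proof.
move=> /has_derivP hf /has_derivP hg; apply/has_derivP.
have := is_deriveM hf hg.
by rewrite addrC (_ : g x *: df = df * g x)//; exact: mulrC.
Qed.

Lemma has_deriv_comp f g x df dg : has_deriv g x dg ->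
  has_deriv f (g x) df -> has_deriv (f \o g) x (df * dg).
Proof.
move=> [hg dg'] [hf df']; split.
  by apply/derivable1_diffP/differentiable_comp; apply/derivable1_diffP.
by rewrite derive1_comp// dg' df'.
Qed.

Lemma has_deriv_inv f x df : has_deriv f x df -> f x != 0 ->
  has_deriv (fun y => (f y)^-1) x (- df * (f x)^-1 * (f x)^-1).
Proof.
move=> [hf dfx] fx; split; first exact: derivableV.
rewrite derive1E deriveV// -derive1E dfx; rewrite [LHS]mulrC.
by rewrite -exprVn expr2 mulrN !mulNr mulrA.
Qed.

End derivation_rules.

Section smooth_functions.
Context {R : realType}.
Implicit Types (f g : R -> R) (x : R).

Fixpoint derivable_n n f : Prop :=
  if n is m.+1 then (forall x, derivable f x 1) /\ derivable_n m (derive1 f) else True.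

Definition smooth1 f := forall n, derivable_n n f.

Lemma derivable_nW n f : derivable_n n.+1 f -> derivable_n n f.
Proof. by elim: n f => //= n ih f [hf hf']; split => //; exact: ih. Qed.

Lemma smooth1_derivable f : smooth1 f -> forall x, derivable f x 1.
Proof. by move=> /(_ 1%N)[]. Qed.

Lemma smooth1_derive f : smooth1 f -> smooth1 (derive1 f).
Proof. by move=> hf n; have [] := hf n.+1. Qed.

Lemma derivable_continuous f : (forall x, derivable f x 1) -> continuous f.
Proof.
by move=> hf x; apply/differentiable_continuous/derivable1_diffP/hf.
Qed.

Lemma smooth1_continuous f : smooth1 f -> continuous f.
Proof. by move=> /smooth1_derivable; exact: derivable_continuous. Qed.

Lemma derivable_n_ext n f df : (forall x, has_deriv f x (df x)) ->
  derivable_n n df -> derivable_n n.+1 f.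
Proof.
move=> hf hdf; split; first by move=> x; have [] := hf x.
by rewrite (_ : derive1 f = df)//; apply/funext => x; have [] := hf x.
Qed.

Lemma derivable_n_has_deriv n f x : derivable_n n.+1 f ->
  has_deriv f x (derive1 f x).
Proof. by move=> [hf _]; split. Qed.

Lemma derivable_n_cst n (c : R) : derivable_n n (fun=> c).
Proof.
elim: n c => // n ih c; apply: (@derivable_n_ext _ _ (fun=> 0)) => // x.
exact: has_deriv_cst.
Qed.

Lemma derivable_n_add n f g : derivable_n n f -> derivable_n n g ->
  derivable_n n (fun x => f x + g x).
Proof.
elim: n f g => // n ih f g hf hg.
apply: (@derivable_n_ext _ _ (fun x => derive1 f x + derive1 g x)) => [x|].
  exact: has_deriv_add (derivable_n_has_deriv x hf) (derivable_n_has_deriv x hg).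
by apply: ih; [case: hf|case: hg].
Qed.

Lemma derivable_n_mul n f g : derivable_n n f -> derivable_n n g ->
  derivable_n n (fun x => f x * g x).
Proof.
elim: n f g => // n ih f g hf hg.
apply: (@derivable_n_ext _ _ (fun x => derive1 f x * g x + f x * derive1 g x)) => [x|].
  exact: has_deriv_mul (derivable_n_has_deriv x hf) (derivable_n_has_deriv x hg).
have [_ hf'] := hf; have [_ hg'] := hg.
by apply: derivable_n_add; apply: ih => //; exact: derivable_nW.
Qed.

Lemma derivable_n_inv n f : (forall x, f x != 0) -> derivable_n n f ->
  derivable_n n (fun x => (f x)^-1).
Proof.
move=> f0; elim: n => // n ih hf.
apply: (@derivable_n_ext _ _ (fun x => (-1 * derive1 f x) * (f x)^-1 * (f x)^-1)) => [x|].
  by rewrite mulN1r; exact: has_deriv_inv (derivable_n_has_deriv x hf) (f0 x).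
have [_ hf'] := hf.
have h := ih (derivable_nW hf).
do 2 (apply: derivable_n_mul => //).
exact: derivable_n_mul (derivable_n_cst n (-1)) hf'.
Qed.

Lemma has_deriv_affine (a b x : R) : has_deriv (fun y => a * y + b) x a.
Proof.
apply: has_deriv_eq.
  apply: has_deriv_add (has_deriv_cst b x).
  exact: has_deriv_mul (has_deriv_cst a x) (has_deriv_id x).
by rewrite mul0r add0r mulr1 addr0.
Qed.

Lemma derivable_n_affine n f (a b : R) : derivable_n n f ->
  derivable_n n (fun x => f (a * x + b)).
Proof.
elim: n f => // n ih f hf.
apply: (@derivable_n_ext _ _ (fun x => derive1 f (a * x + b) * a)) => [x|].
  apply: (@has_deriv_comp _ f (fun y => a * y + b)); first exact: has_deriv_affine.
  exact: derivable_n_has_deriv hf.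
have [_ hf'] := hf.
apply: derivable_n_mul (derivable_n_cst _ _); exact: ih.
Qed.

End smooth_functions.

Section flat_functions.
Context {R : realType}.
Implicit Types (p : {poly R}) (x : R).

(** These functions form a family that is stable under derivation, whence
    their smoothness: a single derivation rule replaces the study of
    successive derivatives. *)
Definition flat p x : R := if 0 < x then p.[x^-1] * expR (- x^-1) else 0.

Lemma flat_le0 p x : x <= 0 -> flat p x = 0.
Proof. by rewrite /flat leNgt => /negbTE ->. Qed.

Lemma pow_exp_le (n : nat) (u : R) : 0 < u ->
  u ^+ n * expR (- u) <= n.+1`!%:R * u^-1.
Proof.
move=> u0; rewrite expRN ler_pdivrMr ?expR_gt0// mulrAC ler_pdivlMr//.
rewrite -exprSr; have := expR_ge1Dxn n (ltW u0).
have f0 : 0 < n.+1`!%:R :> R by rewrite ltr0n fact_gt0.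
move=> h; rewrite mulrC -ler_pdivrMr//; apply: le_trans h.
by rewrite lerDr.
Qed.

Lemma flat_lipschitz0 p : exists C, forall x, `|flat p x| <= C * `|x|.
Proof.
exists (\sum_(i < size p) `|p`_i| * i.+1`!%:R) => x; rewrite /flat.
case: ifPn => [x0|_]; last first.
  by rewrite normr0 mulr_ge0// sumr_ge0// => i _; rewrite mulr_ge0.
rewrite horner_coef mulr_suml mulr_suml; apply: le_trans (ler_norm_sum _ _ _) _.
apply: ler_sum => i _; rewrite -mulrA normrM -[leRHS]mulrA ler_wpM2l//.
have u0 : 0 < x^-1 by rewrite invr_gt0.
rewrite ger0_norm ?mulr_ge0 ?exprn_ge0 ?expR_ge0 ?(ltW u0)//.
apply: le_trans (pow_exp_le _ u0) _.
by rewrite invrK gtr0_norm.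
Qed.

(** At 0, the difference quotient of [flat p] is the flat function [flat (p *
    'X)], which tends to 0. *)
Lemma has_deriv_flat p x :
  has_deriv (flat p) x (flat ('X^2 * (p - p^`())) x).
Proof.
have [x0|x0|x0] := ltgtP x 0.
- rewrite flat_le0 ?(ltW x0)//; apply: (@near_has_deriv _ (fun=> 0)).
    near=> y; rewrite /flat ltNge ltW//; near: y; exact: lt_nbhsl.
  exact: has_deriv_cst.
- apply: (@near_has_deriv _ (fun y => p.[y^-1] * expR (- y^-1))).
    near=> y; rewrite /flat ifT//; near: y; exact: lt_nbhsr.
  have xn0 : x != 0 by rewrite gt_eqF.
  have hi : has_deriv (fun y : R => y^-1) x (- 1 * x^-1 * x^-1).
    exact: has_deriv_inv (has_deriv_id x) xn0.
  have hp : has_deriv (fun y : R => p.[y^-1]) x ((p^`()).[x^-1] * (- 1 * x^-1 * x^-1)).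
    apply: (@has_deriv_comp _ (horner p) (fun y : R => y^-1)) => //.
    by rewrite derivE; split => //; exact: derivable_horner.
  have he : has_deriv (fun y : R => expR (- y^-1)) x
      (expR (- x^-1) * (- (- 1 * x^-1 * x^-1))).
    apply: (@has_deriv_comp _ expR (fun y : R => - y^-1)).
      exact: has_deriv_opp.
    by apply/has_derivP; exact: is_derive_expR.
  apply: (has_deriv_eq (has_deriv_mul hp he)).
  rewrite /flat x0 hornerM hornerXn hornerD hornerN expr2.
  set a := expR _; set b := p^`().[_]; set c := p.[_]; lra.
- have -> : flat ('X^2 * (p - p^`())) x = 0 by rewrite flat_le0 ?x0.
  have [C hC] := flat_lipschitz0 (p * 'X).
  have C0 : 0 <= C by have := hC 1; rewrite normr1 mulr1; exact: le_trans.
  have lim0 : (fun h : R => h^-1 *: (flat p (h *: (1 : R) + x) - flat p x)) h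
      @[h --> 0^'] --> (0 : R).
    apply/cvgrPdist_le => e e0.
    near=> h; rewrite sub0r normrN x0 (@flat_le0 _ 0)// subr0 addr0.
    have -> : h^-1 *: flat p (h *: (1 : R)) = flat (p * 'X) h.
      rewrite /flat /GRing.scale /= mulr1; case: ifP => _; last by rewrite mulr0.
      by rewrite hornerMX; lra.
    apply: le_trans (hC h) _.
    apply: (@le_trans _ _ ((C + 1) * `|h|)); first by rewrite ler_wpM2r// lerDl.
    rewrite -ler_pdivlMl ?ltr_wpDl//.
    near: h; apply: dnbhs0_le; rewrite mulr_gt0 ?invr_gt0 ?ltr_wpDl//.
  apply/has_derivP; apply: DeriveDef; last exact: cvg_lim lim0.
  by apply/cvg_ex; exists 0; exact: lim0.
Unshelve. all: by end_near. Qed.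

Lemma smooth1_flat p : smooth1 (flat p).
Proof.
move=> n; elim: n p => // n ih p.
exact: (derivable_n_ext (has_deriv_flat p) (ih _)).
Qed.

Definition step x : R := flat 1 x * (flat 1 x + flat 1 (-1 * x + 1))^-1.

Lemma flat1_gt0 x : 0 < x -> 0 < flat 1 x.
Proof. by move=> x0; rewrite /flat x0 hornerC mul1r expR_gt0. Qed.

Lemma flat1_ge0 x : 0 <= flat 1 x.
Proof. by case: (leP x 0) => [/flat_le0 ->//|/flat1_gt0/ltW]. Qed.

Lemma step_den x : flat 1 x + flat 1 (-1 * x + 1) != 0.
Proof.
rewrite gt_eqF//; have [x0|x0] := ltP 0 x.
  by rewrite ltr_wpDr ?flat1_gt0 ?flat1_ge0.
by rewrite ltr_wpDl ?flat1_ge0// flat1_gt0//; lra.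
Qed.

Lemma smooth1_step : smooth1 step.
Proof.
move=> n; apply: derivable_n_mul; first exact: smooth1_flat.
apply: derivable_n_inv; first exact: step_den.
apply: derivable_n_add; first exact: smooth1_flat.
by apply: derivable_n_affine; exact: smooth1_flat.
Qed.

Lemma step_le0 x : x <= 0 -> step x = 0.
Proof. by move=> x0; rewrite /step (flat_le0 _ x0) mul0r. Qed.

Lemma step_ge1 x : 1 <= x -> step x = 1.
Proof.
move=> x1; rewrite /step (@flat_le0 _ (-1 * x + 1)); last by lra.
by rewrite addr0 divff// gt_eqF// flat1_gt0//; lra.
Qed.

End flat_functions.

(** * Functions with compact support *)

Section compact_support.
Context {R : realType}.
Implicit Types (M : R) (K : R * R -> R).
Local Notation leb := (@lebesgue_measure R).

Definition vanish_outside M K :=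
  forall p, M < `|p.1| \/ M < `|p.2| -> K p = 0.

Definition box M : set (R * R) := `[- M, M] `*` `[- M, M].

Lemma boxP M p : box M p <-> `|p.1| <= M /\ `|p.2| <= M.
Proof. by rewrite /box /= !in_itv /= !ler_norml. Qed.

Lemma compact_box M : compact (box M).
Proof. by apply: compact_setX; exact: segment_compact. Qed.

Lemma vanish_mul M K G : vanish_outside M K ->
  vanish_outside M (fun p => G p * K p).
Proof. by move=> hK p /hK ->; rewrite mulr0. Qed.

Lemma vanish_bounded M K : continuous K -> vanish_outside M K ->
  exists2 c, 0 <= c & forall p, `|K p| <= c.
Proof.
move=> cK hK; have : bounded_set (K @` box M).
  apply: compact_bounded; apply: continuous_compact; last exact: compact_box.
  exact: continuous_subspaceT.
move=> [c [_ hc]]; exists (`|c| + 1) => [|p]; first by rewrite addr_ge0.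
have [/boxP bp|nb] := pselect (box M p).
  apply: (hc (`|c| + 1)); last by exists p => //; exact/boxP.
  by apply: (le_lt_trans (ler_norm _)); rewrite ltrDl.
rewrite hK ?normr0 ?addr_ge0//.
move/boxP/not_andP : nb => -[] /negP; rewrite -ltNge; [by left|by right].
Qed.

Lemma compact_support_bm M K : continuous K -> vanish_outside M K ->
  bounded_measurable K.
Proof.
move=> cK hK; split; first exact: continuous_measurable2.
by have [c _ hc] := vanish_bounded cK hK; exists c.
Qed.

Lemma lebesgue2_rect (a b c d : R) : a <= b -> c <= d ->
  (lebesgue2 R) (`[a, b] `*` `[c, d]) = ((b - a) * (d - c))%:E.
Proof.
move=> ab cd; rewrite product_measure1E; do ?exact: measurable_itv.
have len (x y : R) : x <= y -> @lebesgue_measure R `[x, y] = (y - x)%:E.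
  move=> xy; rewrite lebesgue_measure_itv /= lte_fin.
  have [xy'|xy'] := ltP x y; first by rewrite EFinB.
  by rewrite (_ : y = x) ?subrr//; apply/le_anti; rewrite xy xy'.
by rewrite EFinM; congr (_ * _)%E; exact: len.
Qed.

Lemma rect_L1 (a b c d : R) : a <= b -> c <= d ->
  L1 (\1_(`[a, b] `*` `[c, d]) : R * R -> R).
Proof.
move=> ab cd; have mB : measurable
    (`[a, b] `*` `[c, d] : set (measurableTypeR R * measurableTypeR R)).
  by apply: measurableX; exact: measurable_itv.
apply/integrableP; split; first exact/measurable_EFinP/measurable_indic.
rewrite (eq_integral (fun p : measurableTypeR R * measurableTypeR R =>
    (\1_(`[a, b] `*` `[c, d]) p)%:E)); last first.
  by move=> p _ /=; rewrite ger0_norm.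
rewrite integral_indic// setIT.
by apply: (@le_lt_trans _ _ ((b - a) * (d - c))%:E); [rewrite -(lebesgue2_rect ab cd)|exact: ltry].
Qed.

Lemma compact_support_L1 M K : continuous K -> vanish_outside M K -> L1 K.
Proof.
move=> cK hK; have [M0|M0] := leP 0 M; last first.
  have -> : K = cst 0.
    by apply/funext => p; rewrite hK//; left; exact: (lt_le_trans M0).
  exact: integrable0.
have NM : - M <= M by lra.
have := bm_integrable (rect_L1 NM NM) (compact_support_bm cK hK).
rewrite (_ : (fun q => _) = K)//; apply/funext => p.
rewrite indicE; case: (boolP (p \in _)) => [_|]; first by rewrite mulr1.
rewrite mulr0 notin_setE -/(box M) => nb; rewrite hK//.
move/boxP/not_andP : nb => -[] /negP; rewrite -ltNge; [by left|by right].
Qed.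

Lemma integral_derivative (u du : R -> R) (a b : R) : a < b ->
  (forall x, has_deriv u x (du x)) -> continuous du ->
  (forall x, x < a \/ b < x -> du x = 0) ->
  (\int[leb]_x (du x)%:E = (u b - u a)%:E)%E.
Proof.
move=> ab hu cdu du0.
have cu : continuous u.
  by apply: derivable_continuous => x; have [] := hu x.
transitivity (\int[leb]_(x in `[a, b]) (du x)%:E)%E.
  rewrite [RHS]integral_mkcond; apply: eq_integral => x _ /=.
  rewrite /patch; case: ifPn => //; rewrite notin_setE /= in_itv /=.
  by move=> /negP; rewrite negb_and -!ltNge => /orP[] h; rewrite du0//; [left|right].
rewrite (@continuous_FTC2 _ du u)//.
- exact: continuous_subspaceT.
- split.
  + by move=> x _; have [] := hu x.
  + by apply: cvg_at_right_filter; exact: cu.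
  + by apply: cvg_at_left_filter; exact: cu.
- by move=> x _; have [] := hu x.
Qed.

Lemma near_abs_gt M (x : R) : M < `|x| -> \forall y \near x, M < `|y|.
Proof.
move=> h; have : continuous (fun y : R => `|y|) by exact: norm_continuous.
by move=> /(_ x) /cvgr_gt; apply.
Qed.

Lemma locally_zero_derive (u : R -> R) (x : R) : (\forall y \near x, u y = 0) ->
  derive1 u x = 0.
Proof.
move=> h; have [_ //] : has_deriv u x 0.
by apply: near_has_deriv (has_deriv_cst 0 x); apply: filterS h => y ->.
Qed.

Lemma vanish_pd1 M K : vanish_outside M K -> vanish_outside M (pd1 K).
Proof.
move=> hK p hp; apply: locally_zero_derive; case: hp => hp.
  by apply: filterS (near_abs_gt hp) => y hy; apply: hK; left.
by exists 1 => //= y _; apply: hK; right.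
Qed.

Lemma vanish_pd2 M K : vanish_outside M K -> vanish_outside M (pd2 K).
Proof.
move=> hK p hp; apply: locally_zero_derive; case: hp => hp.
  by exists 1 => //= y _; apply: hK; left.
by apply: filterS (near_abs_gt hp) => y hy; apply: hK; right.
Qed.

Lemma cont_section1 (G : R * R -> R) y : continuous G ->
  continuous (fun x => G (x, y)).
Proof.
move=> cG x; apply: (@continuous_comp _ _ _ (fun x => (x, y)) G); last exact: cG.
exact: (cvg_pair (@cvg_id _ (nbhs x)) (cvg_cst y)).
Qed.

Lemma cont_section2 (G : R * R -> R) x : continuous G ->
  continuous (fun y => G (x, y)).
Proof.
move=> cG y; apply: (@continuous_comp _ _ _ (fun y => (x, y)) G); last exact: cG.
exact: (cvg_pair (cvg_cst x) (@cvg_id _ (nbhs y))).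
Qed.

Lemma cont_mul (T : topologicalType) (f g : T -> R) :
  continuous f -> continuous g -> continuous (fun x => f x * g x).
Proof. by move=> cf cg x; apply: cvgM; [exact: cf|exact: cg]. Qed.

Lemma cont_fst (a : R -> R) : continuous a -> continuous (fun p : R * R => a p.1).
Proof.
move=> ca [x y]; apply: (@continuous_comp _ _ _ (fun p : R * R => p.1) a).
  exact: cvg_fst.
exact: ca.
Qed.

Lemma cont_snd (a : R -> R) : continuous a -> continuous (fun p : R * R => a p.2).
Proof.
move=> ca [x y]; apply: (@continuous_comp _ _ _ (fun p : R * R => p.2) a).
  exact: cvg_snd.
exact: ca.
Qed.

Lemma vanish_positive M K : vanish_outside M K -> exists2 N, 0 < N &
  vanish_outside N K.
Proof.
move=> hK; exists (`|M| + 1); first by rewrite ltr_wpDl.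
move=> p hp; apply: hK; have h := ler_norm M.
by case: hp => hp; [left|right]; lra.
Qed.

(** By Fubini's theorem: a compactly supported derivative has integral zero on
    each line. *)
Lemma integral_pd2 M (psi : R * R -> R) (a : R -> R) : vanish_outside M psi ->
  (forall p, derivable (fun t => psi (p.1, t)) p.2 1) ->
  continuous (pd2 psi) -> continuous a ->
  \int[(lebesgue2 R)]_p (a p.1 * pd2 psi p) = 0.
Proof.
move=> h dpsi cpsi ca; have [N N0 hN] := vanish_positive h.
have cK : continuous (fun p => a p.1 * pd2 psi p) by apply: cont_mul; [exact: cont_fst|].
have vK := vanish_mul (fun p : R * R => a p.1) (vanish_pd2 hN).
have iK := compact_support_L1 cK vK.
rewrite /Rintegral -(integral12_prod_meas1 iK) /fubini_F.
rewrite (eq_integral (cst 0%E)) ?integral0// => x _ /=.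
rewrite (@integral_derivative (fun t => a x * psi (x, t)) _ (- (N + 1)) (N + 1)).
- rewrite !hN ?mulr0 ?subrr//=; right; rewrite ?normrN ger0_norm; lra.
- lra.
- move=> t; apply: has_deriv_eq.
    apply: has_deriv_mul (has_deriv_cst _ _) _.
    by split; [exact: (dpsi (x, t))|reflexivity].
  by rewrite mul0r add0r.
- by apply: (cont_section2 (G := fun p => a p.1 * pd2 psi p)).
- move=> t ht; rewrite (vanish_pd2 hN) ?mulr0//; right => /=.
  case: ht => ht; first by rewrite ltr0_norm; lra.
  by rewrite gtr0_norm; lra.
Qed.

Lemma integral_pd1 M (psi : R * R -> R) (b : R -> R) : vanish_outside M psi ->
  (forall p, derivable (fun s => psi (s, p.2)) p.1 1) ->
  continuous (pd1 psi) -> continuous b ->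
  \int[(lebesgue2 R)]_p (b p.2 * pd1 psi p) = 0.
Proof.
move=> h dpsi cpsi cb; have [N N0 hN] := vanish_positive h.
have cK : continuous (fun p => b p.2 * pd1 psi p) by apply: cont_mul; [exact: cont_snd|].
have vK := vanish_mul (fun p : R * R => b p.2) (vanish_pd1 hN).
have iK := compact_support_L1 cK vK.
rewrite /Rintegral -(integral21_prod_meas1 iK) /fubini_G.
rewrite (eq_integral (cst 0%E)) ?integral0// => y _ /=.
rewrite (@integral_derivative (fun s => b y * psi (s, y)) _ (- (N + 1)) (N + 1)).
- rewrite !hN ?mulr0 ?subrr//=; left; rewrite ?normrN ger0_norm; lra.
- lra.
- move=> t; apply: has_deriv_eq.
    apply: has_deriv_mul (has_deriv_cst _ _) _.
    by split; [exact: (dpsi (t, y))|reflexivity].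
  by rewrite mul0r add0r.
- by apply: (cont_section1 (G := fun p => b p.2 * pd1 psi p)).
- move=> t ht; rewrite (vanish_pd1 hN) ?mulr0//; left => /=.
  case: ht => ht; first by rewrite ltr0_norm; lra.
  by rewrite gtr0_norm; lra.
Qed.

End compact_support.

(** * Symmetry of the mixed derivative *)

Section increments.
Context {R : realType}.

Lemma near_square (G : R * R -> R) (x y e : R) : continuous G -> 0 < e ->
  \forall h \near 0^'+, forall c d, x <= c <= x + h -> y <= d <= y + h ->
    `|G (c, d) - G (x, y)| <= e.
Proof.
move=> cG e0; have /cvgrPdist_le/(_ _ e0) := cG (x, y).
move=> [[A B] /= [[r r0 rA] [s s0 sB]] AB].
near=> h => c d /andP[c1 c2] /andP[d1' d2']; rewrite distrC.
have hr : h < r by near: h; exact: nbhs_right_lt.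
have hs : h < s by near: h; exact: nbhs_right_lt.
apply: (AB (c, d)); split => /=; [apply: rA|apply: sB] => /=.
  by rewrite distrC ger0_norm; lra.
by rewrite distrC ger0_norm; lra.
Unshelve. all: by end_near. Qed.

(** Divided by [h * h], the increments at [(x, y)] tend both to [G1 (x, y)]
    and to [G2 (x, y)]. *)
Lemma eq_of_increments (G1 G2 : R * R -> R) (D : R -> R -> R -> R) :
  continuous G1 -> continuous G2 ->
  (forall x y h, 0 < h -> exists c d, [/\ x <= c <= x + h, y <= d <= y + h &
    D x y h = G1 (c, d) * h * h]) ->
  (forall x y h, 0 < h -> exists c d, [/\ x <= c <= x + h, y <= d <= y + h &
    D x y h = G2 (c, d) * h * h]) -> G1 = G2.
Proof.
move=> c1 c2 i1 i2.
apply/funext => -[x y]; apply/eqP; rewrite -subr_eq0 -normr_eq0.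
apply/negPn/negP => ne; pose e := `|G1 (x, y) - G2 (x, y)| / 4.
have e0 : 0 < e by rewrite divr_gt0// lt_neqAle eq_sym ne normr_ge0.
have n1 := near_square x y c1 e0; have n2 := near_square x y c2 e0.
have n3 : \forall h \near (0 : R)^'+, 0 < h by exact: nbhs_right_gt.
have [h [[h0 h1] h2]] := filter_ex (filterI (filterI n3 n1) n2).
have [c [d [hc hd E]]] := i1 x y h h0.
have [c' [d' [hc' hd' E']]] := i2 x y h h0.
have EE : G1 (c, d) = G2 (c', d').
  have hn : h != 0 by rewrite gt_eqF.
  by apply: (mulIf hn); apply: (mulIf hn); rewrite -E -E'.
have k1 := h1 _ _ hc hd; have k2 := h2 _ _ hc' hd'.
have := ler_normB (G2 (c', d') - G2 (x, y)) (G1 (c, d) - G1 (x, y)).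
rewrite EE in k1 *; rewrite (_ : G2 (c', d') - _ - _ = G1 (x, y) - G2 (x, y)); last by lra.
by rewrite /e in k1 k2 e0 *; lra.
Qed.

End increments.

Section schwarz.
Context {R : realType}.
Variable phi : R * R -> R.
Hypothesis sphi : smooth2 phi.

Let d1 (p : R * R) : has_deriv (fun s => phi (s, p.2)) p.1 (pd1 phi p).
Proof. by have [_ /(_ p)[? _]] := sphi [::]; split. Qed.

Let d2 (p : R * R) : has_deriv (fun t => phi (p.1, t)) p.2 (pd2 phi p).
Proof. by have [_ /(_ p)[_ ?]] := sphi [::]; split. Qed.

Let d21 (p : R * R) : has_deriv (fun t => pd1 phi (p.1, t)) p.2 (pd2 (pd1 phi) p).
Proof. by have [_ /(_ p)[_ ?]] := sphi [:: false]; split. Qed.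

Let d12 (p : R * R) : has_deriv (fun s => pd2 phi (s, p.2)) p.1 (pd1 (pd2 phi) p).
Proof. by have [_ /(_ p)[? _]] := sphi [:: true]; split. Qed.

Lemma mean_value_has_deriv (u du : R -> R) (x h : R) : 0 < h ->
  (forall y, has_deriv u y (du y)) ->
  exists2 c, x <= c <= x + h & u (x + h) - u x = du c * h.
Proof.
move=> h0 hu; have xh : x <= x + h by rewrite lerDl ltW.
have [||c] := @MVT_segment R u du x (x + h) xh.
- by move=> y _; exact/has_derivP.
- apply: continuous_subspaceT; apply: derivable_continuous => y.
  by have [] := hu y.
- by rewrite in_itv /= (_ : x + h - x = h) => [hc e|]; [exists c|lra].
Qed.

Let incr_pd (x y h : R) : 0 < h ->
  exists c d, [/\ x <= c <= x + h, y <= d <= y + h &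
    phi (x + h, y + h) - phi (x, y + h) - (phi (x + h, y) - phi (x, y)) =
    pd2 (pd1 phi) (c, d) * h * h].
Proof.
move=> h0.
have [|c hc e] := @mean_value_has_deriv (fun s => phi (s, y + h) + - phi (s, y))
    (fun s => pd1 phi (s, y + h) + - pd1 phi (s, y)) x h h0.
  move=> s; apply: has_deriv_add; first exact: (d1 (s, y + h)).
  by apply: has_deriv_opp; exact: (d1 (s, y)).
have [|d hd e'] := @mean_value_has_deriv (fun t => pd1 phi (c, t))
    (fun t => pd2 (pd1 phi) (c, t)) y h h0.
  by move=> t; exact: (d21 (c, t)).
exists c, d; split => //; rewrite -e' -e; lra.
Qed.

Let incr_pd' (x y h : R) : 0 < h ->
  exists c d, [/\ x <= c <= x + h, y <= d <= y + h &
    phi (x + h, y + h) - phi (x, y + h) - (phi (x + h, y) - phi (x, y)) =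
    pd1 (pd2 phi) (c, d) * h * h].
Proof.
move=> h0.
have [|d hd e] := @mean_value_has_deriv (fun t => phi (x + h, t) + - phi (x, t))
    (fun t => pd2 phi (x + h, t) + - pd2 phi (x, t)) y h h0.
  move=> t; apply: has_deriv_add; first exact: (d2 (x + h, t)).
  by apply: has_deriv_opp; exact: (d2 (x, t)).
have [|c hc e'] := @mean_value_has_deriv (fun s => pd2 phi (s, d))
    (fun s => pd1 (pd2 phi) (s, d)) x h h0.
  by move=> s; exact: (d12 (s, d)).
exists c, d; split => //; rewrite -e' -e; lra.
Qed.

(** The increment of [phi] over a square is, by two mean value theorems taken
    in either order, a value of each mixed derivative times the area. *)
Lemma schwarz : pd2 (pd1 phi) = pd1 (pd2 phi).
Proof.
have [c1 _] := sphi [:: true; false]; have [c2 _] := sphi [:: false; true].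
exact: (eq_of_increments c1 c2 incr_pd incr_pd').
Qed.

End schwarz.

(** * Test functions and mollifiers *)

Section extended_plane.
Context {R : realType}.

Lemma compact_ereal : compact [set: \bar R].
Proof.
apply/compact_near_coveringP => I F P FF h.
have := @ereal_tube R I F (fun x i => P i x) FF (fun x => h x Logic.I).
by apply: filterS => i Pi x _; exact: Pi.
Qed.

Lemma continuous_bounded2 (F : \bar R * \bar R -> R) : continuous F ->
  exists c, forall z, `|F z| <= c.
Proof.
move=> cF; have : bounded_set (F @` ([set: \bar R] `*` [set: \bar R])).
  apply: compact_bounded; apply: continuous_compact.
    exact: continuous_subspaceT.
  by apply: compact_setX; exact: compact_ereal.
move=> [c [_ hc]]; exists (`|c| + 1) => z; apply: (hc (`|c| + 1)).
  by apply: (le_lt_trans (ler_norm _)); rewrite ltrDl.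
by exists z.
Qed.

Lemma continuous_embed2 (F : \bar R * \bar R -> R) : continuous F ->
  continuous (fun p : R * R => F (embed2 p)).
Proof.
move=> cF [x y].
apply: (@continuous_comp _ _ _ (@embed2 R) F); last exact: cF.
have e1 : (fun p : R * R => p.1%:E) p @[p --> (x, y)] --> x%:E.
  by apply: cvg_EFin; [exact: nearW|exact: cvg_fst].
have e2 : (fun p : R * R => p.2%:E) p @[p --> (x, y)] --> y%:E.
  by apply: cvg_EFin; [exact: nearW|exact: cvg_snd].
exact: (cvg_pair e1 e2).
Qed.

Lemma embed2_bm (F : \bar R * \bar R -> R) : continuous F ->
  bounded_measurable (fun p : R * R => F (embed2 p)).
Proof.
move=> cF; split; first by apply: continuous_measurable2; exact: continuous_embed2.
by have [c hc] := continuous_bounded2 cF; exists c => p.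
Qed.

Lemma nbhs_finite (x : \bar R) (O : set (\bar R)) : nbhs x O ->
  exists r : R, O r%:E.
Proof.
move=> /ereal_nbhs_segment[l [r [/andP[lx xr] hl hr hO]]].
suff [s ls] : exists s : R, (l <= s%:E <= r)%E by exists s; exact: hO.
case: x {hO} lx xr hl hr => [s| |] lx xr hl hr.
- by exists s; rewrite lx.
- case: hl => // hl; have [s /andP[ls sr]] := ereal_between hl.
  by exists s; rewrite (ltW ls) (le_trans (ltW sr)).
- case: hr => // hr; have [s /andP[ls sr]] := ereal_between hr.
  by exists s; rewrite (ltW sr) andbT (le_trans lx)// leNye.
Qed.

Lemma finite_dense (u : \bar R -> R) c : continuous u ->
  (forall r : R, u r%:E = c) -> forall x, u x = c.
Proof.
move=> cu h x; apply/eqP; rewrite -subr_eq0 -normr_eq0; apply/negPn/negP => ne.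
have ne0 : 0 < `|u x - c| by rewrite lt_neqAle eq_sym ne normr_ge0.
have /cvgrPdist_lt/(_ _ ne0) hx := cu x.
by have [r] := nbhs_finite hx; rewrite /= h ltxx.
Qed.

End extended_plane.

Section test_functions.
Context {R : realType}.
Implicit Types (A B : R -> R).

Lemma pd1_tensor A B : (forall x, derivable A x 1) ->
  pd1 (fun p => A p.1 * B p.2) = (fun p => derive1 A p.1 * B p.2).
Proof.
move=> dA; apply/funext => p.
have [_ e] : has_deriv (fun s => A s * B p.2) p.1 (derive1 A p.1 * B p.2 + A p.1 * 0).
  by apply: has_deriv_mul; [split|exact: has_deriv_cst].
by rewrite /pd1 e mulr0 addr0.
Qed.

Lemma pd2_tensor A B : (forall x, derivable B x 1) ->
  pd2 (fun p => A p.1 * B p.2) = (fun p => A p.1 * derive1 B p.2).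
Proof.
move=> dB; apply/funext => p.
have [_ e] : has_deriv (fun t => A p.1 * B t) p.2 (0 * B p.2 + A p.1 * derive1 B p.2).
  by apply: has_deriv_mul; [exact: has_deriv_cst|split].
by rewrite /pd2 e mul0r add0r.
Qed.

Lemma iter_pd_tensor A B w : smooth1 A -> smooth1 B ->
  exists A' B', [/\ smooth1 A', smooth1 B' &
    iter_pd w (fun p => A p.1 * B p.2) = (fun p => A' p.1 * B' p.2)].
Proof.
move=> sA sB; elim: w => [|[] w [A' [B' [sA' sB' e]]]]; first by exists A, B.
  exists A', (derive1 B'); split => //; first exact: smooth1_derive.
  by rewrite /= -/(iter_pd w _) e pd2_tensor//; exact: smooth1_derivable.
exists (derive1 A'), B'; split => //; first exact: smooth1_derive.
by rewrite /= -/(iter_pd w _) e pd1_tensor//; exact: smooth1_derivable.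
Qed.

Lemma smooth2_tensor A B : smooth1 A -> smooth1 B ->
  smooth2 (fun p => A p.1 * B p.2).
Proof.
move=> sA sB w; have [A' [B' [sA' sB' ->]]] := iter_pd_tensor w sA sB.
split.
  by apply: cont_mul; [apply: cont_fst|apply: cont_snd]; exact: smooth1_continuous.
move=> p; split.
  have [//] : has_deriv (fun s => A' s * B' p.2) p.1 (derive1 A' p.1 * B' p.2 + A' p.1 * 0).
  by apply: has_deriv_mul (has_deriv_cst _ _); split => //; exact: smooth1_derivable.
have [//] : has_deriv (fun t => A' p.1 * B' t) p.2 (0 * B' p.2 + A' p.1 * derive1 B' p.2).
by apply: has_deriv_mul (has_deriv_cst _ _) _; split => //; exact: smooth1_derivable.
Qed.

Lemma vanish_compact M (phi : R * R -> R) : vanish_outside M phi ->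
  compact (closure [set p | phi p != 0]).
Proof.
move=> h; apply: (@subclosed_compact _ _ (box M)).
- exact: closed_closure.
- exact: compact_box.
move=> p cp; apply/boxP; split; rewrite leNgt; apply/negP => hp.
  have [|q [/= + hq]] := cp [set q | M < `|q.1|].
    have [e e0 he] := near_abs_gt hp.
    exists (ball p.1 e, setT) => /=.
      by split; [exact: nbhsx_ballx|exact: filterT].
    by move=> q [/= hq _]; apply: he.
  by rewrite h ?eqxx//; left.
have [|q [/= + hq]] := cp [set q | M < `|q.2|].
  have [e e0 he] := near_abs_gt hp.
  exists (setT, ball p.2 e) => /=.
    by split; [exact: filterT|exact: nbhsx_ballx].
  by move=> q [/= _ hq]; apply: he.
by rewrite h ?eqxx//; right.
Qed.

Lemma testfun_vanish (phi : testfun R) : exists M, vanish_outside M phi.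
Proof.
have [c [_ hc]] := @compact_bounded R (R * R)%type _ (@testfun_support R phi).
exists (`|c| + 1) => p hp; apply/eqP/negPn/negP => ne.
have : `|p| <= `|c| + 1.
  apply: (hc (`|c| + 1)); last exact: subset_closure.
  by apply: (le_lt_trans (ler_norm _)); rewrite ltrDl.
rewrite prod_normE ge_max => /andP[h1 h2].
by case: hp; rewrite ltNge ?h1 ?h2.
Qed.

Lemma mixed_pd_continuous (phi : testfun R) : continuous (pd2 (pd1 phi)).
Proof. by have [] := testfun_smooth phi [:: true; false]. Qed.

Lemma mixed_pd_L1 (phi : testfun R) : L1 (pd2 (pd1 phi)).
Proof.
have [M hM] := testfun_vanish phi.
apply: (@compact_support_L1 _ M); first exact: mixed_pd_continuous.
by apply: vanish_pd2; apply: vanish_pd1; exact: hM.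
Qed.

(** A function of one variable has no mixed derivative. For a function of the
    second variable, both derivatives of the test function are exchanged
    first. *)
Lemma dist12_edge (phi : testfun R) (a b : R -> R) : continuous a -> continuous b ->
  \int[(lebesgue2 R)]_p (a p.1 * pd2 (pd1 phi) p) = 0 /\
  \int[(lebesgue2 R)]_p (b p.2 * pd2 (pd1 phi) p) = 0.
Proof.
move=> ca cb; have [M hM] := testfun_vanish phi.
have s := testfun_smooth phi.
have [c1 s1] := s [:: false]; have [c2 s2] := s [:: true].
have [c3 _] := s [:: false; true].
split.
  apply: (integral_pd2 (vanish_pd1 hM)); [|exact: mixed_pd_continuous|exact: ca].
  by move=> p; have [_ h] := s1 p; exact: h.
rewrite schwarz; last exact: s.
apply: (integral_pd1 (vanish_pd2 hM)); [|exact: c3|exact: cb].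
by move=> p; have [h _] := s2 p; exact: h.
Qed.

End test_functions.

Section mollifier.
Context {R : realType}.

Definition bump : R -> R := derive1 (@step R).

Lemma smooth1_bump : smooth1 bump.
Proof. exact: smooth1_derive smooth1_step. Qed.

Lemma bump_out x : x < 0 \/ 1 < x -> bump x = 0.
Proof.
case=> hx.
  have [_ //] : has_deriv (@step R) x 0.
  apply: near_has_deriv (has_deriv_cst 0 x).
  by apply: filterS (lt_nbhsl hx) => y hy; rewrite step_le0// ltW.
have [_ //] : has_deriv (@step R) x 0.
apply: near_has_deriv (has_deriv_cst 1 x).
by apply: filterS (lt_nbhsr hx) => y hy; rewrite step_ge1// ltW.
Qed.

Lemma bump_bounded : exists2 C, 0 <= C & forall x, `|bump x| <= C.
Proof.
have cb := smooth1_continuous smooth1_bump.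
have := @EVT_max R (fun x => `|bump x|) 0 1 ler01.
case.
  apply: continuous_subspaceT => x; apply: continuous_comp; first exact: cb.
  exact: norm_continuous.
move=> c _ hc; exists `|bump c|; first exact: normr_ge0.
move=> x.
have [x01|] := boolP (x \in `[0, 1]); first exact: hc.
rewrite in_itv /= negb_and -!ltNge => /orP h.
by rewrite bump_out// normr0.
Qed.

(** The derivative of the step rescaled so as to rise between [a] and [a + d].
    The argument of [bump] is kept in affine form, the form in which
    derivatives are computed. *)
Definition moll (d a x : R) := bump (d^-1 * x + - (d^-1 * a)) * d^-1.

Lemma moll_has_deriv d a x :
  has_deriv (fun x => step (d^-1 * x + - (d^-1 * a))) x (moll d a x).
Proof.
apply: (@has_deriv_comp _ (@step R) (fun x => d^-1 * x + - (d^-1 * a))).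
  exact: has_deriv_affine.
by split=> //; exact: smooth1_derivable smooth1_step _.
Qed.

Lemma moll_arg (d a x : R) : d^-1 * x + - (d^-1 * a) = (x - a) / d.
Proof. by rewrite -mulrBr mulrC. Qed.

Lemma moll_arg0 (d a : R) : d^-1 * a + - (d^-1 * a) = 0.
Proof. exact: subrr. Qed.

Lemma moll_arg1 (d a : R) : 0 < d -> d^-1 * (a + d) + - (d^-1 * a) = 1.
Proof. by move=> d0; rewrite moll_arg (addrC a) addrK divff// gt_eqF. Qed.

Lemma moll_out d a x : 0 < d -> x < a \/ a + d < x -> moll d a x = 0.
Proof.
move=> d0 h; rewrite /moll moll_arg bump_out ?mul0r//.
case: h => h; [left|right]; first by rewrite pmulr_llt0 ?invr_gt0// subr_lt0.
by rewrite ltr_pdivlMr// mul1r ltrBrDl.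
Qed.

Lemma moll_continuous d a : continuous (moll d a).
Proof.
apply: cont_mul; last by move=> x; exact: cvg_cst.
apply: smooth1_continuous => n; apply: derivable_n_affine.
exact: smooth1_bump.
Qed.

Lemma moll_integral d a : 0 < d ->
  (\int[@lebesgue_measure R]_x (moll d a x)%:E = 1)%E.
Proof.
move=> d0; have ad : a < a + d by rewrite ltrDl.
rewrite (integral_derivative ad (moll_has_deriv d a) (@moll_continuous d a)).
  by rewrite moll_arg0 moll_arg1// (step_le0 (lexx 0)) (step_ge1 (lexx 1)) subr0.
by move=> x; exact: moll_out.
Qed.

Definition moll2 (d x y : R) (p : R * R) := moll d x p.1 * moll d y p.2.

Lemma moll2_continuous d x y : continuous (moll2 d x y).
Proof. by apply: cont_mul; [apply: cont_fst|apply: cont_snd]; exact: moll_continuous. Qed.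

Lemma moll2_out d x y p : 0 < d -> moll2 d x y p != 0 ->
  (x <= p.1 <= x + d) && (y <= p.2 <= y + d).
Proof.
move=> d0; apply: contraR; rewrite negb_and !negb_and -!ltNge.
rewrite /moll2 => /orP[/orP h|/orP h]; first by rewrite (moll_out d0 h) mul0r.
by rewrite (moll_out d0 h) mulr0.
Qed.

Lemma moll2_L1 d x y : 0 < d -> L1 (moll2 d x y).
Proof.
move=> d0; apply: (@compact_support_L1 _ (`|x| + `|y| + d)).
  exact: moll2_continuous.
move=> p hp; apply/eqP/negPn/negP => /(moll2_out d0)/andP[/andP[h1 h2] /andP[h3 h4]].
have := ler_norm x; have := ler_norm y; have := ler_norm (- x); have := ler_norm (- y).
rewrite !normrN => k1 k2 k3 k4; have x0 := normr_ge0 x; have y0 := normr_ge0 y.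
case: hp; rewrite ltNge => /negP; apply; rewrite ler_norml; apply/andP; split; lra.
Qed.

Lemma moll2_integral d x y : 0 < d ->
  \int[(lebesgue2 R)]_p moll2 d x y p = 1.
Proof.
move=> d0; rewrite /Rintegral -(integral12_prod_meas1 (moll2_L1 x y d0)) /fubini_F.
transitivity (fine (\int[@lebesgue_measure R]_s (moll d x s)%:E)%E); last first.
  by rewrite moll_integral.
congr fine; apply: eq_integral => s _; rewrite /= /moll2 /=.
have dd : y < y + d by rewrite ltrDl.
rewrite (@integral_derivative _ (fun t => moll d x s * step (d^-1 * t + - (d^-1 * y))) _ y (y + d))//.
- by rewrite moll_arg0 moll_arg1// (step_le0 (lexx 0)) (step_ge1 (lexx 1)) mulr0 subr0 mulr1.
- move=> t; apply: has_deriv_eq.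
    exact: has_deriv_mul (has_deriv_cst _ _) (moll_has_deriv d y t).
  by rewrite mul0r add0r.
- by apply: cont_mul; [move=> t; exact: cvg_cst|exact: moll_continuous].
- by move=> t /(moll_out d0) ->; rewrite mulr0.
Qed.

(** The bound is free of [d]: the height is of order [d ^- 2] on a square of
    area [d ^+ 2]. *)
Lemma moll2_norm1 d x y C : 0 < d -> (forall x, `|bump x| <= C) ->
  norm1 (moll2 d x y) <= C * C.
Proof.
move=> d0 hC; have xd : x <= x + d by rewrite lerDl ltW.
have yd : y <= y + d by rewrite lerDl ltW.
have C0 : 0 <= C by exact: le_trans (hC 0).
have hm a s : `|moll d a s| <= C * d^-1.
  by rewrite /moll normrM (@ger0_norm _ d^-1) ?invr_ge0 ?(ltW d0)// ler_wpM2r ?invr_ge0 ?(ltW d0).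
pose r : R * R -> R := \1_(`[x, x + d] `*` `[y, y + d]).
have rL1 : L1 r by exact: rect_L1.
have -> : C * C = \int[(lebesgue2 R)]_p ((C * d^-1) * (C * d^-1) * r p).
  rewrite RintegralZl// /Rintegral integral_indic//; last first.
    by apply: measurableX; exact: measurable_itv.
  rewrite setIT [X in _ * fine X](lebesgue2_rect xd yd) /=.
  rewrite (addrC x d) (addrC y d) !addrK.
  by rewrite [RHS]mulrACA !divfK// gt_eqF.
apply: le_Rintegral => //.
- exact: normh_integrable (moll2_L1 x y d0).
- rewrite (_ : EFin \o _ = (fun q => ((C * d^-1) * (C * d^-1))%:E * (r q)%:E)%E).
    exact: integrableZl.
  by apply/funext => q /=; rewrite EFinM.
- move=> p _; have [->|ne] := eqVneq (moll2 d x y p) 0.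
    by rewrite normr0 !mulr_ge0// ?invr_ge0 ?(ltW d0)// /r indicE.
  have /andP[h1 h2] := moll2_out d0 ne.
  rewrite /r indicE mem_set ?mulr1; last by split; rewrite /= in_itv.
  by rewrite /moll2 normrM ler_pM.
Qed.

Lemma moll2_close (G : R * R -> R) d x y eta C : bounded_measurable G -> 0 < d ->
  (forall x, `|bump x| <= C) ->
  (forall c e, x <= c <= x + d -> y <= e <= y + d ->
    `|G (c, e) - G (x, y)| <= eta) ->
  `|wint (moll2 d x y) G - G (x, y)| <= eta * (C * C).
Proof.
move=> bG d0 hC hG; have mL := moll2_L1 x y d0.
have bc : bounded_measurable (fun=> -1 * G (x, y)).
  by split; [exact: measurable_cst|exists `|-1 * G (x, y)|].
have e0 : 0 <= eta.
  by apply: le_trans (hG x y _ _); rewrite ?normr_ge0// lexx lerDl ltW.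
have -> : wint (moll2 d x y) G - G (x, y) =
    wint (moll2 d x y) (fun p => G p + -1 * G (x, y)).
  rewrite wintD//; congr (_ + _).
  by rewrite /wint RintegralZl// moll2_integral// mulr1 mulN1r.
apply: le_trans (ler_wpM2l e0 (moll2_norm1 x y d0 hC)).
apply: (wint_le mL); first exact: bmD.
move=> [c e] /(moll2_out d0)/andP[h1 h2]; rewrite mulN1r.
exact: hG.
Qed.

Lemma Rintegral_mixed (W1 W2 W3 W4 : R * R -> R) :
  L1 W1 -> L1 W2 -> L1 W3 -> L1 W4 ->
  \int[(lebesgue2 R)]_p (W1 p - W2 p - (W3 p - W4 p)) =
  \int[(lebesgue2 R)]_p W1 p - \int[(lebesgue2 R)]_p W2 p -
  (\int[(lebesgue2 R)]_p W3 p - \int[(lebesgue2 R)]_p W4 p).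
Proof.
move=> i1 i2 i3 i4; rewrite !RintegralB//.
- exact: (integrableB _ i1 i2).
- exact: (integrableB _ i3 i4).
Qed.

Lemma four_close (w11 w01 w10 w00 g11 g01 g10 g00 E : R) :
  `|w11 - g11| <= E -> `|w01 - g01| <= E -> `|w10 - g10| <= E ->
  `|w00 - g00| <= E -> w11 - w01 - (w10 - w00) = 0 ->
  `|g11 - g01 - g10 + g00| <= 4 * E.
Proof.
rewrite !ler_norml => /andP[a1 a2] /andP[b1 b2] /andP[c1 c2] /andP[d1 d2] h.
by apply/andP; split; lra.
Qed.

(** The test function is a product of two differences of steps, which rise
    just after [x0] and [x1], respectively [y0] and [y1]. Its mixed derivative
    is a combination of approximate unit masses at the four corners, with the
    signs of the increment. *)
Lemma mixed_difference_zero (G : R * R -> R) : bounded_measurable G ->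
  continuous G ->
  (forall phi : testfun R, \int[(lebesgue2 R)]_p (G p * pd2 (pd1 phi) p) = 0) ->
  forall x0 x1 y0 y1, G (x1, y1) - G (x0, y1) - G (x1, y0) + G (x0, y0) = 0.
Proof.
move=> bG cG hG x0 x1 y0 y1; apply/eqP; rewrite -normr_eq0; apply/negPn/negP.
set D := G (x1, y1) - _ - _ + _ => ne.
have D0 : 0 < `|D| by rewrite lt_neqAle eq_sym ne normr_ge0.
have [C C0 hC] := bump_bounded.
have CC : 0 <= C * C by rewrite mulr_ge0.
(* four errors of size eta * (C * C) then add up to at most half of |D| *)
pose eta := `|D| / (8 * (C * C + 1)).
have e0 : 0 < eta by rewrite divr_gt0// mulr_gt0// ltr_wpDl.
have eC : eta * (C * C) * 8 <= `|D|.
  rewrite /eta -mulrA mulrAC ler_pdivrMr ?mulr_gt0 ?ltr_wpDl//.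
  by rewrite ler_wpM2l// mulrC ler_wpM2l// lerDl.
have near x y := near_square x y cG e0.
have [d [[[[d0 h11] h01] h10] h00]] := filter_ex (filterI (filterI (filterI
  (filterI (nbhs_right_gt (0 : R)) (near x1 y1)) (near x0 y1)) (near x1 y0)) (near x0 y0)).
have k11 := moll2_close bG d0 hC h11; have k01 := moll2_close bG d0 hC h01.
have k10 := moll2_close bG d0 hC h10; have k00 := moll2_close bG d0 hC h00.
pose S a (x : R) := step (d^-1 * x + - (d^-1 * a)).
pose A x := S x1 x + -1 * S x0 x.
pose B y := S y1 y + -1 * S y0 y.
have smooth a b : smooth1 (fun x => S a x + -1 * S b x).
  move=> n; apply: derivable_n_add; last apply: derivable_n_mul (derivable_n_cst _ _) _.
    by apply: derivable_n_affine; exact: smooth1_step.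
  by apply: derivable_n_affine; exact: smooth1_step.
have dS a b x : has_deriv (fun x => S a x + -1 * S b x) x (moll d a x - moll d b x).
  apply: has_deriv_eq.
    apply: has_deriv_add (moll_has_deriv d a x) _.
    exact: has_deriv_mul (has_deriv_cst _ _) (moll_has_deriv d b x).
  by rewrite mul0r add0r mulN1r.
have S0 a x : x < a -> S a x = 0.
  by move=> xa; rewrite /S moll_arg step_le0// ltW// pmulr_llt0 ?invr_gt0// subr_lt0.
have S1 a x : a + d < x -> S a x = 1.
  by move=> xa; rewrite /S moll_arg step_ge1// ltW// ltr_pdivlMr// mul1r ltrBrDl.
pose M := `|x0| + `|x1| + `|y0| + `|y1| + d.
have far a b x : `|a| + `|b| + d <= M -> M < `|x| -> S a x + -1 * S b x = 0.
  move=> hM hx; have := ler_norm a; have := ler_norm b.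
  have := ler_norm (- a); have := ler_norm (- b); rewrite !normrN.
  have na := normr_ge0 a; have nb := normr_ge0 b.
  have [x_ge0|x_lt0] := leP 0 x => l1 l2 l3 l4.
    rewrite ger0_norm// in hx.
    have e1 : a + d < x by clear -l1 l2 l3 l4 na nb hM hx; lra.
    have e2 : b + d < x by clear -l1 l2 l3 l4 na nb hM hx; lra.
    by rewrite (S1 _ _ e1) (S1 _ _ e2) mulr1 subrr.
  rewrite ltr0_norm// in hx.
  have e1 : x < a by clear -l1 l2 l3 l4 na nb hM hx d0; lra.
  have e2 : x < b by clear -l1 l2 l3 l4 na nb hM hx d0; lra.
  by rewrite (S0 _ _ e1) (S0 _ _ e2) mulr0 addr0.
have vphi : vanish_outside M (fun p => A p.1 * B p.2).
  have n1 := normr_ge0 x0; have n2 := normr_ge0 x1.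
  have n3 := normr_ge0 y0; have n4 := normr_ge0 y1.
  move=> p [] hp; first by rewrite {1}/A far ?mul0r// /M; lra.
  by rewrite {1}/B far ?mulr0// /M; lra.
have pdE : pd2 (pd1 (fun p => A p.1 * B p.2)) =
    (fun p => derive1 A p.1 * derive1 B p.2).
  rewrite pd1_tensor; last by move=> x; have [] := dS x1 x0 x.
  by rewrite pd2_tensor// => y; have [] := dS y1 y0 y.
pose phi : testfun R := TestFun
  (smooth2_tensor (smooth x1 x0 : smooth1 A) (smooth y1 y0 : smooth1 B))
  (vanish_compact vphi).
have := hG phi.
have -> : pd2 (pd1 phi) = (fun p => derive1 A p.1 * derive1 B p.2) by exact: pdE.
pose W x y p := G p * moll2 d x y p.
have iW x y : L1 (W x y).
  exact: (bm_integrable (moll2_L1 x y d0) bG).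
have -> : \int[(lebesgue2 R)]_p (G p * (derive1 A p.1 * derive1 B p.2)) =
    wint (moll2 d x1 y1) G - wint (moll2 d x0 y1) G -
    (wint (moll2 d x1 y0) G - wint (moll2 d x0 y0) G).
  rewrite -(Rintegral_mixed (iW x1 y1) (iW x0 y1) (iW x1 y0) (iW x0 y0)).
  apply: eq_Rintegral => p _.
  have [_ ->] := dS x1 x0 p.1; have [_ ->] := dS y1 y0 p.2.
  rewrite /W /moll2.
  move: (moll d x1 _) (moll d x0 _) (moll d y1 _) (moll d y0 _) (G p) => a1 a2 a3 a4 a5.
  by lra.
move=> h; have h4 := four_close k11 k01 k10 k00 h.
clear -D0 eC h4; rewrite -/D in h4.
by move: (eta * (C * C)) (`|D|) D0 eC h4 => E N; lra.
Qed.

End mollifier.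

(** * Uniqueness of the primitive *)

Section uniqueness.
Context {R : realType}.

(** The difference of two primitives has zero increments over all rectangles
    with finite corners. By continuity this remains true when two sides move
    to [-oo], where the difference vanishes. *)
Lemma dist12_inj (F G : \bar R * \bar R -> R) : Bc F -> Bc G ->
  dist12 F = dist12 G -> F = G.
Proof.
move=> [cF F0] [cG G0] FG.
pose H z := F z - G z.
have cH : continuous H by move=> z; apply: cvgB; [exact: cF|exact: cG].
have H0 s : H (-oo%E, s) = 0 /\ H (s, -oo%E) = 0.
  by rewrite /H; have [-> ->] := F0 s; have [-> ->] := G0 s; rewrite subrr.
have mix : forall x0 x1 y0 y1, H (embed2 (x1, y1)) - H (embed2 (x0, y1)) -
    H (embed2 (x1, y0)) + H (embed2 (x0, y0)) = 0.
  apply: (@mixed_difference_zero _ (fun p => H (embed2 p))).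
  - exact: embed2_bm.
  - exact: continuous_embed2.
  move=> phi; have := congr1 (fun f => f phi) FG; rewrite /dist12 => e.
  have iF := bm_integrable (mixed_pd_L1 phi) (embed2_bm cF).
  have iG := bm_integrable (mixed_pd_L1 phi) (embed2_bm cG).
  transitivity (\int[(lebesgue2 R)]_p (F (embed2 p) * pd2 (pd1 phi) p) -
    \int[(lebesgue2 R)]_p (G (embed2 p) * pd2 (pd1 phi) p)).
    rewrite -RintegralB//; apply: eq_Rintegral => p _; exact: mulrBl.
  by rewrite e subrr.
have Hxy (x1 y0 y1 : R) : H (x1%:E, y1%:E) = H (x1%:E, y0%:E).
  pose u x := H (x, y1%:E) - H (x, y0%:E).
  have cu : continuous u.
    by move=> x; apply: cvgB; [exact: (cont_edge1 cH)|exact: (cont_edge1 cH)].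
  have := @finite_dense _ u (H (x1%:E, y1%:E) - H (x1%:E, y0%:E)) cu.
  move=> /(_ _ -oo%E); rewrite /u; have [-> _] := H0 y1%:E; have [-> _] := H0 y0%:E.
  rewrite subrr => /(_ _)/esym/eqP; rewrite subr_eq0 => h; apply/eqP; apply: h => r.
  by have := mix r x1 y0 y1; rewrite /embed2 /=; lra.
have H1 (x y : R) : H (x%:E, y%:E) = 0.
  have := @finite_dense _ (fun t => H (x%:E, t)) (H (x%:E, y%:E)) (cont_edge2 cH).
  by move=> /(_ (fun r => Hxy x y r) -oo%E) <-; have [] := H0 x%:E.
have H2 (x : R) y : H (x%:E, y) = 0.
  exact: (finite_dense (cont_edge2 (x := x%:E) cH) (H1 x)).
apply/funext => -[x y]; apply/eqP; rewrite -subr_eq0; apply/eqP.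
exact: (finite_dense (cont_edge1 (y := y) cH) (fun r => H2 r y)).
Qed.

Lemma primitive_dist12 (F : \bar R * \bar R -> R) : Bc F ->
  primitive (dist12 F) = F.
Proof.
move=> BF; rewrite /primitive; case: xgetP => [G -> [BG e]|/(_ F)[]//].
exact/esym/dist12_inj.
Qed.

(** The reflection of a function in [Bc] vanishes on the upper edges instead
    of the lower ones. The correction restores membership in [Bc] and leaves
    the mixed derivative unchanged, being made of functions of one variable.
    *)
Definition normalize (G : \bar R * \bar R -> R) (z : \bar R * \bar R) : R :=
  G z - G (z.1, -oo%E) - G (-oo%E, z.2) + G (-oo%E, -oo%E).

Lemma normalize_Bc G : continuous G -> Bc (normalize G).
Proof.
move=> cG; split; last by move=> s; rewrite /normalize /=; split; lra.
move=> [x y]; apply: cvgD; last exact: cvg_cst.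
apply: cvgB; first (apply: cvgB; first exact: cG).
  apply: (@continuous_comp _ _ _ fst (fun x => G (x, -oo%E))); first exact: cvg_fst.
  exact: (cont_edge1 cG).
apply: (@continuous_comp _ _ _ snd (fun y => G (-oo%E, y))); first exact: cvg_snd.
exact: (cont_edge2 cG).
Qed.

Lemma cont_EFin (u : \bar R -> R) : continuous u ->
  continuous (fun x : R => u x%:E).
Proof.
move=> cu x; apply: (@continuous_comp _ _ _ (@EFin R) u); last exact: cu.
by apply: cvg_EFin; [exact: nearW|exact: cvg_id].
Qed.

Lemma dist12_normalize G : continuous G -> dist12 (normalize G) = dist12 G.
Proof.
move=> cG; apply/funext => phi; rewrite /dist12.
have ca := cont_EFin (cont_edge1 (y := -oo%E) cG).
have cb := cont_EFin (cont_edge2 (x := -oo%E) cG).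
have cc : continuous (fun x : R => - G (-oo%E, -oo%E)) by move=> x; exact: cvg_cst.
have [e1 e2] := dist12_edge phi ca cb; have [e3 _] := dist12_edge phi cc cc.
have hL := mixed_pd_L1 phi.
have bG := embed2_bm cG.
have iG := bm_integrable hL bG.
have cA : continuous (fun z : \bar R * \bar R => G (z.1, -oo%E)).
  move=> [x y]; apply: (@continuous_comp _ _ _ fst (fun x => G (x, -oo%E))).
    exact: cvg_fst.
  exact: (cont_edge1 cG).
have cB : continuous (fun z : \bar R * \bar R => G (-oo%E, z.2)).
  move=> [x y]; apply: (@continuous_comp _ _ _ snd (fun x => G (-oo%E, x))).
    exact: cvg_snd.
  exact: (cont_edge2 cG).
have cC : continuous (fun z : \bar R * \bar R => - G (-oo%E, -oo%E)).
  by move=> x; exact: cvg_cst.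
have iA := bm_integrable hL (embed2_bm cA).
have iB := bm_integrable hL (embed2_bm cB).
have iC := bm_integrable hL (embed2_bm cC).
transitivity (\int[(lebesgue2 R)]_p (G (embed2 p) * pd2 (pd1 phi) p) -
  \int[(lebesgue2 R)]_p (G (p.1%:E, -oo%E) * pd2 (pd1 phi) p) -
  (\int[(lebesgue2 R)]_p (G (-oo%E, p.2%:E) * pd2 (pd1 phi) p) +
  \int[(lebesgue2 R)]_p (- G (-oo%E, -oo%E) * pd2 (pd1 phi) p))).
  rewrite -RintegralD// -RintegralB// -RintegralB//.
  - by apply: eq_Rintegral => p _; rewrite /normalize /=; lra.
  - exact: (integrableB _ iG iA).
  - exact: (integrableD _ iB iC).
by rewrite e1 e2 e3 addr0 !subr0.
Qed.

End uniqueness.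

(** * The convolution through the primitive *)

Section convolution_value.
Context {R : realType}.
Implicit Types (F g k : \bar R * \bar R -> R) (p : R * R).

(** The convolution read on primitives, as [g * f] is defined;
    [prim_conv_left] identifies it with [f * g]. *)
Definition prim_conv F g p : R := xget 0 [set v | is_product_integral F (reflect2 g p) v].

(** Reflections exchange the edges at [+oo] and at [-oo], hence these
    variations of [g] bound [upper_variation (reflect2 g p)] for all [p] at
    once. *)
Definition lower_variation g : R :=
  fine (V1 g -oo%E) + fine (V2 g -oo%E) + fine (V12 g).

Lemma lower_variation_ge0 g : 0 <= lower_variation g.
Proof. by rewrite /lower_variation !addr_ge0// fine_ge0// ?V12_ge0 ?var1_ge0. Qed.

Lemma upper_variation_refl g p : HKBV g -> upper_variation (reflect2 g p) <= lower_variation g.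
Proof.
move=> hg; have [g12 _] := hg.
have f1 := HKBV_V1 -oo%E hg; have f2 := HKBV_V2 -oo%E hg.
have fle (a b : \bar R) : (0 <= a)%E -> (a <= b)%E -> (b < +oo)%E -> fine a <= fine b.
  move=> a0 ab bo; apply: (@fine_le_ub _ a b); [by rewrite a0|by []|exact: lexx].
rewrite /upper_variation /lower_variation; apply: lerD; first apply: lerD.
- by apply: fle => //; [exact: var1_ge0|exact: (var1_refl p.1 (fun x => g (x, -oo%E)))].
- by apply: fle => //; [exact: var1_ge0|exact: (var1_refl p.2 (fun x => g (-oo%E, x)))].
- by apply: fle => //; [exact: V12_ge0|exact: V12_refl].
Qed.

Lemma good_grid2_ge0 F e N a t M b s : good_grid2 F e N a t M b s -> 0 <= e.
Proof.
move=> [[ga gb] _ _ h]; apply: le_trans (normr_ge0 _) (h 0%N 0%N (a 0%N) (b 0%N) _ _ _ _) => //.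
  by rewrite /iset1 /= lexx ltW//; have [_ _ ->] := ga.
by rewrite /iset1 /= lexx ltW//; have [_ _ ->] := gb.
Qed.

Lemma prim_convP F g p : Bc F -> HKBV g ->
  [/\ is_product_integral F (reflect2 g p) (prim_conv F g p),
    (forall e N a t M b s, good_grid2 F e N a t M b s ->
      `|prim_conv F g p - mixed_sum F (reflect2 g p) N a t M b s| <= e * lower_variation g) &
    forall c, (forall z, `|F z| <= c) ->
      `|prim_conv F g p| <= c * (`|g (-oo%E, -oo%E)| + lower_variation g)].
Proof.
move=> BF hg; have hk := HKBV_refl p hg; have [k12 _] := hk.
have [v [v1 v2 v3]] := product_integral_ex BF k12 (HKBV_V1 +oo%E hk) (HKBV_V2 +oo%E hk).
have -> : prim_conv F g p = v.
  rewrite /prim_conv; case: xgetP => [w -> hw|/(_ v)]; last by [].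
  exact: product_integral_unique hw v1.
have lb := upper_variation_refl p hg.
split => // [e N a t M b s gd|c hc].
  apply: le_trans (v2 _ _ _ _ _ _ _ gd) _.
  by rewrite ler_wpM2l// (good_grid2_ge0 gd).
apply: le_trans (v3 _ hc) _.
apply: ler_wpM2l; first exact: le_trans (normr_ge0 _) (hc (0%E, 0%E)).
exact: lerD (lexx _) lb.
Qed.

Lemma is_iintP F g v : Bc F -> is_iint (dist12 F) g v <-> is_product_integral F g v.
Proof.
move=> BF; rewrite /is_iint primitive_dist12//; split; first by case.
by move=> h; split => //; exists F.
Qed.

Lemma iintE F g v : Bc F -> is_product_integral F g v -> iint (dist12 F) g = v.
Proof.
move=> BF hv; rewrite /iint; case: xgetP => [w -> /(is_iintP _ _ BF) hw|/(_ v)].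
  exact: product_integral_unique hw hv.
by case; apply/is_iintP.
Qed.

Lemma refl_continuous_joint (s0 : \bar R) (x0 : R) :
  (fun z : \bar R * R => (z.2%:E - z.1)%E) z @[z --> (s0, x0)] --> (x0%:E - s0)%E.
Proof.
apply: cvgeD; first exact: fin_num_adde_defr.
- by apply: cvg_EFin; [exact: nearW|exact: cvg_snd].
- by apply: cvgeN; exact: cvg_fst.
Qed.

Lemma refl_continuous (x0 : R) : continuous (fun s : \bar R => (x0%:E - s)%E).
Proof.
move=> s; apply: cvgeD; first exact: fin_num_adde_defr.
- exact: cvg_cst.
- by apply: cvgeN; exact: cvg_id.
Qed.

Lemma reflect2_continuous F p : continuous F -> continuous (reflect2 F p).
Proof.
move=> cF [x y]; apply: (@continuous_comp _ _ _
  (fun z : \bar R * \bar R => (p.1%:E - z.1, p.2%:E - z.2)%E) F); last exact: cF.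
have e1 : (fun z : \bar R * \bar R => (p.1%:E - z.1)%E) z @[z --> (x, y)]
    --> (p.1%:E - x)%E.
  exact: (cvg_comp _ _ (@cvg_fst _ _ (nbhs x) (nbhs y) _) (@refl_continuous p.1 x)).
have e2 : (fun z : \bar R * \bar R => (p.2%:E - z.2)%E) z @[z --> (x, y)]
    --> (p.2%:E - y)%E.
  exact: (cvg_comp _ _ (@cvg_snd _ _ (nbhs x) (nbhs y) _) (@refl_continuous p.2 y)).
exact: (cvg_pair e1 e2).
Qed.

Definition refl_grid (x : R) N (a : nat -> \bar R) (i : nat) : \bar R :=
  (x%:E - a (N - i)%N)%E.

Lemma is_grid_refl x N a : is_grid N a -> is_grid N (refl_grid x N a).
Proof.
move=> [a0 aN ai]; split; rewrite /refl_grid ?subn0 ?subnn ?a0 ?aN//.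
by move=> i iN; rewrite lte_reflect subnS; have := ai (N - i).-1;
  rewrite prednK ?subn_gt0//; apply; lia.
Qed.

Lemma iset_refl_grid x N a i z : (i < N)%N ->
  iset1 (cell1 (refl_grid x N a) i) z -> iset1 (cell1 a (N - i.+1)) (x%:E - z)%E.
Proof.
move=> iN; rewrite /iset1 /= /refl_grid => /andP[h1 h2].
rewrite -(reflK x z) lee_reflect in h1; rewrite -(reflK x z) lee_reflect in h2.
by rewrite h2 /= subnSK.
Qed.

(** Up to a constant, [normalize (reflect2 F p)] combines the values of [F] at
    three points, one in a reflected cell and its projections to the upper
    edges; hence the factor 3. *)
Lemma good_grid2_refl F e N a t M b s p : good_grid2 F e N a t M b s ->
  good_grid2 (normalize (reflect2 F p)) (3 * e)
    N (refl_grid p.1 N.+1 a) (refl_grid p.1 N t)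
    M (refl_grid p.2 M.+1 b) (refl_grid p.2 M s).
Proof.
move=> [[ga gb] [t0 tN] [s0 sM] h]; split.
- by split; exact: is_grid_refl.
- by rewrite /refl_grid subn0 subnn t0 tN.
- by rewrite /refl_grid subn0 subnn s0 sM.
move=> i j x y iN jM xi yj.
have [_ aN _] := ga; have [_ bM _] := gb.
have xi' := iset_refl_grid iN xi; have yj' := iset_refl_grid jM yj.
rewrite !subSS in xi' yj'.
have iN' : (N - i < N.+1)%N by lia.
have jM' : (M - j < M.+1)%N by lia.
have h1 := h _ _ _ _ iN' jM' xi' yj'.
have oN : iset1 (cell1 a N) +oo%E by rewrite /iset1 /= aN !leey.
have oM : iset1 (cell1 b M) +oo%E by rewrite /iset1 /= bM !leey.
have h2 := h _ _ _ _ iN' (ltnSn M) xi' oM.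
have h3 := h _ _ _ _ (ltnSn N) jM' oN yj'.
rewrite sM in h2; rewrite tN in h3.
rewrite /normalize /reflect2 /refl_grid /= !reflK.
move: h1 h2 h3; move: (F _) (F _) (F _) (F _) (F _) (F _) (F _) => u1 u2 u3 u4 u5 u6 u7.
rewrite !ler_norml => /andP[? ?] /andP[? ?] /andP[? ?].
by apply/andP; split; lra.
Qed.

(** Both indices are reversed, and the corrections of [normalize] cancel in
    the increments of rectangles. *)
Lemma mixed_sum_refl F g N a t M b s p :
  mixed_sum (normalize (reflect2 F p)) g N (refl_grid p.1 N.+1 a) (refl_grid p.1 N t)
    M (refl_grid p.2 M.+1 b) (refl_grid p.2 M s) =
  mixed_sum F (reflect2 g p) N a t M b s.
Proof.
rewrite /mixed_sum (reindex_inj rev_ord_inj) /=; apply: eq_bigr => i _.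
rewrite (reindex_inj rev_ord_inj) /=; apply: eq_bigr => j _.
have hi := ltn_ord i; have hj := ltn_ord j.
have ei : (N - (N - i.+1) = i.+1)%N by lia.
have ei' : (N - (N - i.+1).+1 = i)%N by lia.
have ej : (M - (M - j.+1) = j.+1)%N by lia.
have ej' : (M - (M - j.+1).+1 = j)%N by lia.
rewrite /incr2 /normalize /reflect2 /refl_grid /= !reflK !subSS !ei !ei' !ej !ej'.
by congr (_ * _); lra.
Qed.

(** Grids for both products correspond by reflection and give equal
    approximating sums. *)
Lemma prim_conv_left F g p : Bc F -> HKBV g ->
  is_product_integral (normalize (reflect2 F p)) g (prim_conv F g p).
Proof.
move=> BF hg; have [cF _] := BF; have [g12 _] := hg.
have BP := normalize_Bc (reflect2_continuous (p := p) cF).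
have [v [v1 v2 _]] := product_integral_ex BP g12 (HKBV_V1 +oo%E hg) (HKBV_V2 +oo%E hg).
suff -> : prim_conv F g p = v by [].
have [_ w2 _] := prim_convP p BF hg.
apply/eqP; rewrite -subr_eq0 -normr_eq0; apply/negPn/negP => ne.
have D0 : 0 < `|prim_conv F g p - v| by rewrite lt_neqAle eq_sym ne normr_ge0.
have V0 : 0 <= lower_variation g + 3 * upper_variation g.
  by rewrite addr_ge0 ?lower_variation_ge0// mulr_ge0// upper_variation_ge0.
have [e e0 he] := small_factor V0 D0.
have [N [a [t [M [b [s gd]]]]]] := good_grid2_ex cF e0.
have h1 := w2 _ _ _ _ _ _ _ gd.
have h2 := v2 _ _ _ _ _ _ _ (good_grid2_refl p gd).
rewrite mixed_sum_refl in h2.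
have := ler_normB (prim_conv F g p - mixed_sum F (reflect2 g p) N a t M b s)
  (v - mixed_sum F (reflect2 g p) N a t M b s).
rewrite (_ : _ - _ - _ = prim_conv F g p - v); last by lra.
by lra.
Qed.

End convolution_value.

(** * Finite approximations and limits at infinity *)

Section finite_approximation.
Context {R : realType}.
Implicit Types (F g : \bar R * \bar R -> R) (p : R * R).

Definition shift_sum (T : finType) (c : T -> R) (al : T -> R * R)
    (k : \bar R * \bar R -> R) p : R :=
  \sum_t c t * k ((p.1 - (al t).1)%:E, (p.2 - (al t).2)%:E).

Lemma grid_finite N (a : nat -> \bar R) i : is_grid N.+1 a -> (i < N)%N ->
  a i.+1 = (fine (a i.+1))%:E.
Proof.
move=> ga iN; have [a0 aN _] := ga.
have h1 : (-oo < a i.+1)%E by rewrite -a0; apply: (grid_lt ga); lia.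
have h2 : (a i.+1 < +oo)%E by rewrite -aN; apply: (grid_lt ga); lia.
by case: (a i.+1) h1 h2.
Qed.

(** Summation by parts against the constant 1. *)
Lemma mixed_total F N (t : nat -> \bar R) M (s : nat -> \bar R) : Bc F ->
  t 0%N = -oo%E -> t N = +oo%E -> s 0%N = -oo%E -> s M = +oo%E ->
  \sum_(i < N) \sum_(j < M) incr2 F ((t i, t i.+1), (s j, s j.+1)) =
  F (+oo%E, +oo%E).
Proof.
move=> [_ F0] t0 tN s0 sM.
have := @abel2 R N M (fun i j => F (t i, s j)) (fun _ _ => 1).
rewrite /= t0 s0 tN sM => h; rewrite [RHS](_ : _ = F (+oo%E, +oo%E) * 1
  - \sum_(i < N.+1) F (t i, +oo%E) * (1 - 1)
  - \sum_(j < M.+1) F (+oo%E, s j) * (1 - 1)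
  + \sum_(i < N.+1) \sum_(j < M.+1) F (t i, s j) * (1 + 1 - 1 - 1)).
  rewrite h => [|j|i].
  - by apply: eq_bigr => i _; apply: eq_bigr => j _; rewrite mulr1.
  - by have [] := F0 (s j).
  - by have [] := F0 (t i).
rewrite mulr1 !big1 ?subr0 ?addr0// => i _; rewrite ?subrr ?mulr0//.
by rewrite big1// => j _; rewrite addrK subrr mulr0.
Qed.

(** The grid is adapted to [F] alone, and [reflect2 g p] is sampled at its
    inner points, which are finite. *)
Lemma conv_approx F e : Bc F -> 0 < e ->
  exists (T : finType) (c : T -> R) (al : T -> R * R),
    \sum_t c t = F (+oo%E, +oo%E) /\
    forall g p, HKBV g ->
      `|prim_conv F g p - shift_sum c al g p| <= e * lower_variation g.
Proof.
move=> BF e0; have [cF _] := BF.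
have [N [a [t [M [b [s gd]]]]]] := good_grid2_ex cF e0.
have [[ga gb] [t0 tN] [s0 sM] _] := gd.
pose c (k : 'I_N * 'I_M) := incr2 F ((t k.1, t k.1.+1), (s k.2, s k.2.+1)).
pose al (k : 'I_N * 'I_M) := (fine (a k.1.+1), fine (b k.2.+1)).
exists ('I_N * 'I_M)%type, c, al; split.
  rewrite -(mixed_total BF t0 tN s0 sM).
  by rewrite (pair_bigA _ (fun (i : 'I_N) (j : 'I_M) =>
    incr2 F ((t i, t i.+1), (s j, s j.+1)))).
move=> g p hg; have [_ h _] := prim_convP p BF hg.
have := h _ _ _ _ _ _ _ gd; congr (`|_ - _| <= _).
rewrite /mixed_sum /shift_sum (pair_bigA _ (fun (i : 'I_N) (j : 'I_M) =>
  incr2 F ((t i, t i.+1), (s j, s j.+1)) * reflect2 g p (a i.+1, b j.+1))) /=.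
apply: eq_bigr => -[i j] _ /=; rewrite /c /= /reflect2 /=; congr (_ * g (_, _)).
  by rewrite (grid_finite ga (ltn_ord i)).
by rewrite (grid_finite gb (ltn_ord j)).
Qed.

Lemma conv_approx1 F g e : Bc F -> HKBV g -> 0 < e ->
  exists (T : finType) (c : T -> R) (al : T -> R * R),
    \sum_t c t = F (+oo%E, +oo%E) /\
    forall p, `|prim_conv F g p - shift_sum c al g p| <= e.
Proof.
move=> BF hg e0; have [d d0 hd] := small_factor (lower_variation_ge0 g) e0.
have [T [c [al [h1 h2]]]] := conv_approx BF d0.
by exists T, c, al; split => // p; apply: le_trans (ltW hd); exact: h2.
Qed.

Lemma shift_sum_dist (T : finType) (c : T -> R) (al : T -> R * R) g m1 m2 p q :
  dominated g m1 m2 ->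
  `|shift_sum c al g p - shift_sum c al g q| <=
  \sum_t `|c t| * `|m1 (p.1 - (al t).1)%:E - m1 (q.1 - (al t).1)%:E| +
  \sum_t `|c t| * `|m2 (p.2 - (al t).2)%:E - m2 (q.2 - (al t).2)%:E|.
Proof.
move=> d; rewrite /shift_sum -sumrB -big_split /=.
apply: le_trans (ler_norm_sum _ _ _) _; apply: ler_sum => t _.
rewrite -mulrBr normrM -mulrDr ler_wpM2l//; exact: dominated_dist.
Qed.

End finite_approximation.

Section limits_at_infinity.
Context {R : realType}.

Global Instance nbhs_infty_proper (e : bool) : ProperFilter (@nbhs_infty R e).
Proof. by case: e; exact: _. Qed.

Lemma cvg_sum0 (T : finType) (U : Type) (Fl : set_system U) (phi : T -> U -> R) :
  Filter Fl -> (forall t, phi t x @[x --> Fl] --> 0) ->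
  (fun x => \sum_t phi t x) x @[x --> Fl] --> 0.
Proof.
move=> FF h; elim: (index_enum T) => [|t r ih].
  under eq_fun do rewrite big_nil; exact: cvg_cst.
under eq_fun do rewrite big_cons.
have := cvgD (h t) ih; rewrite addr0; exact.
Qed.

Lemma shift_infty (u : R -> R) (e : bool) (r L : R) :
  u x @[x --> @nbhs_infty R e] --> L ->
  (fun x => u (x - r)) x @[x --> @nbhs_infty R e] --> L.
Proof.
move=> h A /h; case: e {h} => -[M [_ hM]]; exists (M + r); split; rewrite ?num_real// => x /= hx.
  by apply: hM; rewrite ltrBrDr.
by apply: hM; rewrite ltrBlDr.
Qed.

Lemma weighted_infty (T : finType) (w al : T -> R) (u : R -> R) (e : bool)
    (L d : R) : u x @[x --> @nbhs_infty R e] --> L -> 0 < d ->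
  \forall x \near @nbhs_infty R e, \sum_t `|w t| * `|u (x - al t) - L| <= d.
Proof.
move=> h d0.
have : (fun x => \sum_t `|w t| * `|u (x - al t) - L|) x
    @[x --> @nbhs_infty R e] --> 0.
  apply: cvg_sum0 => t.
  have h0 : (fun x => `|u (x - al t) - L|) x @[x --> @nbhs_infty R e] --> `|L - L|.
    by apply: cvg_norm; apply: cvgB; [exact: shift_infty|exact: cvg_cst].
  rewrite subrr normr0 in h0.
  by rewrite -(mulr0 `|w t|); exact: cvgM (cvg_cst _) h0.
move/cvgrPdist_le => /(_ _ d0); apply: filterS => x.
by rewrite sub0r normrN; apply: le_trans; exact: ler_norm.
Qed.

End limits_at_infinity.

Section corner_limits.
Context {R : realType}.
Variables (F g : \bar R * \bar R -> R).
Hypotheses (BF : Bc F) (hg : HKBV g).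

(** Near a corner all the translates [g (p - al t)] are close to the same
    limit [l], and their coefficients add up to [F (+oo, +oo)]. *)
Lemma corner_cvg (e1 e2 : bool) : exists l : R,
  (g \o @embed2 R) x @[x --> @corner R e1 e2] --> l /\
  prim_conv F g x @[x --> @corner R e1 e2] --> l * F (+oo%E, +oo%E).
Proof.
have [m1 [m2 d]] := HKBV_dominated hg; have [n1 n2 _ _] := d.
have [L1 hL1] := ndec_infty_cvg e1 n1; have [L2 hL2] := ndec_infty_cvg e2 n2.
pose E S err := exists x y : R, S = g (x%:E, y%:E) /\
  err = `|m1 x%:E - L1| + `|m2 y%:E - L2|.
(* for all x and y, l is within |m1 x - L1| + |m2 y - L2| of g (x, y) *)
have [||l hl] := @squeeze_ex R E.
- by do 2 eexists; exists 0, 0; split; reflexivity.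
- move=> _ _ _ _ [x [y [-> ->]]] [x' [y' [-> ->]]].
  apply: le_trans (dominated_dist _ _ _ _ d) _.
  have := ler_normB (m1 x%:E - L1) (m1 x'%:E - L1).
  have := ler_normB (m2 y%:E - L2) (m2 y'%:E - L2).
  rewrite (_ : m1 x%:E - L1 - _ = m1 x%:E - m1 x'%:E); last by lra.
  rewrite (_ : m2 y%:E - L2 - _ = m2 y%:E - m2 y'%:E); last by lra.
  by lra.
have gl (x y : R) : `|g (x%:E, y%:E) - l| <= `|m1 x%:E - L1| + `|m2 y%:E - L2|.
  by apply: hl; exists x, y.
have lim_of (v : R * R -> R) (L : R) : (forall e : R, 0 < e -> exists B1 B2 : R -> Prop,
    [/\ \forall x \near @nbhs_infty R e1, B1 x, \forall y \near @nbhs_infty R e2, B2 y &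
      forall x y, B1 x -> B2 y -> `|v (x, y) - L| <= e]) ->
    v x @[x --> @corner R e1 e2] --> L.
  move=> h; apply/cvgrPdist_le => e e0; have [B1 [B2 [b1 b2 hB]]] := h e e0.
  by exists (B1, B2) => //= -[x y] [/= x1 y2]; rewrite distrC; exact: hB.
exists l; split; apply: lim_of => e e0.
  have e2' : 0 < e / 2 by rewrite divr_gt0.
  exists (fun x => `|m1 x%:E - L1| <= e / 2), (fun y => `|m2 y%:E - L2| <= e / 2).
  split.
  - by have /cvgrPdist_le/(_ _ e2') := hL1; apply: filterS => x; rewrite distrC.
  - by have /cvgrPdist_le/(_ _ e2') := hL2; apply: filterS => x; rewrite distrC.
  - move=> x y h1 h2; apply: le_trans (gl x y) _; lra.
have e4 : 0 < e / 4 by rewrite divr_gt0.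
have [T [c [al [sc hc]]]] := conv_approx1 BF hg e4.
exists (fun x => \sum_t `|c t| * `|(m1 \o EFin) (x - (al t).1) - L1| <= e / 4),
  (fun y => \sum_t `|c t| * `|(m2 \o EFin) (y - (al t).2) - L2| <= e / 4).
split.
- exact: (weighted_infty c (fun t => (al t).1) hL1 e4).
- exact: (weighted_infty c (fun t => (al t).2) hL2 e4).
move=> x y h1 h2.
have h3 := hc (x, y).
have h4 : `|shift_sum c al g (x, y) - l * F (+oo%E, +oo%E)| <= e / 4 + e / 4.
  apply: le_trans (lerD h1 h2); rewrite -sc mulrC mulr_suml /shift_sum -sumrB.
  rewrite -big_split /=; apply: le_trans (ler_norm_sum _ _ _) _.
  apply: ler_sum => t _; rewrite -mulrBr normrM -mulrDr ler_wpM2l//.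
have := ler_normD (prim_conv F g (x, y) - shift_sum c al g (x, y))
  (shift_sum c al g (x, y) - l * F (+oo%E, +oo%E)).
rewrite addrA subrK; lra.
Qed.

(** Finitely many translates of [m1] control the increments in [x], each with
    a limit at infinity, and [y] does not enter; likewise with [m2]. *)
Lemma conv_cauchy (e : bool) (eps : R) : 0 < eps ->
  (\forall x \near @nbhs_infty R e & x' \near @nbhs_infty R e, forall y,
     `|prim_conv F g (x, y) - prim_conv F g (x', y)| <= eps) /\
  (\forall y \near @nbhs_infty R e & y' \near @nbhs_infty R e, forall x,
     `|prim_conv F g (x, y) - prim_conv F g (x, y')| <= eps).
Proof.
move=> e0; have e4 : 0 < eps / 4 by rewrite divr_gt0.
have [m1 [m2 d]] := HKBV_dominated hg; have [n1 n2 _ _] := d.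
have [L1 hL1] := ndec_infty_cvg e n1; have [L2 hL2] := ndec_infty_cvg e n2.
have [T [c [al [sc hc]]]] := conv_approx1 BF hg e4.
have tri p q A B : `|shift_sum c al g p - shift_sum c al g q| <= A + B ->
    A <= eps / 4 -> B <= eps / 4 -> `|prim_conv F g p - prim_conv F g q| <= eps.
  move=> h hA hB; have h1 := hc p; have h2 := hc q.
  rewrite (_ : prim_conv F g p - _ = (prim_conv F g p - shift_sum c al g p) -
    (prim_conv F g q - shift_sum c al g q) +
    (shift_sum c al g p - shift_sum c al g q)); last by lra.
  apply: le_trans (ler_normD _ _) _.
  have := ler_normB (prim_conv F g p - shift_sum c al g p)
    (prim_conv F g q - shift_sum c al g q).
  by lra.
have zero (u : R -> R) (a : R) : \sum_t `|c t| * `|u (a - (al t).2) - u (a - (al t).2)| = 0.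
  by rewrite big1// => t _; rewrite subrr normr0 mulr0.
have zero' (u : R -> R) (a : R) : \sum_t `|c t| * `|u (a - (al t).1) - u (a - (al t).1)| = 0.
  by rewrite big1// => t _; rewrite subrr normr0 mulr0.
have split_dist (u : R -> R) (be : T -> R) (L x x' : R) :
    \sum_t `|c t| * `|u (x - be t) - u (x' - be t)| <=
    \sum_t `|c t| * `|u (x - be t) - L| + \sum_t `|c t| * `|u (x' - be t) - L|.
  rewrite -big_split /=; apply: ler_sum => t _; rewrite -mulrDr ler_wpM2l//.
  rewrite (_ : u (x - be t) - _ = (u (x - be t) - L) - (u (x' - be t) - L)); last by lra.
  exact: ler_normB.
have w1 := weighted_infty c (fun t => (al t).1) hL1 e4.
have w2 := weighted_infty c (fun t => (al t).2) hL2 e4.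
split.
  exists ([set x | \sum_t `|c t| * `|(m1 \o EFin) (x - (al t).1) - L1| <= eps / 4], [set x | \sum_t `|c t| * `|(m1 \o EFin) (x - (al t).1) - L1| <= eps / 4]) => //=.
  move=> [x x'] [/= h h'] y; apply: tri h h'.
  apply: le_trans (shift_sum_dist c al (x, y) (x', y) d) _ => /=.
  by rewrite (zero (m2 \o EFin) y) addr0; exact: (split_dist (m1 \o EFin)).
exists ([set x | \sum_t `|c t| * `|(m2 \o EFin) (x - (al t).2) - L2| <= eps / 4], [set x | \sum_t `|c t| * `|(m2 \o EFin) (x - (al t).2) - L2| <= eps / 4]) => //=.
move=> [y y'] [/= h h'] x; apply: tri h h'.
apply: le_trans (shift_sum_dist c al (x, y) (x, y') d) _ => /=.
by rewrite (zero' (m1 \o EFin) x) add0r; exact: (split_dist (m2 \o EFin)).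
Qed.

End corner_limits.

Section linearity.
Context {R : realType}.

Lemma HS1_sub (F F' u : \bar R -> R) A A' : is_HS1 F u A -> is_HS1 F' u A' ->
  is_HS1 (fun x => F x - F' x) u (A - A').
Proof.
move=> h h' eps e0; have e2 : 0 < eps / 2 by rewrite divr_gt0.
have [ga [[oa fa] ha]] := h _ e2; have [gb [[ob fb] hb]] := h' _ e2.
exists (fun x => ga x `&` gb x); split.
  split=> [x|r z []]; last by move=> /fa.
  have [op1 x1] := oa x; have [op2 x2] := ob x.
  by split; [exact: openI|split].
move=> n I t [dI fI].
have k1 : fine_division1 ga I t.
  by split => // i; have [? s] := fI i; split => // x /s [].
have k2 : fine_division1 gb I t.
  by split => // i; have [? s] := fI i; split => // x /s [].
have := ha _ _ _ k1; have := hb _ _ _ k2.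
under [X in _ -> _ -> `|X - _| < _]eq_bigr do rewrite mulrBl.
rewrite sumrB; set S := \sum_(i < n) _; set S' := \sum_(i < n) _ => l1 l2.
rewrite (_ : S' - S - _ = (S' - A) - (S - A')); last by lra.
by apply: le_lt_trans (ler_normB _ _) _; lra.
Qed.

Lemma HS2_sub (F F' g : \bar R * \bar R -> R) A A' : is_HS2 F g A ->
  is_HS2 F' g A' -> is_HS2 (fun x => F x - F' x) g (A - A').
Proof.
move=> h h' eps e0; have e2 : 0 < eps / 2 by rewrite divr_gt0.
have [ga [[oa fa] ha]] := h _ e2; have [gb [[ob fb] hb]] := h' _ e2.
exists (fun x => ga x `&` gb x); split.
  split=> [x|r z []]; last by move=> /fa.
  have [op1 x1] := oa x; have [op2 x2] := ob x.
  by split; [exact: openI|split].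
move=> n I t [dI fI].
have k1 : fine_division2 ga I t.
  by split => // i; have [? s] := fI i; split => // x /s [].
have k2 : fine_division2 gb I t.
  by split => // i; have [? s] := fI i; split => // x /s [].
have := ha _ _ _ k1; have := hb _ _ _ k2.
under [X in _ -> _ -> `|X - _| < _]eq_bigr do rewrite mulrBl.
rewrite sumrB; set S := \sum_(i < n) _; set S' := \sum_(i < n) _ => l1 l2.
rewrite (_ : S' - S - _ = (S' - A) - (S - A')); last by lra.
by apply: le_lt_trans (ler_normB _ _) _; lra.
Qed.

Lemma product_integral_sub (F F' g : \bar R * \bar R -> R) v v' : is_product_integral F g v -> is_product_integral F' g v' ->
  is_product_integral (fun z => F z - F' z) g (v - v').
Proof.
move=> [A1 [A2 [A3 [h1 h2 h3 ->]]]] [B1 [B2 [B3 [k1 k2 k3 ->]]]].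
exists (A1 - B1), (A2 - B2), (A3 - B3); split.
- exact: HS1_sub.
- exact: HS1_sub.
- exact: HS2_sub.
- by lra.
Qed.

Lemma Bc_sub (F F' : \bar R * \bar R -> R) : Bc F -> Bc F' ->
  Bc (fun z => F z - F' z).
Proof.
move=> [cF F0] [cF' F0']; split.
  by move=> z; apply: cvgB; [exact: cF|exact: cF'].
by move=> s; have [-> ->] := F0 s; have [-> ->] := F0' s; rewrite subrr.
Qed.

Lemma product_integral_le (P g : \bar R * \bar R -> R) v c : Bc P -> HKBV g -> is_product_integral P g v ->
  (forall z, `|P z| <= c) -> `|v| <= c * (`|g (+oo%E, +oo%E)| + upper_variation g).
Proof.
move=> BP hg hv hc; have [g12 _] := hg.
have [w [w1 _ w3]] := product_integral_ex BP g12 (HKBV_V1 +oo%E hg) (HKBV_V2 +oo%E hg).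
by rewrite (product_integral_unique hv w1); exact: w3.
Qed.

Lemma normalize_dist (G G' : \bar R * \bar R -> R) c : (forall z, `|G z - G' z| <= c) ->
  forall z, `|normalize G z - normalize G' z| <= 4 * c.
Proof.
move=> h z; have := h z; have := h (z.1, -oo%E); have := h (-oo%E, z.2).
have := h (-oo%E, -oo%E); rewrite /normalize !ler_norml.
by move=> /andP[? ?] /andP[? ?] /andP[? ?] /andP[? ?]; apply/andP; split; lra.
Qed.

(** The product integral is linear in the primitive; [normalize] accounts for
    the factor 4. *)
Lemma prim_conv_lip (F g : \bar R * \bar R -> R) (c : R) p q : Bc F -> HKBV g ->
  (forall z, `|reflect2 F p z - reflect2 F q z| <= c) ->
  `|prim_conv F g p - prim_conv F g q| <=
    4 * c * (`|g (+oo%E, +oo%E)| + upper_variation g).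
Proof.
move=> BF hg hc; have [cF _] := BF.
have Bp := normalize_Bc (reflect2_continuous (p := p) cF).
have Bq := normalize_Bc (reflect2_continuous (p := q) cF).
apply: (product_integral_le (Bc_sub Bp Bq) hg).
  by apply: product_integral_sub; exact: prim_conv_left.
exact: normalize_dist.
Qed.

(** Since [(s, x) |-> x - s] is continuous on the extended line times the
    line, [F (x - s, .)] is near [F (x0 - s, .)] locally in [s], hence for all
    [s] by compactness. *)
Lemma reflection_uniform (F : \bar R * \bar R -> R) (x0 d : R) : continuous F -> 0 < d ->
  \forall x \near x0, forall s w : \bar R,
    `|F ((x%:E - s)%E, w) - F ((x0%:E - s)%E, w)| <= d.
Proof.
move=> cF d0; have d2 : 0 < d / 2 by rewrite divr_gt0.
apply: (@ereal_tube R R (nbhs x0) (fun s x => forall w : \bar R,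
   `|F ((x%:E - s)%E, w) - F ((x0%:E - s)%E, w)| <= d)) => s0.
have := @refl_continuous_joint R s0 x0.
move=> /(_ _ (continuous_uniform2 cF (x0%:E - s0)%E d2)) [[A B] /= [nA nB] h].
exists (A, B) => // -[s x] [/= As Bx] w.
have h1 := h (s, x) (conj As Bx) w.
have h2 := h (s, x0) (conj As (nbhs_singleton nB)) w.
move: h1 h2 => /=; set u := F _; set v := F _; set v' := F _ => h1 h2.
rewrite (_ : u - v' = (u - v) - (v' - v)); last by lra.
by apply: le_trans (ler_normB _ _) _; lra.
Qed.

Lemma conv_locally_uniform (F g : \bar R * \bar R -> R) (x0 eps : R) : Bc F -> HKBV g ->
  0 < eps ->
  (\forall x \near x0, forall y,
     `|prim_conv F g (x, y) - prim_conv F g (x0, y)| <= eps) /\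
  (\forall y \near x0, forall x,
     `|prim_conv F g (x, y) - prim_conv F g (x, x0)| <= eps).
Proof.
move=> BF hg e0; have [cF _] := BF.
have K0 : 0 <= 4 * (`|g (+oo%E, +oo%E)| + upper_variation g).
  by rewrite mulr_ge0// addr_ge0// upper_variation_ge0.
have [d d0 hd] := small_factor K0 e0.
have fin p q : (forall z, `|reflect2 F p z - reflect2 F q z| <= d) ->
    `|prim_conv F g p - prim_conv F g q| <= eps.
  move=> /(prim_conv_lip BF hg) h; apply: le_trans h _; apply: le_trans (ltW hd).
  by rewrite mulrCA mulrA.
split.
  apply: filterS (reflection_uniform x0 cF d0) => x hx y; apply: fin => -[s w].
  exact: hx.
apply: filterS (reflection_uniform x0 (continuous_swap2 cF) d0) => y hy x.
by apply: fin => -[s w]; exact: hy.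
Qed.

End linearity.

(** * Continuity and associativity *)

Section extension.
Context {R : realType}.

Lemma nbhs_finite2 (z : \bar R * \bar R) (U : set (\bar R * \bar R)) :
  nbhs z U -> exists p : R * R, U (embed2 p).
Proof.
move=> [[A B] /= [nA nB] AB].
have [r Ar] := nbhs_finite nA; have [s Bs] := nbhs_finite nB.
by exists (r, s); apply: AB.
Qed.

(** The extension at [z] is the limit of [u] along the finite points near [z].
    It is continuous because a neighbourhood where [u] oscillates little is
    also one of the points near [z]. *)
Lemma extend_by_oscillation (u : R * R -> R) :
  (forall (z : \bar R * \bar R) (e : R), 0 < e -> exists U, nbhs z U /\ forall p q,
     U (embed2 p) -> U (embed2 q) -> `|u p - u q| <= e) ->
  extends_continuously u.
Proof.
move=> osc.
pose E (z : \bar R * \bar R) S err := exists U p, [/\ nbhs z U, U (embed2 p), S = u p &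
  forall p q, U (embed2 p) -> U (embed2 q) -> `|u p - u q| <= err].
have /choice[H hH] : forall z, exists L, forall S err, E z S err -> `|S - L| <= err.
  move=> z; apply: squeeze_ex.
    have [U [nO hO]] := osc z 1 ltr01; have [p Op] := nbhs_finite2 nO.
    by exists (u p), 1, U, p; split.
  move=> _ e _ e' [U [p [nO Op -> h]]] [U' [p' [nO' Op' -> h']]].
  have [q [Oq U'q]] := nbhs_finite2 (filterI nO nO').
  apply: (@le_trans _ _ (`|u p - u q| + `|u q - u p'|)).
    rewrite (_ : u p - u p' = (u p - u q) + (u q - u p')); last by lra.
    exact: ler_normD.
  by apply: lerD; [exact: h|exact: h'].
have Hbnd z U p e : nbhs z U -> U (embed2 p) ->
    (forall p q, U (embed2 p) -> U (embed2 q) -> `|u p - u q| <= e) ->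
    `|u p - H z| <= e.
  by move=> nO Op h; apply: hH; exists U, p; split.
exists H; split.
  move=> z; apply/cvgrPdist_le => e e0; have e2 : 0 < e / 2 by rewrite divr_gt0.
  have [U [nO hO]] := osc z _ e2.
  have nn : \forall z' \near z, nbhs z' U by exact: nbhs_interior.
  apply: filterS nn => z' nO'; have [p Op] := nbhs_finite2 nO.
  have h1 := Hbnd _ _ _ _ nO Op hO; have h2 := Hbnd _ _ _ _ nO' Op hO.
  rewrite (_ : H z - H z' = (u p - H z') - (u p - H z)); last by lra.
  by apply: le_trans (ler_normB _ _) _; lra.
move=> p; apply/eqP; rewrite -subr_eq0 -normr_eq0; apply/negPn/negP => ne.
have D0 : 0 < `|H (embed2 p) - u p| / 2.
  by rewrite divr_gt0// lt_neqAle eq_sym ne normr_ge0.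
have [U [nO hO]] := osc (embed2 p) _ D0.
have := Hbnd _ _ _ _ nO (nbhs_singleton nO) hO.
by rewrite distrC; lra.
Qed.

End extension.

Section convolution_extends.
Context {R : realType}.
Variables (F g : \bar R * \bar R -> R).
Hypotheses (BF : Bc F) (hg : HKBV g).

(** The finite points near [x0] are the reals near a real number, or the reals
    near an end of the line. *)
Lemma nbhs_finite_pairs (x0 : \bar R) (Q : R -> R -> Prop) :
  (forall r : R, \forall x \near r & x' \near r, Q x x') ->
  (forall e, \forall x \near @nbhs_infty R e & x' \near @nbhs_infty R e, Q x x') ->
  exists O, nbhs x0 O /\ forall x x' : R, O x%:E -> O x'%:E -> Q x x'.
Proof.
move=> hfin hinf; case: x0 => [r| |].
- have [[A B] /= [nA nB] AB] := hfin r.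
  exists [set z | if z is x%:E then A x /\ B x else False]; split.
    by apply: (filterS _ (filterI nA nB)).
  by move=> x x' [Ax _] [_ Bx']; exact: (AB (x, x')).
- have [[A B] /= [[M [_ hA]] [M' [_ hB]]] AB] := hinf true.
  exists [set z | (Num.max M M')%:E < z]%E; split.
    by exists (Num.max M M'); split; [exact: num_real|].
  move=> x x' /=; rewrite !lte_fin !gt_max => /andP[h1 _] /andP[_ h2].
  by apply: (AB (x, x')); split; [exact: hA|exact: hB].
- have [[A B] /= [[M [_ hA]] [M' [_ hB]]] AB] := hinf false.
  exists [set z | z < (Num.min M M')%:E]%E; split.
    by exists (Num.min M M'); split; [exact: num_real|].
  move=> x x' /=; rewrite !lte_fin !lt_min => /andP[h1 _] /andP[_ h2].
  by apply: (AB (x, x')); split; [exact: hA|exact: hB].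
Qed.

Lemma near_pair (P : R -> Prop) (Q : R -> R -> Prop) (r : R) :
  (\forall x \near r, P x) -> (forall x x', P x -> P x' -> Q x x') ->
  \forall x \near r & x' \near r, Q x x'.
Proof. by move=> nP h; exists (P, P) => // -[x x'] [/= ? ?]; exact: h. Qed.

Lemma conv_extends : extends_continuously (prim_conv F g).
Proof.
apply: extend_by_oscillation => -[x0 y0] e e0.
have e2 : 0 < e / 2 by rewrite divr_gt0.
have e4 : 0 < e / 4 by rewrite divr_gt0.
have [||O1 [nO1 h1]] := @nbhs_finite_pairs x0 (fun x x' => forall y,
    `|prim_conv F g (x, y) - prim_conv F g (x', y)| <= e / 2).
- move=> r; apply: near_pair (proj1 (conv_locally_uniform r BF hg e4)) _ => x x' hx hx' y.
  rewrite (_ : prim_conv F g (x, y) - _ = (prim_conv F g (x, y) - prim_conv F g (r, y)) -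
    (prim_conv F g (x', y) - prim_conv F g (r, y))); last by lra.
  by apply: le_trans (ler_normB _ _) _; move: (hx y) (hx' y); lra.
- by move=> b; exact: (proj1 (conv_cauchy BF hg b e2)).
have [||O2 [nO2 h2]] := @nbhs_finite_pairs y0 (fun y y' => forall x,
    `|prim_conv F g (x, y) - prim_conv F g (x, y')| <= e / 2).
- move=> r; apply: near_pair (proj2 (conv_locally_uniform r BF hg e4)) _ => y y' hy hy' x.
  rewrite (_ : prim_conv F g (x, y) - _ = (prim_conv F g (x, y) - prim_conv F g (x, r)) -
    (prim_conv F g (x, y') - prim_conv F g (x, r))); last by lra.
  by apply: le_trans (ler_normB _ _) _; move: (hy x) (hy' x); lra.
- by move=> b; exact: (proj2 (conv_cauchy BF hg b e2)).
exists (O1 `*` O2); split; first by exists (O1, O2).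
move=> [x y] [x' y'] [/= x1 y1] [/= x1' y1'].
rewrite (_ : prim_conv F g (x, y) - _ = (prim_conv F g (x, y) - prim_conv F g (x', y)) +
  (prim_conv F g (x', y) - prim_conv F g (x', y'))); last by lra.
by apply: le_trans (ler_normD _ _) _; move: (h1 _ _ x1 x1' y) (h2 _ _ y1 y1' x'); lra.
Qed.

Lemma conv_bounded c p : (forall z, `|F z| <= c) ->
  `|prim_conv F g p| <= c * (`|g (-oo%E, -oo%E)| + lower_variation g).
Proof. by move=> hc; have [_ _] := prim_convP p BF hg; apply. Qed.

Lemma conv_supnorm : (supnorm (prim_conv F g) <= supnorm F * bvnorm g)%E.
Proof.
have [cF _] := BF; have [c hc] := continuous_bounded2 cF.
have sF0 : (0 <= supnorm F)%E.
  apply: le_trans (ereal_sup_ubound _); last by exists (0%E, 0%E).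
  by rewrite lee_fin.
have sFc : (supnorm F <= c%:E)%E.
  by apply: ge_ereal_sup => _ [z _ <-]; rewrite lee_fin.
have fF : supnorm F \is a fin_num.
  by rewrite ge0_fin_numE// (le_lt_trans sFc)// ltry.
have hF z : `|F z| <= fine (supnorm F).
  by rewrite -lee_fin fineK//; apply: ereal_sup_ubound; exists z.
apply: ge_ereal_sup => _ [p _ <-].
apply: (@le_trans _ _ (fine (supnorm F) * (`|g (-oo%E, -oo%E)| + lower_variation g))%:E).
  by rewrite lee_fin; exact: conv_bounded.
rewrite EFinM fineK//; apply: lee_wpmul2l => //.
have [g12 _] := hg; have f1 := HKBV_V1 -oo%E hg; have f2 := HKBV_V2 -oo%E hg.
rewrite /lower_variation /bvnorm !addrA !EFinD.
have fin (v : \bar R) : (0 <= v)%E -> (v < +oo)%E -> (fine v)%:E = v.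
  by move=> v0 vo; rewrite fineK// ge0_fin_numE.
rewrite (fin _ (var1_ge0 _) f1) (fin _ (var1_ge0 _) f2) (fin _ (V12_ge0 _) g12).
apply: leeD => //; apply: leeD; first apply: leeD.
- by apply: ereal_sup_ubound; exists (-oo%E, -oo%E).
- by apply: ereal_sup_ubound; exists -oo%E.
- by apply: ereal_sup_ubound; exists -oo%E.
Qed.

End convolution_extends.

Section associativity.
Context {R : realType}.
Variables (F g : \bar R * \bar R -> R) (h : R * R -> R).
Hypotheses (BF : Bc F) (hg : HKBV g) (hh : L1 h).

Lemma shifted_conv_bm (p : R * R) :
  bounded_measurable (fun q : R * R => prim_conv F g (p.1 - q.1, p.2 - q.2)).
Proof.
have [cF _] := BF; have [c hc] := continuous_bounded2 cF.
split; last first.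
  by exists (c * (`|g (-oo%E, -oo%E)| + lower_variation g)) => q; exact: conv_bounded.
have [H [cH Hu]] := conv_extends BF hg.
apply: continuous_measurable2 => -[x y].
apply: (@continuous_comp _ _ _ (fun q : R * R => (p.1 - q.1, p.2 - q.2)) (prim_conv F g)).
  have e1 : (fun q : R * R => p.1 - q.1) q @[q --> (x, y)] --> p.1 - x.
    by apply: cvgB; [exact: cvg_cst|exact: cvg_fst].
  have e2 : (fun q : R * R => p.2 - q.2) q @[q --> (x, y)] --> p.2 - y.
    by apply: cvgB; [exact: cvg_cst|exact: cvg_snd].
  exact: (cvg_pair e1 e2).
rewrite (_ : prim_conv F g = fun q => H (embed2 q)); last by apply/funext => q; rewrite Hu.
exact: continuous_embed2.
Qed.

(** The formula of [conv_approx] for [Lconv_ext g h] is the integral against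
    [h] of the formula for the translates of [g], with the same coefficients.
    *)
Lemma conv_assoc : prim_conv F (Lconv_ext g h) = Lconv (prim_conv F g) h.
Proof.
have hgh := HKBV_Lconv_ext hg hh.
apply/funext => p; apply/eqP; rewrite -subr_eq0 -normr_eq0; apply/negPn/negP => ne.
set D := prim_conv F (Lconv_ext g h) p - _ in ne.
have D0 : 0 < `|D| by rewrite lt_neqAle eq_sym ne normr_ge0.
have V0 : 0 <= lower_variation (Lconv_ext g h) + lower_variation g * norm1 h.
  by rewrite addr_ge0 ?lower_variation_ge0// mulr_ge0 ?lower_variation_ge0// norm1_ge0.
have [e e0 he] := small_factor V0 D0.
have [T [c [al [_ hc]]]] := conv_approx BF e0.
pose z t : \bar R * \bar R := ((p.1 - (al t).1)%:E, (p.2 - (al t).2)%:E).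
have bz t : bounded_measurable (fun q => c t * transl g q (z t)).
  by apply: bmZ; exact: transl_bm.
have sumE : shift_sum c al (Lconv_ext g h) p =
    wint h (fun q => \sum_t c t * transl g q (z t)).
  rewrite wint_sum//; apply: eq_bigr => t _; rewrite wintZ//.
  exact: transl_bm.
have h1 := hc (Lconv_ext g h) p hgh.
have h2 : `|shift_sum c al (Lconv_ext g h) p - Lconv (prim_conv F g) h p| <=
    e * lower_variation g * norm1 h.
  have bN : bounded_measurable (fun q : R * R => -1 * prim_conv F g (p.1 - q.1, p.2 - q.2)).
    by apply: bmZ; exact: shifted_conv_bm.
  have -> : shift_sum c al (Lconv_ext g h) p - Lconv (prim_conv F g) h p =
      wint h (fun q => (\sum_t c t * transl g q (z t)) +
        -1 * prim_conv F g (p.1 - q.1, p.2 - q.2)).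
    rewrite (wintD hh (bm_sum bz) bN) wintZ//; last exact: shifted_conv_bm.
    by rewrite sumE mulN1r.
  apply: (wint_le hh); first exact: bmD (bm_sum bz) bN.
  move=> q _; rewrite mulN1r distrC.
  have := hc g (p.1 - q.1, p.2 - q.2) hg; congr (`|_ - _| <= _).
  apply: eq_bigr => t _; rewrite /transl /z /=; congr (_ * g (_, _)).
    by congr EFin; lra.
  by congr EFin; lra.
have := ler_normD (prim_conv F (Lconv_ext g h) p - shift_sum c al (Lconv_ext g h) p)
  (shift_sum c al (Lconv_ext g h) p - Lconv (prim_conv F g) h p).
rewrite addrA subrK -/D => h3.
move: he h1 h2 h3; rewrite mulrDr mulrA.
move: (e * lower_variation (Lconv_ext g h)) (e * lower_variation g * norm1 h) => a b.
by lra.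
Qed.

End associativity.

Theorem theorem14p1 (R : realType) (f : functional R)
    (F g : \bar R * \bar R -> R)
    (hf : Ac f) (hF : Bc F) (hfF : f = dist12 F) (hg : HKBV g) :
  [/\ (* (a) *)
      forall p : R * R, Aconv_exists f g p,
      (* (b) *)
      (forall p : R * R, Arconv_exists g f p) /\ Aconv f g = Arconv g f,
      (* (c) *)
      (supnorm (Aconv f g) <= alexiewicz f * bvnorm g)%E,
      (* (d) *)
      extends_continuously (Aconv f g) /\
      (forall e1 e2 : bool,
        [/\ cvg ((g \o @embed2 R) @ @corner R e1 e2),
            Aconv f g @ @corner R e1 e2 -->
              corner_lim g e1 e2 * F (+oo%E, +oo%E) &
            ((g \o @embed2 R) @ @corner R e1 e2 --> g (@infty R e1, @infty R e2) ->
             Aconv f g @ @corner R e1 e2 -->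
               g (@infty R e1, @infty R e2) * F (+oo%E, +oo%E))]) &
      (* (e) *)
      forall h : R * R -> R, L1 h ->
        [/\ forall p : R * R, Aconv_exists f (Lconv_ext g h) p,
            Aconv f (Lconv_ext g h) = Lconv (Aconv f g) h &
            extends_continuously (Lconv (Aconv f g) h)]].
Proof.
have [cF _] := hF.
have fF : primitive f = F by rewrite hfF primitive_dist12.
have BP p := normalize_Bc (reflect2_continuous (p := p) cF).
have rf p : reflect_dist f p = dist12 (normalize (reflect2 F p)).
  by rewrite /reflect_dist fF dist12_normalize//; exact: reflect2_continuous.
have existsA k p : HKBV k -> Aconv_exists f k p.
  move=> hk; exists (prim_conv F k p); rewrite rf; apply/is_iintP => //.
  exact: prim_conv_left.
have AE k : HKBV k -> Aconv f k = prim_conv F k.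
  move=> hk; apply/funext => p; rewrite /Aconv rf.
  by apply: iintE => //; exact: prim_conv_left.
have existsR p : Arconv_exists g f p.
  exists (prim_conv F g p); rewrite hfF; apply/is_iintP => //.
  by have [] := prim_convP p hF hg.
have RE : Arconv g f = prim_conv F g.
  apply/funext => p; rewrite /Arconv hfF.
  by apply: iintE => //; have [] := prim_convP p hF hg.
split.
- by move=> p; exact: existsA.
- by split; [exact: existsR|rewrite RE AE].
- by rewrite AE// /alexiewicz fF; exact: conv_supnorm.
- rewrite AE//; split; first exact: conv_extends.
  move=> e1 e2; have [l [hl hu]] := corner_cvg hF hg e1 e2.
  have el : corner_lim g e1 e2 = l by apply: cvg_lim hl; exact: Rhausdorff.
  split.
  + by apply/cvg_ex; exists l.
  + by rewrite el.
  + move=> hl'; suff -> : g (@infty R e1, @infty R e2) = l by [].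
    by apply: cvg_unique hl' hl; exact: Rhausdorff.
- move=> h hh; have hgh := HKBV_Lconv_ext hg hh.
  rewrite !AE// -conv_assoc//; split => //.
  + by move=> p; exact: existsA.
  + exact: conv_extends.
Qed.
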